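(* Let $G=\mathrm{GL}_n(\mathbb{K})$, let $L=\prod_{i=1}^m \mathrm{GL}_{p_i}(\mathbb{K})$ with $p_i\geq 1$ and $\sum_{i=1}^m p_i=n$ be a Levi subgroup of $G$ (embedded block-diagonally), and let $P\subsetneq G$ and $Q=\prod_{i=1}^m Q_i\subset L$, with $Q_i\subset \mathrm{GL}_{p_i}(\mathbb{K})$, be parabolic subgroups. The double flag variety $\mathfrak{X}=L/Q\times G/P$, with the diagonal action of $L$, has a finite number of $L$-orbits if and only if one of the following conditions is satisfied. (A) $m=1$, that is, $L=G$. (B) $m=2$ and, up to switching the roles of $Q_1$ and $Q_2$, the triple $(P,Q_1,Q_2)$ satisfies one of the following: (B1) $P$ is maximal, $Q_1$ any, $Q_2$ any; (B2) $P$ has 3 blocks, $Q_1$ is maximal, $Q_2$ has at most 4 blocks; (B3) $P$ has 3 blocks, $Q_1=\mathrm{GL}_{p_1}$ or $Q_1$ is mirabolic, $Q_2$ any; (B4) $P$ has 3 blocks, one of which has size 2, $Q_1=\mathrm{GL}_{p_1}$ or $Q_1$ is maximal, $Q_2$ any; (B5) $P$ has 3 blocks, one of which has size 1, $Q_1$ any, $Q_2$ any; (B6) $P$ has 4 blocks, $Q_1=\mathrm{GL}_2$ (so $p_1=2$), $Q_2$ any; (B7) $P$ has 4 blocks, $Q_1=\mathrm{GL}_{p_1}$, $Q_2$ has at most 4 blocks; (B8) $P$ has 4 blocks, one of which has size 1, $Q_1=\mathrm{GL}_{p_1}$, $Q_2$ any; (B9) $P$ has 5 or 6 blocks, $Q_1=\mathrm{GL}_{p_1}$,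 $Q_2$ is maximal; (B10) $P$ any, $Q_1=\mathrm{GL}_1$ (so $p_1=1$), $Q_2$ any; (B11) $P$ any, $Q_1=\mathrm{GL}_2$ (so $p_1=2$), $Q_2$ is maximal; (B12) $P$ any, $Q_1=\mathrm{GL}_{p_1}$, and $Q_2=\mathrm{GL}_{p_2}$ or $Q_2$ is mirabolic. (C) $m=3$, $P$ is maximal, conjugate to $P_{(d_1,d_2)}$ (i.e. $G/P$ is a Grassmannian variety), and, up to switching the roles of $Q_1,Q_2,Q_3$, the quadruple $(P,Q_1,Q_2,Q_3)$ satisfies one of the following: (C1) $\min\{d_1,d_2\}\leq 2$, and $Q_1,Q_2,Q_3$ any; (C2) $\min\{d_1,d_2\}=3$, $Q_1=\mathrm{GL}_{p_1}$, $Q_2$ any, $Q_3$ any; (C3) $\min\{d_1,d_2\}\in\{4,5\}$, $Q_1=\mathrm{GL}_{p_1}$, $Q_2$ is maximal, $Q_3$ any; (C4) $Q_1=\mathrm{GL}_1$ (so $p_1=1$), $Q_2$ any, $Q_3$ any ($d_1,d_2$ arbitrary); (C5) $Q_1=\mathrm{GL}_2$ (so $p_1=2$), $Q_2$ is maximal, $Q_3$ any ($d_1,d_2$ arbitrary); (C6) $Q_1=\mathrm{GL}_{p_1}$, $Q_2=\mathrm{GL}_{p_2}$ or $Q_2$ is mirabolic, $Q_3$ any ($d_1,d_2$ arbitrary); (C7) $Q_1=\mathrm{GL}_{p_1}$, $Q_2$ is maximal, $Q_3$ has at most 4 blocks ($d_1,d_2$ arbitrary). (D) $m\geq 4$ and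 $P$ is mirabolic, i.e. $G/P$ is a projective space.
   Context: $\mathbb{K}$ is an algebraically closed field of characteristic zero, and $\mathrm{GL}_k$ means $\mathrm{GL}_k(\mathbb{K})$. Every parabolic subgroup of $\mathrm{GL}_N$ is conjugate to a unique $P_{\mathbf d}$, the subgroup of invertible blockwise upper triangular matrices with diagonal blocks of sizes $d_1,\dots,d_k$, for a composition $\mathbf d=(d_1,\dots,d_k)$ of $N$ into positive parts. One says that it has $k$ blocks, of sizes $d_1,\dots,d_k$. It is called maximal if $k=2$, and mirabolic if $\mathbf d=(1,N-1)$ or $\mathbf d=(N-1,1)$ with $k=2$ (the stabilizer of a line or of a hyperplane). The whole group $\mathrm{GL}_N$ has one block. ''Any'' means any parabolic subgroup of the relevant group (for $P$, any parabolic subgroup $P\subsetneq G$). ''One of which has size $s$'' means at least one block has size $s$. *)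

(* Defs.v *)
From HB Require Import structures.
From mathcomp Require Import all_boot all_order all_algebra.
From mathcomp Require Import boolp classical_sets functions cardinality.

Set Implicit Arguments.
Unset Strict Implicit.
Unset Printing Implicit Defensive.

Import GRing.Theory.
Local Open Scope classical_set_scope.
Local Open Scope ring_scope.

Definition is_composition (N : nat) (d : seq nat) : bool :=
  (0%N \notin d) && (sumn d == N).

Section Groups.
Variable K : fieldType.

Definition GL (N : nat) : set 'M[K]_N := [set M | M \in unitmx].

(* [reshape_index d i] is the index of the block of [d] containing [i]. *)
Definition std_parabolic (N : nat) (d : seq nat) : set 'M[K]_N :=
  [set M | M \in unitmx /\
    forall i j : 'I_N, (reshape_index d j < reshape_index d i)%N -> M i j = 0].

(* The block sizes are a function of the underlying subgroup, because a
   parabolic subgroup is conjugate to a unique [std_parabolic d]; recording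
   them in the structure involves no choice. *)
Record parabolic (N : nat) := Parabolic {
  par_set :> set 'M[K]_N;
  blocks : seq nat;
  blocks_composition : is_composition N blocks;
  par_conj : exists2 g : 'M[K]_N, g \in unitmx &
    par_set = [set g *m h *m invmx g | h in std_parabolic blocks]
}.

Definition nblocks (N : nat) (H : parabolic N) : nat := size (blocks H).

Definition is_maximal (N : nat) (H : parabolic N) : Prop := nblocks H = 2%N.

(* For [N <= 1] this is never satisfied, as block sizes are positive. *)
Definition is_mirabolic (N : nat) (H : parabolic N) : Prop :=
  blocks H = [:: 1%N; (N - 1)%N] \/ blocks H = [:: (N - 1)%N; 1%N].

Definition is_whole (N : nat) (H : parabolic N) : Prop := par_set H = @GL N.

Definition translate (N : nat) (g : 'M[K]_N) (A : set 'M[K]_N) :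
  set 'M[K]_N := [set g *m x | x in A].

Definition coset_space (N : nat) (G H : set 'M[K]_N) : set (set 'M[K]_N) :=
  [set translate g H | g in G].

Definition block_diag_prod (m : nat) (p : 'I_m -> nat)
    (A : forall i, set 'M[K]_(p i)) : set 'M[K]_(\sum_i p i) :=
  [set \mxdiag_i B i | B in [set B : forall i, 'M[K]_(p i) | forall i, A i (B i)]].

Definition levi (m : nat) (p : 'I_m -> nat) : set 'M[K]_(\sum_i p i) :=
  block_diag_prod (fun i => @GL (p i)).

Definition double_flag_variety (m : nat) (p : 'I_m -> nat)
    (P : parabolic (\sum_i p i)) (Q : forall i, parabolic (p i)) :
    set (set 'M[K]_(\sum_i p i) * set 'M[K]_(\sum_i p i)) :=
  coset_space (@levi m p) (block_diag_prod (fun i => par_set (Q i)))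
  `*` coset_space (@GL (\sum_i p i)) P.

Definition diag_orbit (N : nat) (L : set 'M[K]_N)
    (x : set 'M[K]_N * set 'M[K]_N) : set (set 'M[K]_N * set 'M[K]_N) :=
  [set (translate l x.1, translate l x.2) | l in L].

Definition finitely_many_orbits (m : nat) (p : 'I_m -> nat)
    (P : parabolic (\sum_i p i)) (Q : forall i, parabolic (p i)) : Prop :=
  finite_set [set diag_orbit (@levi m p) x | x in double_flag_variety P Q].

Variant caseB (n p1 p2 : nat) (P : parabolic n)
    (Q1 : parabolic p1) (Q2 : parabolic p2) : Prop :=
| B1 of is_maximal P
| B2 of nblocks P = 3%N & is_maximal Q1 & (nblocks Q2 <= 4)%N
| B3 of nblocks P = 3%N & is_whole Q1 \/ is_mirabolic Q1
| B4 of nblocks P = 3%N & 2%N \in blocks P & is_whole Q1 \/ is_maximal Q1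
| B5 of nblocks P = 3%N & 1%N \in blocks P
| B6 of nblocks P = 4%N & p1 = 2%N & is_whole Q1
| B7 of nblocks P = 4%N & is_whole Q1 & (nblocks Q2 <= 4)%N
| B8 of nblocks P = 4%N & 1%N \in blocks P & is_whole Q1
| B9 of nblocks P = 5%N \/ nblocks P = 6%N & is_whole Q1 & is_maximal Q2
| B10 of p1 = 1%N & is_whole Q1
| B11 of p1 = 2%N & is_whole Q1 & is_maximal Q2
| B12 of is_whole Q1 & is_whole Q2 \/ is_mirabolic Q2.

Variant caseC (d1 d2 p1 p2 p3 : nat)
    (Q1 : parabolic p1) (Q2 : parabolic p2) (Q3 : parabolic p3) : Prop :=
| C1 of (minn d1 d2 <= 2)%N
| C2 of minn d1 d2 = 3%N & is_whole Q1
| C3 of minn d1 d2 = 4%N \/ minn d1 d2 = 5%N & is_whole Q1 & is_maximal Q2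
| C4 of p1 = 1%N & is_whole Q1
| C5 of p1 = 2%N & is_whole Q1 & is_maximal Q2
| C6 of is_whole Q1 & is_whole Q2 \/ is_mirabolic Q2
| C7 of is_whole Q1 & is_maximal Q2 & (nblocks Q3 <= 4)%N.

End Groups.

(* Main.v *)
(** Conjugating everything to standard position, the orbits are the double
    cosets [A^* \ GL_n / B^*], where [A] and [B] are the algebras of matrices
    that are block upper triangular for the blocks of [Q] and of [P]. An invertible matrix
    [g] is an object of an exact category: a morphism [g -> g'] is a pair
    [(a, b)] in [A x B] with [a g = g' b], and [Ext(g, g)] is
    [M / (A g + g B)]. The Euler form depends only on the dimension vector,
    which gives the quadratic (Tits) form [q]. There are finitely
    many double cosets if and only if [q > 0] on every nonzero dimension
    vector of a direct summand.

    If [q > 0], a minimality argument of Ringel shows that an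
    indecomposable object has only scalar endomorphisms, hence no
    self-extensions; such an object is determined by its dimension vector, because
    isomorphisms deform along the line joining two of them.
    Conversely, if [q <= 0] on some summand, the group acting there has, modulo scalars,
    smaller dimension than the space of matrices, so infinitely many orbits,
    and cancellation of one-dimensional summands transports them to [n].

    Finally, [2 q = sum_i (p_i^2 + sum_j q_ij^2) + sum_j d_j^2 - n^2]. In the
    listed cases it is positive; otherwise the dimension vector dominates one
    of finitely many null vectors, those of the extended Dynkin stars
    [D4~, E6~, E7~, E8~]. *)

Require Import Defs.
From HB Require Import structures.
From mathcomp Require Import all_boot all_order all_algebra.
From mathcomp Require Import boolp zify.

Set Implicit Arguments.
Unset Strict Implicit.
Unset Printing Implicit Defensive.

Import GRing.Theory.
Local Open Scope ring_scope.

(** * Corners of the matrix ring *)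

Section Corner.
Variables (K : fieldType) (n : nat).
Implicit Types (I J L : {set 'I_n}) (a b c g h u v w x y z : 'M[K]_n).
Implicit Types (R : rel 'I_n).

(** All objects are kept inside one ring of [n] by [n] matrices: an object is a matrix invertible
    from the coordinates [J] to the coordinates [I], its dimension vector counts the elements of [I]
    and [J] in each block, and after a base change a direct sum becomes a partition of both index
    sets. The obstacle is that kernels of endomorphisms are not spanned by coordinate vectors. A
    unit of the incidence algebra moves them to coordinates because both preorders are disjoint
    unions of chains: echelon reduction then needs no coefficient outside the algebra. This gives
    Fitting's lemma, and with it Ringel's argument, in matrix form. Geometry is replaced by
    polynomials: a polynomial kernel vector along a line of matrices stands for the openness of a
    rigid orbit, and a count of linearly independent functions on a finite grid stands for the
    comparison of dimensions. *)

Definition idm I : 'M[K]_n := \matrix_(i, j) ((i == j) && (i \in I))%:R.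

Lemma idm_mulE I p (a : 'M[K]_(n, p)) i j :
  (idm I *m a) i j = if i \in I then a i j else 0.
Proof.
rewrite mxE (bigD1 i) //= mxE eqxx /= big1 ?addr0.
  by case: ifP => _; rewrite (mul1r, mul0r).
by move=> k ki; rewrite mxE eq_sym (negPf ki) mul0r.
Qed.

Lemma mul_idmE I p (a : 'M[K]_(p, n)) i j :
  (a *m idm I) i j = if j \in I then a i j else 0.
Proof.
rewrite mxE (bigD1 j) //= mxE eqxx /= big1 ?addr0.
  by case: ifP => _; rewrite (mulr1, mulr0).
by move=> k ki; rewrite mxE (negPf ki) mulr0.
Qed.

Lemma idmM I J : idm I *m idm J = idm (I :&: J).
Proof.
apply/matrixP => i j; rewrite idm_mulE !mxE inE.
by case: (i \in I); rewrite ?andbF.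
Qed.

Lemma idm_id I : idm I *m idm I = idm I. Proof. by rewrite idmM setIid. Qed.

Lemma idmT : idm [set: 'I_n] = 1%:M.
Proof. by apply/matrixP => i j; rewrite !mxE in_setT andbT. Qed.

Lemma idm0 : idm set0 = 0.
Proof. by apply/matrixP => i j; rewrite !mxE in_set0 andbF. Qed.

Lemma idmMS I J : I \subset J -> idm I *m idm J = idm I.
Proof. by move=> sIJ; rewrite idmM (setIidPl sIJ). Qed.

Lemma idmMSr I J : I \subset J -> idm J *m idm I = idm I.
Proof. by move=> sIJ; rewrite idmM (setIidPr sIJ). Qed.

Lemma idmM0 I J : [disjoint I & J] -> idm I *m idm J = 0.
Proof. by move=> dIJ; rewrite idmM disjoint_setI0 ?idm0. Qed.

Lemma idmDI I J : I \subset J -> idm J = idm I + idm (J :\: I).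
Proof.
move=> sIJ; apply/matrixP => i j; rewrite !mxE in_setD.
case: eqP => _ /=; last by rewrite addr0.
case: (boolP (i \in I)) => iI /=; last by rewrite add0r.
by rewrite (subsetP sIJ) // addr0.
Qed.

Lemma idm_neq0 I : (idm I == 0) = (I == set0).
Proof.
apply/eqP/eqP => [E|->]; last exact: idm0.
apply/setP => i; rewrite in_set0; apply/negP => iI.
by move/matrixP/(_ i i): E; rewrite !mxE eqxx iI /= => /eqP; rewrite oner_eq0.
Qed.

Lemma mxrank_idm I : \rank (idm I) = #|I|.
Proof.
pose f := fun k : 'I_#|I| => enum_val k.
have -> : idm I = (\matrix_(i, k) (i == f k)%:R) *m (\matrix_(k, j) (f k == j)%:R) :> 'M[K]_n.
  apply/matrixP => i j; rewrite !mxE.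
  case: (boolP (i \in I)) => iI; rewrite ?andbT ?andbF.
    rewrite (bigD1 (enum_rank_in iI i)) //= !mxE /f enum_rankK_in // eqxx mul1r.
    rewrite big1 ?addr0 // => k ki; rewrite !mxE; case: eqP => [E|]; last by rewrite mul0r.
    by move: ki; rewrite [i in enum_rank_in _ i]E enum_valK_in eqxx.
  rewrite big1 // => k _; rewrite !mxE; case: eqP => [E|]; last by rewrite mul0r.
  by move: iI; rewrite E enum_valP.
have E : (\matrix_(k, j) (f k == j)%:R) *m (\matrix_(i, k) (i == f k)%:R) = 1%:M :> 'M[K]_#|I|.
  apply/matrixP => k l; rewrite !mxE (bigD1 (f k)) //= !mxE eqxx mul1r big1.
    by rewrite addr0 (inj_eq enum_val_inj).
  by move=> i ik; rewrite !mxE eq_sym (negPf ik) mul0r.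
set P := \matrix_(i, k) _ in E *; set Q := \matrix_(k, j) _ in E *.
apply/eqP; rewrite eqn_leq; apply/andP; split.
  by apply: leq_trans (mxrankM_maxl _ _) _; apply: rank_leq_col.
have H : #|I| = \rank (P *m (Q *m P) *m Q) by rewrite !mulmxA E mul1mx E mxrank1.
apply: leq_trans (eq_leq H) _.

exact: leq_trans (mxrankM_maxl _ _) (mxrankM_maxr _ _).
Qed.

Definition corner I J a := idm I *m a = a /\ a *m idm J = a.

Lemma corner_mx I J a : corner I J (idm I *m a *m idm J).
Proof. by split; rewrite -?mulmxA ?idm_id // !mulmxA idm_id. Qed.

Lemma corner0P I J a : corner I J a <->
  forall i j, ~~ ((i \in I) && (j \in J)) -> a i j = 0.
Proof.
split=> [[aI aJ] i j|a0].
  rewrite negb_and => /orP[/negPf iI|/negPf jJ].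
    by rewrite -aI idm_mulE iI.
  by rewrite -aJ mul_idmE jJ.
by split; apply/matrixP => i j; rewrite ?idm_mulE ?mul_idmE;
  case: ifP => // /negbT iI; rewrite a0 // negb_and iI ?orbT.
Qed.

Lemma cornerW I J I' J' a : I \subset I' -> J \subset J' ->
  corner I J a -> corner I' J' a.
Proof.
move=> sI sJ [aI aJ]; split.
  by rewrite -aI mulmxA idmMSr.
by rewrite -aJ -mulmxA idmMS.
Qed.

Lemma corner_idm I : corner I I (idm I). Proof. by split; rewrite idm_id. Qed.

Lemma cornerM I J L a b : corner I J a -> corner J L b -> corner I L (a *m b).
Proof. by move=> [a1 a2] [b1 b2]; split; rewrite ?mulmxA ?a1 // -mulmxA b2. Qed.

Lemma cornerD I J a b : corner I J a -> corner I J b -> corner I J (a + b).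
Proof. by move=> [a1 a2] [b1 b2]; split; rewrite ?mulmxDr ?mulmxDl ?a1 ?b1 ?a2 ?b2. Qed.

Lemma cornerZ I J k a : corner I J a -> corner I J (k *: a).
Proof. by move=> [a1 a2]; split; rewrite -?scalemxAr -?scalemxAl ?a1 ?a2. Qed.

Lemma cornerN I J a : corner I J a -> corner I J (- a).
Proof. by move=> [a1 a2]; split; rewrite ?mulmxN ?mulNmx ?a1 ?a2. Qed.

Lemma cornerB I J a b : corner I J a -> corner I J b -> corner I J (a - b).
Proof. by move=> a1 b1; apply: cornerD => //; apply: cornerN. Qed.

Lemma corner_mull I J L a : corner I J a -> [disjoint L & I] -> idm L *m a = 0.
Proof. by move=> [<- _] d; rewrite mulmxA idmM0 ?mul0mx. Qed.

Lemma corner_mulr I J L a : corner I J a -> [disjoint J & L] -> a *m idm L = 0.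
Proof. by move=> [_ <-] d; rewrite -mulmxA idmM0 ?mulmx0. Qed.

(** Isomorphism between two coordinate spaces. The idempotents replace the identity matrix, so
    invertibility makes sense without changing the matrix size. *)
Definition cinv I J g h :=
  [/\ corner I J g, corner J I h, g *m h = idm I & h *m g = idm J].

Lemma cinv_sym I J g h : cinv I J g h -> cinv J I h g.
Proof. by case=> ? ? ? ?; split. Qed.

Lemma cinv_idm I : cinv I I (idm I) (idm I).
Proof. by split; rewrite ?idm_id //; apply: corner_idm. Qed.

Lemma cinvM I J L g h g' h' :
  cinv I J g h -> cinv J L g' h' -> cinv I L (g *m g') (h' *m h).
Proof.
case=> g1 h1 gh hg [g1' h1' gh' hg']; split; try exact: (@cornerM _ J).
  by rewrite -mulmxA (mulmxA g') gh' h1.1 gh.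
by rewrite -mulmxA (mulmxA h) hg g1'.1 hg'.
Qed.

Lemma cinv_card I J g h : cinv I J g h -> #|I| = #|J|.
Proof.
case=> [[g1 g2] [h1 h2] gh hg]; apply/eqP; rewrite eqn_leq -!mxrank_idm.
have l I' J' a b : a *m b = idm I' -> b *m idm I' = b -> b *m a = idm J' ->
   (\rank (idm I') <= \rank (idm J'))%N.
  move=> ab bI ba; rewrite -ab -{1}bI -ab (mulmxA b) ba mulmxA.
  by apply: leq_trans (mxrankM_maxl _ _) (mxrankM_maxr _ _).
by apply/andP; split; [apply: (l _ _ g h)|apply: (l _ _ h g)].
Qed.

(** Membership in the incidence algebra of [R]; for the labels of a flag these are the block upper
    triangular matrices. *)
Definition incid R a := forall i j, ~~ R i j -> a i j = 0.

Lemma incid_idm R I : reflexive R -> incid R (idm I).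
Proof.
move=> Rr i j; rewrite mxE; case: eqP => //= ->.
by rewrite Rr.
Qed.

Lemma incidM R a b : transitive R -> incid R a -> incid R b -> incid R (a *m b).
Proof.
move=> Rt Ra Rb i j nR; rewrite mxE big1 // => k _.
case: (boolP (R i k)) => [ik|/Ra->]; last by rewrite mul0r.
case: (boolP (R k j)) => [kj|/Rb->]; last by rewrite mulr0.
by case/negP: nR; apply: Rt kj.
Qed.

Lemma incidD R a b : incid R a -> incid R b -> incid R (a + b).
Proof. by move=> Ra Rb i j nR; rewrite mxE Ra // Rb // addr0. Qed.

Lemma incidZ R k a : incid R a -> incid R (k *: a).
Proof. by move=> Ra i j nR; rewrite mxE Ra // mulr0. Qed.

Lemma incidN R a : incid R a -> incid R (- a).
Proof. by move=> Ra i j nR; rewrite mxE Ra // oppr0. Qed.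

Lemma incidB R a b : incid R a -> incid R b -> incid R (a - b).
Proof. by move=> Ra Rb; apply: incidD => //; apply: incidN. Qed.

Lemma incid0 R : incid R 0. Proof. by move=> i j _; rewrite mxE. Qed.

End Corner.

Section Inverse.
Variables (K : fieldType).

(** By Cayley-Hamilton the inverse is a polynomial in [z], since the constant coefficient is the
    determinant up to sign; the incidence algebra of a preorder contains all such polynomials. *)
Lemma incid_inv n (R : rel 'I_n) (z : 'M[K]_n) :
  reflexive R -> transitive R -> incid R z -> z \in unitmx -> incid R (invmx z).
Proof.
case: n R z => [|n] R z Rr Rt zR zu; first by move=> [].
have hR (p : {poly K}) : incid R (horner_mx z p).
  elim/poly_ind: p => [|p c IH]; first by rewrite rmorph0; apply: incid0.
  rewrite rmorphD rmorphM /= horner_mx_X horner_mx_C; apply: incidD.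
    exact: incidM.
  by rewrite -scalemx1 -idmT; apply: incidZ; apply: incid_idm.
have := Cayley_Hamilton z.
set p := char_poly z => p0.
have c0 : p`_0 != 0.
  by rewrite char_poly_det mulf_neq0 ?signr_eq0 // -unitfE -unitmxE.
pose q := drop_poly 1 p.
have E : p = q * 'X + (p`_0)%:P.
  rewrite -[LHS](poly_take_drop 1) addrC expr1; congr (_ + _).
  apply/polyP => i; rewrite coef_take_poly coefC.
  by case: i.
have Ez : horner_mx z q *m z = - (p`_0)%:M.
  apply: subr0_eq; rewrite opprK.
  transitivity (horner_mx z (q * 'X + (p`_0)%:P)); last by rewrite -E p0.
  by rewrite rmorphD rmorphM /= horner_mx_X horner_mx_C mulmxE.
suff -> : invmx z = - (p`_0)^-1 *: horner_mx z q by apply: incidZ.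
apply: (can_inj (mulmxK zu)); rewrite mulVmx // -scalemxAl Ez.
by rewrite scaleNr scalerN opprK scale_scalar_mx mulVf.
Qed.

(** Adding the identity on the complement of [I] turns [z] into an invertible matrix [Z] of full
    size, whose inverse stays in every incidence algebra containing [z]; the corner of that inverse
    is the one sought. *)
Lemma cinj_cinv n (I : {set 'I_n}) (z : 'M[K]_n) :
  corner I I z -> (forall x : 'cV[K]_n, idm K I *m x = x -> z *m x = 0 -> x = 0) ->
  exists2 w, cinv I I z w & forall R, reflexive R -> transitive R ->
    incid R z -> incid R w.
Proof.
move=> zI zinj.
pose Z := z + idm K (~: I).
have d1 : [disjoint I & ~: I] by rewrite -setI_eq0 setICr.
have d2 : [disjoint ~: I & I] by rewrite disjoint_sym.
have zC : z *m idm K (~: I) = 0 by apply: corner_mulr zI d1.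
have Cz : idm K (~: I) *m z = 0 by apply: corner_mull zI d2.
have E1 : 1%:M = idm K I + idm K (~: I).
  by rewrite -idmT (@idmDI _ _ I) ?subsetT // setTD.
have Zu : Z \in unitmx.
  rewrite -unitmx_tr -row_free_unit -kermx_eq0; apply/eqP/row_matrixP => i.
  rewrite row0; set x := row i _.
  have : x *m Z^T = 0 by apply/sub_kermxP; apply: row_sub.
  move/(congr1 trmx); rewrite trmx_mul trmxK trmx0.
  set y := x^T => Zy; suff: y = 0 by move/(congr1 trmx); rewrite trmxK trmx0.
  have y2 : idm K (~: I) *m y = 0.
    move/(congr1 (mulmx (idm K (~: I)))): Zy.
    by rewrite mulmx0 mulmxA mulmxDr Cz add0r idm_id.
  apply: zinj; first by rewrite -[RHS]mul1mx E1 mulmxDl y2 addr0.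
  by move: Zy; rewrite mulmxDl y2 addr0.
pose w := idm K I *m invmx Z *m idm K I.
have ZI : Z *m idm K I = z by rewrite mulmxDl zI.2 idmM0 // addr0.
have IZ : idm K I *m Z = z by rewrite mulmxDr zI.1 idmM0 // addr0.
exists w.
  split=> //; first exact: corner_mx.
    rewrite !mulmxA zI.2 -{1}IZ -(mulmxA (idm K I)) mulmxV //.
    by rewrite mulmx1 idm_id.
  rewrite -!mulmxA zI.1 -{1}ZI (mulmxA (invmx Z)) mulVmx //.
  by rewrite mul1mx idm_id.
move=> R Rr Rt zR; do 2?apply: incidM => //; try exact: incid_idm.
by apply: incid_inv => //; apply: incidD => //; exact: incid_idm.
Qed.

End Inverse.

(** * Kernels adapted to a union of chains *)

Section Forest.
Variables (K : fieldType) (n : nat).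
Implicit Types (R : rel 'I_n) (I J : {set 'I_n}).

Definition comparable_rel R i j := R i j || R j i.

(* Transitivity of comparability makes the preorder a disjoint union of chains. *)
Definition chain_union R :=
  [/\ reflexive R, transitive R & transitive (comparable_rel R)].

(** An element of [I] with the most predecessors works: a comparable element strictly above it would
    have all of these and itself in addition. *)
Lemma exists_top R I : chain_union R -> I != set0 ->
  exists2 j, j \in I & forall k, k \in I -> comparable_rel R k j -> R k j.
Proof.
move=> [Rr Rt Rc] /set0Pn[j0 j0I].
pose f j := #|[set k | R k j]|.
case: (@arg_maxnP _ j0 (fun j => j \in I) f j0I) => j jI jmax.
exists j => // k kI /orP[//|jk].
apply: contraT => nkj.
have := jmax k kI; rewrite /= leqNgt => /negP[]; apply: proper_card.
apply/properP; split.
  by apply/subsetP => l; rewrite !inE => lj; apply: Rt jk.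
by exists k; rewrite !inE ?Rr.
Qed.

(** Echelon form: the columns of [idm K I0 - c] span the kernel of [a] on [I], and the indices
    outside [I0] are the pivots. The greatest index [j] of a chain is treated last; if its column
    depends on pivot columns, the coefficients sit at positions [(k, j)] with [R k j], which keeps
    [c] in the incidence algebra. *)
Lemma kernel_basis R (a : 'M[K]_n) I : chain_union R ->
  incid (comparable_rel R) a ->
  exists I0 c, [/\ I0 \subset I, corner (I :\: I0) I0 c, incid R c,
    a *m (idm K I0 - c) = 0 &
    forall x : 'cV[K]_n, idm K (I :\: I0) *m x = x -> a *m x = 0 -> x = 0].
Proof.
move=> fR aR; have [Rr Rt Rc] := fR.
have [m] := ubnP #|I|; elim: m I => // m IH I; rewrite ltnS => Im.
have [->|I0] := eqVneq I set0.
  exists set0, 0; split=> //.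
  - by split; rewrite ?mulmx0 ?mul0mx.
  - exact: incid0.
  - by rewrite idm0 subr0 mulmx0.
  - by move=> x; rewrite set0D idm0 mul0mx.
have [j jI jtop] := exists_top fR I0.
have [|I0' [c [sI cc cR ac ind]]] := IH (I :\ j).
  by apply: leq_trans Im; rewrite [X in (_ < X)%N](cardsD1 j) jI.
have jI0' : j \notin I0'.
  by apply/negP => /(subsetP sI); rewrite !inE eqxx.
set S := (I :\ j) :\: I0' in cc ind.
have sSI k : k \in S -> k \in I by rewrite !inE => /and3P[].
have [[x xS ax]|nx] := pselect (exists2 x : 'cV[K]_n, idm K S *m x = x &
   a *m x = a *m delta_mx j 0).
  (* Coefficients outside the chain of [j] are discarded: [a] is block diagonal for the chains, so
     the truncated vector still produces column [j]. *)
  pose x' : 'cV[K]_n := \col_k (if comparable_rel R k j then x k 0 else 0).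
  have ax' : a *m x' = a *m delta_mx j 0.
    apply/matrixP => i i0; rewrite ord1 -ax !mxE.
    have [ij|nij] := boolP (comparable_rel R i j).
      apply: eq_bigr => k _; rewrite mxE; case: ifP => // nkj.
      have [ik|/aR->] := boolP (comparable_rel R i k); last by rewrite !mul0r.
      by rewrite (Rc i) // /comparable_rel orbC in nkj.
    transitivity (a i j).
      rewrite aR // big1 // => k _; rewrite mxE; case: ifP => kj; last by rewrite mulr0.
      have [ik|/aR->] := boolP (comparable_rel R i k); last by rewrite !mul0r.
      by rewrite (Rc k) in nij.
    move/matrixP/(_ i 0): ax; rewrite !mxE => ->.
    rewrite (bigD1 j) //= mxE !eqxx mulr1 big1 ?addr0 // => k kj.
    by rewrite mxE (negPf kj) mulr0.
  have x0 k : k \notin S -> x k 0 = 0 by rewrite -xS idm_mulE => /negPf->.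
  have x'0 k : ~~ ((k \in S) && comparable_rel R k j) -> x' k 0 = 0.
    by rewrite mxE; case: ifP => // _; rewrite andbT => /x0.
  have ES : I :\: (j |: I0') = S.
    by apply/setP => k; rewrite !inE negb_or; do !case: (_ == _) (_ \in _) => [] [].
  exists (j |: I0'), (c + x' *m delta_mx 0 j); rewrite ES; split=> //.
  - apply/subsetP => k; rewrite !inE => /orP[/eqP->//|/(subsetP sI)].
    by rewrite !inE => /andP[].
  - apply: cornerD.
      by apply: cornerW cc => //; apply: subsetUr.
    apply/corner0P => k l; rewrite negb_and in_setU1 => kl.
    rewrite mxE big_ord1 [delta_mx _ _ _ _]mxE /=.
    case: (l =P j) kl => [->|_ _]; rewrite /= ?orbF; last by rewrite mulr0.
    by move=> kS; rewrite x'0 ?mul0r // (negPf kS).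
  - apply: incidD => // k l nkl.
    rewrite mxE big_ord1 [delta_mx _ _ _ _]mxE /=.
    case: (l =P j) nkl => [->|_ _]; last by rewrite mulr0.
    move=> nkj; rewrite x'0 ?mul0r //; apply/negP => /andP[kS kj].
    by rewrite jtop ?sSI in nkj.
  - have -> : idm K (j |: I0') = idm K I0' + delta_mx j j.
      apply/matrixP => k l; rewrite !mxE !inE eq_sym.
      case: (l =P k) => [->|lk] /=.
        case: (k =P j) => [->|_]; last by rewrite addr0.
        by rewrite (negPf jI0') add0r.
      case: (k =P j) => [kj|_]; last by rewrite addr0.
      by case: (l =P j) => [lj|_]; rewrite ?addr0 //; case: lk; rewrite lj kj.
    rewrite opprD addrACA mulmxDr ac add0r mulmxBr [_ *m (x' *m _)]mulmxA ax'.
    by rewrite -mulmxA mul_delta_mx subrr.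
have ES : I :\: I0' = j |: S.
  apply/setP => k; rewrite !inE; case: eqP => [->|//] /=.
  by rewrite jI0' jI.
exists I0', c; split=> //.
- by apply: subset_trans sI (subsetDl _ _).
- by apply: cornerW cc => //; rewrite ES; apply: subsetUr.
move=> x; rewrite ES => xS ax.
have jS : j \notin S by rewrite !inE eqxx andbF.
have x0 k : k != j -> (k \in S) = false -> x k 0 = 0.
  by move=> kj kS; rewrite -xS idm_mulE in_setU1 kS (negPf kj).
have xj : x j 0 = 0.
  apply/eqP/negPn/negP => xj; case: nx.
  exists (delta_mx j 0 - (x j 0)^-1 *: x); last first.
    by rewrite mulmxBr -scalemxAr ax scaler0 subr0.
  apply/matrixP => k i; rewrite ord1 idm_mulE; case: ifP => // kS.
  rewrite !mxE eqxx andbT; case: (k =P j) => [->|kj].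
    by rewrite mulVf // subrr.
  by rewrite (x0 k) ?mulr0 ?subr0 //; apply/eqP.
apply: ind => //; apply/matrixP => k i; rewrite ord1 idm_mulE.
case: ifP => // kS; case: (k =P j) => [->//|kj].
by rewrite x0 //; apply/eqP.
Qed.

End Forest.

(** * Normal forms *)

(** Equal ranks mean that the column space of [a] meets the kernel of [b] only in zero. Every
    minimality of a rank is turned into an injectivity in this way. *)
Lemma mxrank_mul_kernel (K : fieldType) m n p q (b : 'M[K]_(m, n)) (a : 'M[K]_(n, p)) :
  \rank (b *m a) = \rank a -> forall x : 'M[K]_(p, q), b *m (a *m x) = 0 -> a *m x = 0.
Proof.
move=> E x bax.
have := mxrank_mul_ker a^T b^T.
rewrite -trmx_mul !mxrank_tr E -[RHS]addn0 => /addnI/eqP.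
rewrite mxrank_eq0 => /eqP cap0.
have : ((a *m x)^T <= a^T :&: kermx b^T)%MS.
  rewrite sub_capmx; apply/andP; split; first by rewrite trmx_mul submxMl.
  by apply/sub_kermxP; rewrite -trmx_mul bax trmx0.
rewrite cap0 submx0 => /eqP/(congr1 trmx).
by rewrite trmxK trmx0.
Qed.

Section Injective.
Variables (K : fieldType) (n : nat).
Implicit Types (S : {set 'I_n}) (a : 'M[K]_n).

Definition inj_on S a := forall x : 'cV[K]_n, idm K S *m x = x -> a *m x = 0 -> x = 0.

Lemma inj_onM S a q (x : 'M[K]_(n, q)) : inj_on S a ->
  idm K S *m x = x -> a *m x = 0 -> x = 0.
Proof.
move=> ai xS ax; apply/matrixP => i j.
have : x *m delta_mx j (0 : 'I_1) = 0 by apply: ai; rewrite mulmxA ?xS ?ax ?mul0mx.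
rewrite -colE => /colP/(_ i).
by rewrite !mxE.
Qed.

Lemma inj_on_linv S a T : corner T S a -> inj_on S a -> exists l, l *m a = idm K S.
Proof.
move=> [_ aS] ai; suff /submxP[l ->] : (idm K S <= a)%MS by exists l.
rewrite submxE; apply/eqP; apply: (inj_onM ai); first by rewrite mulmxA idm_id.
by rewrite mulmxA aS mulmx_coker.
Qed.

End Injective.

Section Units.
Variables (K : fieldType) (n : nat).
Implicit Types (R : rel 'I_n) (I J : {set 'I_n}) (u v : 'M[K]_n).

Definition incid_unit R I u u' := [/\ cinv I I u u', incid R u & incid R u'].

Lemma incid_unit_sym R I u u' : incid_unit R I u u' -> incid_unit R I u' u.
Proof. by case=> ? ? ?; split=> //; apply: cinv_sym. Qed.

Lemma incid_unit1 R I : reflexive R -> incid_unit R I (idm K I) (idm K I).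
Proof. by move=> Rr; split; [apply: cinv_idm|apply: incid_idm..]. Qed.

Lemma incid_unitM R I u u' v v' : transitive R ->
  incid_unit R I u u' -> incid_unit R I v v' ->
  incid_unit R I (u *m v) (v' *m u').
Proof.
move=> Rt [uI uR u'R] [vI vR v'R]; split; [exact: cinvM uI vI|exact: incidM|exact: incidM].
Qed.

Lemma incid_unit_nil R I c : reflexive R -> corner I I c -> incid R c ->
  c *m c = 0 -> incid_unit R I (idm K I + c) (idm K I - c).
Proof.
move=> Rr cI cR cc; have i1 := @corner_idm K _ I.
have c1 : corner I I (idm K I + c) by apply: cornerD.
have c2 : corner I I (idm K I - c) by apply: cornerB.
split; [split=> //| |].
- by rewrite mulmxBr c1.2 mulmxDl cc addr0 cI.1 addrK.
- by rewrite mulmxDr c2.2 mulmxBl cc subr0 cI.1 subrK.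
- by apply: incidD => //; exact: incid_idm.
- by apply: incidB => //; exact: incid_idm.
Qed.

Lemma incid_unitD R I1 I2 u1 u1' u2 u2' :
  [disjoint I1 & I2] -> incid_unit R I1 u1 u1' -> incid_unit R I2 u2 u2' ->
  incid_unit R (I1 :|: I2) (u1 + u2) (u1' + u2').
Proof.
move=> d [[c1 c1' e1 f1] R1 R1'] [[c2 c2' e2 f2] R2 R2'].
have d' : [disjoint I2 & I1] by rewrite disjoint_sym.
have l1 a : corner I1 I1 a -> corner (I1 :|: I2) (I1 :|: I2) a.
  by apply: cornerW; apply: subsetUl.
have l2 a : corner I2 I2 a -> corner (I1 :|: I2) (I1 :|: I2) a.
  by apply: cornerW; apply: subsetUr.
have E : idm K (I1 :|: I2) = idm K I1 + idm K I2.
  rewrite (idmDI K (subsetUl I1 I2)) setDUl setDv set0U.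
  by move: d'; rewrite -setI_eq0 setIC => /eqP I0; rewrite setDE (setIidPl _) // -disjoints_subset disjoint_sym.
split; [split|exact: incidD|exact: incidD].
- by apply: cornerD; [apply: l1|apply: l2].
- by apply: cornerD; [apply: l1|apply: l2].
- rewrite mulmxDl !mulmxDr e1 e2 -c1.2 -c2.2 -!mulmxA.
  by rewrite (corner_mull c2') // (corner_mull c1') // !mulmx0 addr0 add0r E.
- rewrite mulmxDl !mulmxDr f1 f2 -c1'.2 -c2'.2 -!mulmxA.
  by rewrite (corner_mull c2) // (corner_mull c1) // !mulmx0 addr0 add0r E.
Qed.

(** The matrix [c] of the echelon form has square zero, so [idm K I - c] is a unit; conjugating by
    it moves the kernel of [a] onto the coordinates [I0]. *)
Lemma kernel_adapt R I (a : 'M[K]_n) : chain_union R ->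
  corner I I a -> incid R a ->
  exists I0 u u', [/\ I0 \subset I, incid_unit R I u u',
    u' *m a *m u *m idm K I0 = 0 & inj_on (I :\: I0) (u' *m a *m u)].
Proof.
move=> fR aI aR; have [Rr Rt _] := fR.
have [|I0 [c [sI cc cR ac ind]]] := @kernel_basis K n R a I fR.
  by move=> i j; rewrite negb_or => /andP[/aR].
set I1 := I :\: I0 in cc ind.
have sI1 : I1 \subset I by apply: subsetDl.
have d10 : [disjoint I1 & I0] by rewrite -setI_eq0 setIDAC setDIl setDv setI0.
have d01 : [disjoint I0 & I1] by rewrite disjoint_sym.
have cc0 : c *m c = 0 by rewrite -{1}cc.2 -{2}cc.1 -mulmxA (mulmxA (idm _ _)) idmM0 ?mul0mx ?mulmx0.
have cI : corner I I c by apply: cornerW cc.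
have := @incid_unit_nil R I c Rr cI cR cc0.
set u' := idm K I + c; set u := idm K I - c => /incid_unit_sym unu.
have [[uI u'I uu' u'u] uR u'R] := unu.
exists I0, u, u'; split=> //.
  by rewrite -!mulmxA [u *m _]mulmxBl cc.2 idmMSr // ac mulmx0.
move=> x xI1 a1x; apply: ind => //.
have cx : c *m x = 0 by rewrite -xI1 mulmxA (corner_mulr cc) ?mul0mx.
have ux : u *m x = x by rewrite mulmxBl cx subr0 -xI1 mulmxA idmMSr.
have : u *m (u' *m a *m u) *m x = 0 by rewrite -mulmxA a1x mulmx0.
by rewrite !mulmxA uu' aI.1 -mulmxA ux.
Qed.

(** By hypothesis the kernel and the image of [a] meet trivially. Once the kernel sits on the
    coordinates [I0], the matrix is [y + z] with [z] invertible on the other coordinates, and the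
    unipotent unit made of [y] times the inverse of [z] conjugates [y] away. *)
Lemma fitting_split R I (a : 'M[K]_n) : chain_union R ->
  corner I I a -> incid R a ->
  (forall x : 'cV[K]_n, a *m (a *m x) = 0 -> a *m x = 0) ->
  exists I0 u u' z z', [/\ I0 \subset I, incid_unit R I u u', u' *m a *m u = z &
    cinv (I :\: I0) (I :\: I0) z z'].
Proof.
move=> fR aI aR aa; have [Rr Rt _] := fR.
have [I0 [u [u' [sI unu]]]] := kernel_adapt fR aI aR.
have [[uI u'I uu' u'u] uR u'R] := unu.
pose a1 := u' *m a *m u; rewrite -/a1.
pose I1 := I :\: I0; rewrite -/I1 => a10 a1x.
have sI1 : I1 \subset I by apply: subsetDl.
have d10 : [disjoint I1 & I0] by rewrite -setI_eq0 setIDAC setDIl setDv setI0.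
have d01 : [disjoint I0 & I1] by rewrite disjoint_sym.
have a1I : corner I I a1 by apply: cornerM uI; apply: cornerM u'I aI.
have a1R : incid R a1 by do 2?[apply: (@incidM _ _ _ _ _ Rt)].
have E1 : idm K I = idm K I0 + idm K I1 by apply: idmDI.
pose z := idm K I1 *m a1 *m idm K I1.
pose y := idm K I0 *m a1 *m idm K I1.
have a1E : a1 = y + z.
  rewrite -{1}a1I.2 E1 mulmxDr a10 add0r -{1}a1I.1 E1 mulmxDl mulmxDl.
  by rewrite /y /z !mulmxA.
have zI : corner I1 I1 z by apply: corner_mx.
have yI : corner I0 I1 y by apply: corner_mx.
have a1a1 x : a1 *m (a1 *m x) = 0 -> a1 *m x = 0 :> 'cV[K]_n.
  rewrite /a1 -!mulmxA => H.
  have : u *m (u' *m (a *m (u *m (u' *m (a *m (u *m x)))))) = 0 by rewrite H mulmx0.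
  rewrite !(mulmxA u u') uu' (mulmxA a (idm _ _)) aI.2 (mulmxA (idm _ _) a) aI.1.
  by move/aa ->; rewrite mulmx0.
have [|w zw wR] := cinj_cinv zI.
  move=> x xI1 zx; apply: a1x => //; apply: a1a1.
  rewrite {2}a1E mulmxDl zx addr0 -yI.1 -mulmxA mulmxA a10 mul0mx //.
exists I0; pose t := y *m w.
have [_ wI zw1 wz1] := zw.
have tI : corner I0 I1 t by apply: cornerM wI.
have yR : incid R y by do 2?apply: incidM; rewrite //; apply: incid_idm.
have zR : incid R z by do 2?apply: incidM; rewrite //; apply: incid_idm.
have tR : incid R t by apply: incidM => //; apply: wR.
have tII : corner I I t by apply: cornerW tI.
have tt : t *m t = 0 by rewrite -{1}tI.2 -{2}tI.1 -mulmxA (mulmxA (idm _ _)) idmM0 ?mul0mx ?mulmx0.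
have := @incid_unit_nil R I t Rr tII tR tt.
set s := _ + t; set s' := _ - t => uns.
exists (u *m s), (s' *m u'), z, w; split=> //; first exact: incid_unitM.
have -> : s' *m u' *m a *m (u *m s) = s' *m (a1 *m s) by rewrite /a1 !mulmxA.
rewrite mulmxDr a1I.2 -tI.1 (mulmxA a1) a10 mul0mx addr0 mulmxBl a1I.1.
have ty : t *m y = 0 by rewrite -tI.2 -yI.1 -mulmxA (mulmxA (idm _ _)) idmM0 ?mul0mx ?mulmx0.
have tz : t *m z = y by rewrite -mulmxA wz1 yI.2.
by rewrite a1E mulmxDr ty add0r tz addrAC subrr add0r.
Qed.

End Units.

Lemma setD_disjoint (T : finType) (A B : {set T}) : [disjoint A :\: B & B].
Proof. by rewrite -setI_eq0 setIDAC setDIl setDv setI0. Qed.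

Lemma disjoint_setD (T : finType) (A B : {set T}) : [disjoint B & A :\: B].
Proof. by rewrite disjoint_sym setD_disjoint. Qed.

Lemma cinv_block (K : fieldType) n (I J I1 J1 : {set 'I_n}) (g h : 'M[K]_n) :
  cinv I J g h -> I1 \subset I -> J1 \subset J ->
  idm K I1 *m g *m idm K (J :\: J1) = 0 ->
  idm K (I :\: I1) *m g *m idm K J1 = 0 ->
  [/\ cinv I1 J1 (idm K I1 *m g *m idm K J1) (idm K J1 *m h *m idm K I1),
    idm K I1 *m g = g *m idm K J1 &
    g = idm K I1 *m g *m idm K J1 +
        idm K (I :\: I1) *m g *m idm K (J :\: J1)].
Proof.
move=> [[gI gJ] [hJ hI] gh hg] sI sJ g12 g21.
have EI := idmDI K sI; have EJ := idmDI K sJ.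
have l : idm K I1 *m g = idm K I1 *m g *m idm K J1.
  by rewrite -{1}gJ mulmxA EJ mulmxDr g12 addr0.
have r : g *m idm K J1 = idm K I1 *m g *m idm K J1.
  by rewrite -{1}gI EI !mulmxDl g21 addr0.
split; last 1 first.
- by rewrite -{1}gI EI mulmxDl {1}l; congr (_ + _); rewrite -{1}gJ EJ mulmxA mulmxDr g21 add0r.
- have e1 := idm_id K I1; have e2 := idm_id K J1.
  split; [exact: corner_mx..| |].
    rewrite !mulmxA -[_ *m idm K J1 *m idm K J1]mulmxA e2 -l -(mulmxA _ g) gh.
    by rewrite idmMS // e1.
  rewrite !mulmxA -[_ *m idm K I1 *m idm K I1]mulmxA e1 -!mulmxA [idm K I1 *m _]mulmxA -r.
  by rewrite (mulmxA h) hg idmMSr // e2.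
- by rewrite l.
Qed.

Lemma ex_min_nat (T : Type) (P : T -> Prop) (f : T -> nat) :
  (exists x, P x) -> exists2 x, P x & forall y, P y -> (f x <= f y)%N.
Proof.
case=> x; have [m] := ubnP (f x); elim: m x => // m IH x fxm Px.
have [[y Py yx]|nex] := pselect (exists2 y, P y & (f y < f x)%N).
  by apply: (IH y) => //; apply: leq_trans yx _.
by exists x => // y Py; rewrite leqNgt; apply/negP => yx; case: nex; exists y.
Qed.

(** * Isomorphism and decomposition of objects *)

Section Objects.
Variables (K : fieldType) (n : nat) (RA RB : rel 'I_n).
Hypotheses (fA : chain_union RA) (fB : chain_union RB).
Implicit Types (I J : {set 'I_n}) (a b g h u v x : 'M[K]_n).

Let Ar : reflexive RA. Proof. by case: fA. Qed.
Let At : transitive RA. Proof. by case: fA. Qed.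
Let Br : reflexive RB. Proof. by case: fB. Qed.
Let Bt : transitive RB. Proof. by case: fB. Qed.

Definition cobj I J g := exists h, cinv I J g h.

Definition eqv I J g g' := exists u u' v v',
  [/\ incid_unit RA I u u', incid_unit RB J v v' & u *m g *m v = g'].

Lemma eqv_refl I J g : corner I J g -> eqv I J g g.
Proof.
move=> [gI gJ]; exists (idm K I), (idm K I), (idm K J), (idm K J).
by split; [exact: incid_unit1..|rewrite gI gJ].
Qed.

Lemma eqv_trans I J g1 g2 g3 : eqv I J g1 g2 -> eqv I J g2 g3 -> eqv I J g1 g3.
Proof.
move=> [u [u' [v [v' [uA vB <-]]]]] [w [w' [z [z' [wA zB <-]]]]].
exists (w *m u), (u' *m w'), (v *m z), (z' *m v'); split.
- exact: incid_unitM.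
- exact: incid_unitM.
- by rewrite !mulmxA.
Qed.

Lemma eqv_sym I J g1 g2 : corner I J g1 -> eqv I J g1 g2 -> eqv I J g2 g1.
Proof.
move=> [gI gJ] [u [u' [v [v' [uA vB <-]]]]]; exists u', u, v', v; split.
- exact: incid_unit_sym.
- exact: incid_unit_sym.
- case: uA vB => [[_ _ _ u'u] _ _] [[_ _ vv' _] _ _].
  by rewrite !mulmxA u'u gI -mulmxA vv' gJ.
Qed.

Lemma cobj_eqv I J g g' : eqv I J g g' -> cobj I J g -> cobj I J g'.
Proof.
move=> [u [u' [v [v' [[uA _ _] [vB _ _] <-]]]]] [h gh].
by exists (v' *m (h *m u')); apply: cinvM vB; apply: cinvM gh.
Qed.

Lemma cobj_corner I J g : cobj I J g -> corner I J g.
Proof. by case=> h []. Qed.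

(* A direct sum decomposition in adapted bases. *)
Definition dec I J g := exists I1 J1 g1 g2,
  [/\ [/\ I1 \subset I, I1 != set0 & I1 != I], J1 \subset J,
      cobj I1 J1 g1, cobj (I :\: I1) (J :\: J1) g2 & eqv I J g (g1 + g2)].

Lemma dec_block I J I1 J1 g g' : cobj I J g -> eqv I J g g' ->
  I1 \subset I -> I1 != set0 -> I1 != I -> J1 \subset J ->
  idm K I1 *m g' *m idm K (J :\: J1) = 0 ->
  idm K (I :\: I1) *m g' *m idm K J1 = 0 -> dec I J g.
Proof.
move=> og eg sI I1n I1I sJ z1 z2.
have [h' g'h'] := cobj_eqv eg og.
have [c1 _ E] := cinv_block g'h' sI sJ z1 z2.
exists I1, J1, (idm K I1 *m g' *m idm K J1),
  (idm K (I :\: I1) *m g' *m idm K (J :\: J1)).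
split=> //; first by exists (idm K J1 *m h' *m idm K I1).
  have DD (A B : {set 'I_n}) : B \subset A -> A :\: (A :\: B) = B.
    by move=> sBA; rewrite setDDr setDv set0U; apply/setIidPr.
  have [] := @cinv_block K n I J (I :\: I1) (J :\: J1) g' h' g'h';
    rewrite ?subsetDl ?DD //.
  by exists (idm K (J :\: J1) *m h' *m idm K (I :\: I1)).
by rewrite -E.
Qed.

(** The power with exponent [k + 1]: exponent 0 would give the identity, which need not lie in the
    corner. *)
Definition mpow a k := iter k (mulmx a) a.

Lemma mpow_add a k l : mpow a k *m mpow a l = mpow a (k + l).+1.
Proof.
elim: k => [|k IH] //=.
by rewrite -/(mpow a k) -mulmxA IH.
Qed.

Lemma mpow_comm a b g k : a *m g = g *m b -> mpow a k *m g = g *m mpow b k.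
Proof.
move=> agb; elim: k => //= k IH.
by rewrite -!/(mpow _ _) -mulmxA IH mulmxA agb mulmxA.
Qed.

Lemma mpow_corner I a k : corner I I a -> corner I I (mpow a k).
Proof. by move=> aI; elim: k => //= k IH; apply: cornerM aI IH. Qed.

Lemma mpow_incid R a k : transitive R -> incid R a -> incid R (mpow a k).
Proof. by move=> Rt aR; elim: k => //= k IH; apply: incidM. Qed.

(** Fitting's lemma. A power of [a] of least rank has the same kernel as its square, and [g] carries
    this property to the same power of [b]. Both split into a zero part and an invertible part, and
    intertwining forces [g] to respect the two splittings. *)
Lemma fitting_dec I J g a b : cobj I J g ->
  corner I I a -> incid RA a -> corner J J b -> incid RB b ->
  a *m g = g *m b ->
  (exists x : 'cV[K]_n, [/\ idm K I *m x = x, a *m x = 0 & x != 0]) ->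
  (exists k, mpow a k = 0) \/ dec I J g.
Proof.
move=> og aI aA bJ bB agb [x [xI ax x0]]; have [h [gc hc gh hg]] := og.
have [k _ kmin] := @ex_min_nat nat (fun=> True) (fun k => \rank (mpow a k)) (ex_intro _ 0%N Logic.I).
set al := mpow a k in kmin; set be := mpow b k.
have alI : corner I I al by apply: mpow_corner.
have beJ : corner J J be by apply: mpow_corner.
have alg : al *m g = g *m be by apply: mpow_comm.
have alal (y : 'cV[K]_n) : al *m (al *m y) = 0 -> al *m y = 0.
  apply: mxrank_mul_kernel; apply/eqP; rewrite eqn_leq mxrankM_maxl /=.
  by rewrite mpow_add kmin.
have bebe (y : 'cV[K]_n) : be *m (be *m y) = 0 -> be *m y = 0.
  move=> bby; have : al *m (al *m (g *m y)) = 0.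
    by rewrite (mulmxA al g) alg mulmxA mulmxA alg -!mulmxA bby mulmx0.
  move/alal; rewrite mulmxA alg -mulmxA => gby.
  by rewrite -beJ.1 -hg -!mulmxA gby mulmx0.
have alA : incid RA al by apply: mpow_incid.
have beB : incid RB be by apply: mpow_incid.
have [I0 [u [u' [z [z' [sI uA uz [zI z'I zz z'z]]]]]]] := fitting_split fA alI alA alal.
have [J0 [v [v' [w [w' [sJ vB vw [wJ w'J ww w'w]]]]]]] := fitting_split fB beJ beB bebe.
have [[uI u'I uu' u'u] _ _] := uA; have [[vI v'I vv' v'v] _ _] := vB.
pose g' := u' *m g *m v.
have zg : z *m g' = g' *m w.
  rewrite /g' -uz -vw -!mulmxA (mulmxA u) uu' (mulmxA (idm _ _)) gc.1.
  by rewrite (mulmxA al) alg -mulmxA (mulmxA v) vv' (mulmxA (idm _ _) be) beJ.1.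
(* An empty zero part contradicts the kernel vector [x]; a full one means that a power of [a]
   vanishes. *)
have [I0n|I0n] := eqVneq I0 set0.
  have alx : al *m x = 0.
    rewrite /al; case: (k) => [|l] //.
    have -> : mpow a l.+1 = mpow a l *m a by rewrite -[a in RHS]/(mpow a 0) mpow_add addn0.
    by rewrite -mulmxA ax mulmx0.
  have : z *m (u' *m x) = 0.
    by rewrite -uz -!mulmxA (mulmxA u) uu' xI alx mulmx0.
  move/(congr1 (mulmx z')); rewrite mulmxA z'z mulmx0 I0n setD0 mulmxA u'I.1.
  by move/(congr1 (mulmx u)); rewrite mulmxA uu' xI mulmx0 => xE; rewrite xE eqxx in x0.
have [I0I|I0I] := eqVneq I0 I.
  have z0 : z = 0 by rewrite -zI.1 I0I setDv idm0 mul0mx.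
  have ualu : u *m z *m u' = al.
    by rewrite -uz !mulmxA uu' alI.1 -mulmxA uu' alI.2.
  by left; exists k; rewrite -/al -ualu z0 mulmx0 mul0mx.
right; apply: (@dec_block I J I0 J0 g g') => //.
- exists u', u, v, v'; split=> //; exact: incid_unit_sym.
- rewrite -ww mulmxA -[_ *m g' *m w]mulmxA -zg mulmxA (corner_mull zI) ?mul0mx //.
  exact: disjoint_setD.
- rewrite -z'z -(mulmxA z' z g') zg -mulmxA -(mulmxA g' w) (corner_mulr wJ) ?mulmx0 //.
  exact: setD_disjoint.
Qed.

End Objects.

(** * The extension matrix *)

Section Positions.
Variables (K : comNzRingType) (n : nat).
Implicit Types (S : {set 'I_n * 'I_n}) (x : 'M[K]_n).

Definition pos_vec S x : 'rV[K]_#|S| := \row_k x (enum_val k).1 (enum_val k).2.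

Definition pos_mx S (y : 'rV[K]_#|S|) : 'M[K]_n :=
  \sum_k y 0 k *: delta_mx (enum_val k).1 (enum_val k).2.

Lemma pos_vecK S x : (forall i j, (i, j) \notin S -> x i j = 0) ->
  pos_mx (pos_vec S x) = x.
Proof.
move=> xS; apply/matrixP => i j; rewrite summxE.
have [ijS|ijS] := boolP ((i, j) \in S).
  rewrite (bigD1 (enum_rank_in ijS (i, j))) //= !mxE enum_rankK_in //= !eqxx mulr1.
  rewrite big1 ?addr0 // => k kij; rewrite !mxE.
  case: eqP => [E1|]; last by rewrite mulr0.
  case: eqP => [E2|]; last by rewrite mulr0.
  case/eqP: kij; apply: enum_val_inj; rewrite enum_rankK_in //.
  by rewrite [LHS]surjective_pairing -E1 -E2.
rewrite xS // big1 // => k _; rewrite !mxE.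
case: eqP => [E1|]; last by rewrite mulr0.
case: eqP => [E2|]; last by rewrite mulr0.
by move: ijS; rewrite E1 E2 -surjective_pairing enum_valP.
Qed.

Lemma pos_mx0 S (y : 'rV[K]_#|S|) i j : (i, j) \notin S -> pos_mx y i j = 0.
Proof.
move=> ijS; rewrite summxE big1 // => k _; rewrite !mxE.
case: eqP => [E1|]; last by rewrite mulr0.
case: eqP => [E2|]; last by rewrite mulr0.
by move: ijS; rewrite E1 E2 -surjective_pairing enum_valP.
Qed.

Lemma pos_mxK S (y : 'rV[K]_#|S|) : pos_vec S (pos_mx y) = y.
Proof.
apply/rowP => k; rewrite mxE summxE (bigD1 k) //= !mxE !eqxx mulr1.
rewrite big1 ?addr0 // => l lk; rewrite !mxE.
case: eqP => [E1|]; last by rewrite mulr0.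
case: eqP => [E2|]; last by rewrite mulr0.
case/eqP: lk; apply: enum_val_inj.
by rewrite [LHS]surjective_pairing -E1 -E2 -surjective_pairing.
Qed.

Lemma pos_vec_linear S c x x' :
  pos_vec S (c *: x + x') = c *: pos_vec S x + pos_vec S x'.
Proof. by apply/rowP => k; rewrite !mxE. Qed.

Lemma pos_mx_linear S c (y y' : 'rV[K]_#|S|) :
  pos_mx (c *: y + y') = c *: pos_mx y + pos_mx y'.
Proof.
rewrite /pos_mx scaler_sumr -big_split; apply: eq_bigr => k _.
by rewrite !mxE scalerDl scalerA.
Qed.

Lemma map_pos_mx (L : comNzRingType) (f : {rmorphism K -> L}) S (y : 'rV[K]_#|S|) :
  map_mx f (pos_mx y) = \sum_k f (y 0 k) *: delta_mx (enum_val k).1 (enum_val k).2.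
Proof.
apply/matrixP => i j; rewrite mxE !summxE rmorph_sum; apply: eq_bigr => k _.
by rewrite !mxE rmorphM rmorph_nat.
Qed.

End Positions.

Lemma map_mx_pos_mx (K L : comNzRingType) n (f : {rmorphism K -> L})
    (S : {set 'I_n * 'I_n}) (y : 'rV[K]_#|S|) :
  map_mx f (pos_mx y) = pos_mx (map_mx f y).
Proof. by rewrite map_pos_mx; apply: eq_bigr => k _; rewrite mxE. Qed.

Section RelPos.
Variables (K : fieldType) (n : nat).
Implicit Types (a : 'M[K]_n).

Definition rel_pos (R : rel 'I_n) (I : {set 'I_n}) : {set 'I_n * 'I_n} :=
  [set p | [&& p.1 \in I, p.2 \in I & R p.1 p.2]].

Lemma pos_mx_incid R I (y : 'rV[K]_#|rel_pos R I|) :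
  corner I I (pos_mx y) /\ incid R (pos_mx y).
Proof.
split; first by apply/corner0P => i j /negP nI; apply: pos_mx0;
  rewrite inE /=; apply/negP => /and3P[iI jI _]; case: nI; rewrite iI.
by move=> i j nR; apply: pos_mx0; rewrite inE (negPf nR) !andbF.
Qed.

Lemma pos_vecK_incid R I a : corner I I a -> incid R a ->
  pos_mx (pos_vec (rel_pos R I) a) = a.
Proof.
move=> /corner0P aI aR; apply: pos_vecK => i j; rewrite inE /=.
rewrite andbA negb_and => /orP[/aI//|]; exact: aR.
Qed.

Lemma pos_vecK_corner (I J : {set 'I_n}) a : corner I J a ->
  pos_mx (pos_vec (setX I J) a) = a.
Proof. by move=> /corner0P aI; apply: pos_vecK => i j; rewrite inE /= => /aI. Qed.

End RelPos.

Section HomMatrix.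
Variables (K : fieldType) (n : nat) (RA RB : rel 'I_n).
Hypotheses (fA : chain_union RA) (fB : chain_union RB).
Implicit Types (I J : {set 'I_n}) (a b g h u v x : 'M[K]_n).

Let Ar : reflexive RA. Proof. by case: fA. Qed.
Let At : transitive RA. Proof. by case: fA. Qed.
Let Br : reflexive RB. Proof. by case: fB. Qed.
Let Bt : transitive RB. Proof. by case: fB. Qed.

(** In coordinates, the map whose kernel is the space of morphisms and whose cokernel is the space
    of extensions. *)
Definition ext_fun I J g g' (y : 'rV[K]_(#|rel_pos RA I| + #|rel_pos RB J|)) :
    'rV[K]_#|setX I J| :=
  pos_vec (setX I J) (pos_mx (lsubmx y) *m g - g' *m pos_mx (rsubmx y)).

Lemma ext_fun_linear I J g g' : linear (@ext_fun I J g g').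
Proof.
move=> c y y'; rewrite /ext_fun -pos_vec_linear; congr pos_vec.
rewrite !linearP /= !pos_mx_linear mulmxDl mulmxDr -!scalemxAl -!scalemxAr.
by rewrite scalerBr opprD !addrA; congr (_ + _); rewrite addrAC.
Qed.

HB.instance Definition _ I J g g' :=
  GRing.isLinear.Build K 'rV[K]_(#|rel_pos RA I| + #|rel_pos RB J|)
    'rV[K]_#|setX I J| *:%R (@ext_fun I J g g') (@ext_fun_linear I J g g').

Definition ext_mx I J g g' := lin1_mx (@ext_fun I J g g').

Lemma ext_mxP I J g g' a b : corner I I a -> incid RA a -> corner J J b -> incid RB b ->
  row_mx (pos_vec (rel_pos RA I) a) (pos_vec (rel_pos RB J) b) *m ext_mx I J g g' =
  pos_vec (setX I J) (a *m g - g' *m b).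
Proof.
move=> aI aA bJ bB; rewrite mul_rV_lin1 /= /ext_fun row_mxKl row_mxKr.
by rewrite !pos_vecK_incid.
Qed.

Lemma ext_mx_pencil I J g g' d t :
  ext_mx I J g (g' + t *: d) = ext_mx I J g g' + t *: ext_mx I J 0 d.
Proof.
apply/row_matrixP => i; rewrite linearD linearZ /= !rowE !mul_rV_lin1 /= /ext_fun.
rewrite [RHS]addrC -pos_vec_linear; congr pos_vec.
by rewrite mulmx0 sub0r mulmxDl -scalemxAl opprD scalerN addrA [RHS]addrC.
Qed.

(** Vanishing of the space of self-extensions. *)
Definition rigid I J g := forall x, corner I J x -> exists a b,
  [/\ corner I I a /\ incid RA a, corner J J b /\ incid RB b &
      x = a *m g - g *m b].

Lemma rigidP I J g : corner I J g -> rigid I J g <-> row_full (ext_mx I J g g).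
Proof.
move=> gc; have cc a b : corner I I a -> corner J J b -> corner I J (a *m g - g *m b).
  by move=> aI bJ; apply: cornerB; [apply: cornerM gc|apply: cornerM bJ].
split=> [rg|full x xc].
  rewrite -sub1mx; apply/rV_subP => y _.
  have [|a [b [[aI aA] [bJ bB] E]]] := rg (pos_mx y).
    by apply/corner0P => i j nij; apply: pos_mx0; rewrite inE.
  by rewrite -[y]pos_mxK E -ext_mxP // submxMl.
have /submxP[y Ey] : (pos_vec (setX I J) x <= ext_mx I J g g)%MS by apply: submx_full.
exists (pos_mx (lsubmx y)), (pos_mx (rsubmx y)).
split; [exact: pos_mx_incid..|].
rewrite -[LHS](pos_vecK_corner xc) Ey mul_rV_lin1 /= pos_vecK_corner //.
by apply: cc; apply: (pos_mx_incid _).1.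
Qed.

Definition endo I J g a b :=
  [/\ corner I I a /\ incid RA a, corner J J b /\ incid RB b & a *m g = g *m b].

(** Positivity of the Euler form: the dimension of the algebra of pairs [(a, b)] exceeds that of the
    space of matrices on which it acts. *)
Definition tits_pos I J := (#|I| * #|J| < #|rel_pos RA I| + #|rel_pos RB J|)%N.

(** The Euler form is the dimension of the endomorphism space minus that of the self-extension
    space. It is at least 1, and the endomorphism space is a line because [b] is determined by [a]
    through the inverse of [g]. *)
Lemma brick_rigid I J g : cobj I J g -> tits_pos I J ->
  (forall a b, endo I J g a b -> exists c, a = c *: idm K I) -> rigid I J g.
Proof.
move=> og tp brick; have gc := cobj_corner og; have [h [_ hc gh hg]] := og.
apply/(rigidP gc).
have idA : corner I I (idm K I) /\ incid RA (idm K I).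
  by split; [apply: corner_idm|apply: incid_idm].
have idB : corner J J (idm K J) /\ incid RB (idm K J).
  by split; [apply: corner_idm|apply: incid_idm].
pose y0 := row_mx (pos_vec (rel_pos RA I) (idm K I)) (pos_vec (rel_pos RB J) (idm K J)).
have : (kermx (ext_mx I J g g) <= y0)%MS.
  apply/row_subP => i; set y := row i _.
  have : y *m ext_mx I J g g = 0 by apply/sub_kermxP; apply: row_sub.
  pose a := pos_mx (lsubmx y); pose b := pos_mx (rsubmx y).
  have [aI aA] : corner I I a /\ incid RA a by apply: pos_mx_incid.
  have [bJ bB] : corner J J b /\ incid RB b by apply: pos_mx_incid.
  have -> : y = row_mx (pos_vec (rel_pos RA I) a) (pos_vec (rel_pos RB J) b).
    by rewrite !pos_mxK hsubmxK.
  rewrite ext_mxP // => /(congr1 (@pos_mx _ _ _)).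
  rewrite pos_vecK_corner; last first.
    by apply: cornerB; [apply: cornerM gc|apply: cornerM bJ].
  have -> : @pos_mx K n (setX I J) 0 = 0.
    by rewrite /pos_mx big1 // => k _; rewrite mxE scale0r.
  move/subr0_eq => agb.
  have [|c ac] := brick a b; first by split.
  have bc : b = c *: idm K J.
    by rewrite -bJ.1 -hg -mulmxA -agb ac -scalemxAl gc.1 -scalemxAr hg.
  apply/sub_rVP; exists c; rewrite ac bc /y0 scale_row_mx.
  by congr row_mx; apply/rowP => k; rewrite !mxE.
move/mxrankS; rewrite mxrank_ker => kle.
rewrite /row_full eqn_leq rank_leq_col /=.
have arith (ij ab r c : nat) : (ij < ab -> ab - r <= 1 -> c = ij -> c <= r)%N by lia.
exact: arith tp (leq_trans kle (rank_leq_row _)) (cardsX I J).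
Qed.

End HomMatrix.

(** * Indecomposable objects are rigid *)

(** The split characteristic polynomial kills a coordinate vector of the corner; applying its linear
    factors one at a time, the last nonzero vector is an eigenvector. *)
Lemma corner_eigenvector (K : closedFieldType) n (I : {set 'I_n}) (a : 'M[K]_n) :
  corner I I a -> I != set0 ->
  exists c (y : 'cV[K]_n), [/\ idm K I *m y = y, a *m y = c *: y & y != 0].
Proof.
case: n I a => [|n] I a aI /set0Pn[i iI]; first by case: i iI.
have [r pr] := closed_field_poly_normal (char_poly a).
rewrite (monicP (char_poly_monic a)) scale1r in pr.
pose x : 'cV[K]_n.+1 := delta_mx i 0.
have : horner_mx a (\prod_(z <- r) ('X - z%:P)) *m x = 0.
  by rewrite -pr [horner_mx _ _]Cayley_Hamilton mul0mx.
have : x != 0.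
  apply/negP => /eqP/matrixP/(_ i 0); rewrite !mxE !eqxx => /eqP.
  by rewrite oner_eq0.
have : idm K I *m x = x.
  apply/colP => k; rewrite idm_mulE mxE eqxx andbT.
  by case: ifP => // kI; case: eqP => // ki; rewrite ki iI in kI.
elim: r x {pr} => [|z r IH] x xI x0.
  by rewrite big_nil rmorph1 mul1mx => xE; rewrite xE eqxx in x0.
rewrite big_cons mulrC rmorphM rmorphB /= horner_mx_X horner_mx_C.
rewrite -mulmxE -mulmxA => hx.
have [ax|ax] := eqVneq ((a - z%:M) *m x) 0; last first.
  apply: IH ax hx; rewrite mulmxBl mul_scalar_mx mulmxBr mulmxA aI.1.
  by rewrite -scalemxAr xI.
exists z, x; split=> //; apply: subr0_eq.
by rewrite -ax mulmxBl mul_scalar_mx.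
Qed.

Section Core.
Variables (K : fieldType) (n : nat) (RA RB : rel 'I_n).
Hypotheses (fA : chain_union RA) (fB : chain_union RB).
Implicit Types (I J : {set 'I_n}) (a b f g h u v x : 'M[K]_n).

Let Ar : reflexive RA. Proof. by case: fA. Qed.
Let At : transitive RA. Proof. by case: fA. Qed.
Let Br : reflexive RB. Proof. by case: fB. Qed.
Let Bt : transitive RB. Proof. by case: fB. Qed.

(** The image of [f] lies in its kernel, which is spanned by the coordinates [I0]. *)
Lemma sq0_corner I I0 f : I0 \subset I -> corner I I f -> f *m idm K I0 = 0 ->
  inj_on (I :\: I0) f -> f *m f = 0 -> corner I0 (I :\: I0) f.
Proof.
move=> sI fI f0 fi ff; have EI := idmDI K sI; split.
  rewrite -[RHS]fI.1 EI mulmxDl -[LHS]addr0; congr (_ + _).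
  apply/esym; apply: (inj_onM fi); first by rewrite mulmxA idm_id.
  have : f *m (idm K I0 *m f + idm K (I :\: I0) *m f) = 0.
    by rewrite -mulmxDl -EI fI.1 ff.
  by rewrite mulmxDr mulmxA f0 mul0mx add0r.
by rewrite -[RHS]fI.2 EI mulmxDr f0 add0r.
Qed.

(* Since [f] has square zero, it embeds the quotient by its kernel [I0] into
   the summand [I2] of [I0]. So the extension of the quotient by [I2] comes from a
   self-extension of [I2], which splits; the splitting is a nontrivial idempotent [ea]. *)
Lemma rigid_sub_dec I J I0 J0 I2 J2 g f b :
  cobj I J g -> endo RA RB I J g f b ->
  I0 \subset I -> J0 \subset J -> I2 \subset I0 -> J2 \subset J0 ->
  f *m idm K I0 = 0 -> b *m idm K J0 = 0 ->
  inj_on (I :\: I0) f -> inj_on (J :\: J0) b -> f *m f = 0 ->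
  idm K (I :\: I0) *m g *m idm K J0 = 0 ->
  idm K I2 *m g *m idm K (J0 :\: J2) = 0 ->
  idm K (I0 :\: I2) *m g *m idm K J2 = 0 ->
  idm K I2 *m f != 0 ->
  (forall x : 'cV[K]_n, idm K I2 *m (f *m x) = 0 -> f *m x = 0) ->
  rigid RA RB I2 J2 (idm K I2 *m g *m idm K J2) -> dec RA RB I J g.
Proof.
move=> og [[fI fA'] [bJ bB] fgb] sI sJ sI2 sJ2 f0 b0 fi bi ff g10 g23 g32 h0 hker rg.
have [h [gc hc gh hg]] := og.
have bb : b *m b = 0.
  have -> : b = h *m f *m g by rewrite -mulmxA fgb mulmxA hg bJ.1.
  by rewrite !mulmxA -[_ *m g *m h]mulmxA gh -(mulmxA _ (idm _ _)) fI.1 -(mulmxA h) ff mulmx0 mul0mx.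
have fc := sq0_corner sI fI f0 fi ff; have bc := sq0_corner sJ bJ b0 bi bb.
set I1 := I :\: I0 in fi fc g10; set J1 := J :\: J0 in bi bc.
have d12 : [disjoint I1 & I2] by apply: disjointWr sI2 (setD_disjoint _ _).
have EI : idm K I = idm K I2 + idm K (I0 :\: I2) + idm K I1.
  by rewrite (idmDI K sI) (idmDI K sI2).
have EJ : idm K J = idm K J2 + idm K (J0 :\: J2) + idm K J1.
  by rewrite (idmDI K sJ) (idmDI K sJ2).
set k := idm K I2 *m g *m idm K J2 in rg.
have gJ2 : g *m idm K J2 = k.
  rewrite -{1}gc.1 EI !mulmxDl g32 addr0 -{2}(idmMSr K sJ2).
  by rewrite [idm K I1 *m g *m _]mulmxA g10 mul0mx addr0.
have I2g : idm K I2 *m g = k + idm K I2 *m g *m idm K J1.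
  by rewrite -{1}gc.2 EJ !mulmxA !mulmxDr g23 addr0.
pose h2 := idm K I2 *m f; pose b2 := idm K J2 *m b.
have kb : h2 *m g = k *m b2.
  rewrite /h2 -mulmxA fgb mulmxA I2g mulmxDl -(mulmxA _ (idm K J1)).
  rewrite (corner_mull bc) ?mulmx0 ?addr0; last exact: setD_disjoint.
  by rewrite /b2 mulmxA -{2}gJ2 -(mulmxA g) idm_id gJ2.
have b2c : corner J2 J1 b2.
  by split; rewrite /b2 -?mulmxA ?bc.2 // mulmxA idm_id.
have h2c : corner I2 I1 h2.
  by split; rewrite /h2 -?mulmxA ?fc.2 // mulmxA idm_id.
have b2i : inj_on J1 b2.
  move=> x xJ b2x; apply: bi => //.
  have : h2 *m (g *m x) = 0 by rewrite mulmxA kb -mulmxA b2x mulmx0.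
  rewrite /h2 -mulmxA => /hker; rewrite mulmxA fgb -mulmxA => gbx.
  by rewrite -bJ.1 -hg -!mulmxA gbx mulmx0.
(* The pair [(h2, b2)] embeds the quotient into the summand. The left inverse [l] extends the class
   [e] along this embedding to a self-extension of the summand, to which rigidity applies. *)
have [l lb] := inj_on_linv b2c b2i.
set e := idm K I2 *m g *m idm K J1 in I2g.
have [|al [be [[alI alA] [beJ beB] E]]] := rg (idm K I2 *m (e *m l) *m idm K J2).
  exact: corner_mx.
have {}E : e = al *m h2 *m g - g *m (be *m b2).
  have <- : idm K I2 *m (e *m l) *m idm K J2 *m b2 = e.
    rewrite -mulmxA b2c.1 -mulmxA -(mulmxA e) lb /e !mulmxA idm_id.
    by rewrite -!mulmxA idm_id.
  have kbe : k *m be = g *m be by rewrite -gJ2 -(mulmxA g) beJ.1.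
  by rewrite E mulmxBl -(mulmxA al k) -kb kbe (mulmxA al) (mulmxA g).
pose ea := idm K I2 - al *m h2; pose eb := idm K J2 - be *m b2.
have yc : corner I2 I1 (al *m h2) by apply: cornerM alI h2c.
have eab : ea *m g = g *m eb.
  rewrite mulmxBl mulmxBr gJ2 I2g E.
  by rewrite -addrA; congr (_ + _); rewrite addrAC subrr sub0r.
have sI2I : I2 \subset I := subset_trans sI2 sI.
have sJ2J : J2 \subset J := subset_trans sJ2 sJ.
have y2 : al *m h2 *m idm K I2 = 0 by apply: corner_mulr yc d12.
have yy : al *m h2 *m (al *m h2) = 0.
  by rewrite -{2}yc.1 [LHS]mulmxA y2 mul0mx.
have ee : ea *m ea = ea.
  by rewrite mulmxBl mulmxBr idm_id yc.1 mulmxBr y2 yy subr0 subr0.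
have := @fitting_dec K n RA RB fA fB I J g ea eb og.
case=> //.
- by apply: cornerB; [apply: cornerW (corner_idm _ _)|apply: cornerW yc => //; apply: subsetDl].
- by apply: incidB; [apply: incid_idm|do 2?apply: incidM => //; apply: incid_idm].
- apply: cornerB; [by apply: cornerW (corner_idm _ _)|].
  by apply: cornerW (cornerM beJ b2c) => //; apply: subsetDl.
- by apply: incidB; [apply: incid_idm|do 2?apply: incidM => //; apply: incid_idm].
- have I1n : I1 != set0.
    apply: contra_neq h0 => I10.
    by rewrite -fc.2 I10 idm0 !mulmx0.
  have /set0Pn[i iI1] := I1n.
  pose x : 'cV[K]_n := delta_mx i 0.
  have xI1 : idm K I1 *m x = x.
    apply/colP => j; rewrite idm_mulE mxE eqxx andbT.
    by case: ifP => // jI; case: eqP => // ji; rewrite ji iI1 in jI.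
  have x2 : idm K I2 *m x = 0.
    by rewrite -xI1 mulmxA idmM0 ?mul0mx // disjoint_sym.
  (* This is the image of [x] under the complementary idempotent, hence killed by [ea]; its
     component on [I1] is still [x]. *)
  exists (x + al *m h2 *m x); split.
  + rewrite mulmxDr -{1}xI1 mulmxA idmMSr ?subsetDl // xI1; congr (_ + _).
    by rewrite mulmxA -yc.1 mulmxA idmMSr // yc.1.
  + rewrite mulmxBl !mulmxDr x2 add0r [idm K I2 *m _]mulmxA yc.1.
    by rewrite [_ *m (_ *m x)]mulmxA yy mul0mx addr0 subrr.
  + apply/eqP => /(congr1 (mulmx (idm K I1))).
    rewrite mulmxDr xI1 mulmx0 mulmxA (corner_mull yc) // mul0mx addr0.
    by move/matrixP/(_ i 0); rewrite !mxE !eqxx => /eqP; rewrite oner_eq0.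
- move=> [m em].
  have me : mpow ea m = ea by elim: m {em} => //= m IH; rewrite -/(mpow _ _) IH ee.
  have : ea *m idm K I2 = 0 by rewrite -me em mul0mx.
  rewrite mulmxBl idm_id y2 subr0 => i2; case/eqP: h0.
  by rewrite i2 mul0mx.
Qed.

End Core.

Section Ringel.
Variables (K : closedFieldType) (n : nat) (RA RB : rel 'I_n).
Hypotheses (fA : chain_union RA) (fB : chain_union RB).
Implicit Types (I J : {set 'I_n}) (a b f g h u v x : 'M[K]_n).

Let Ar : reflexive RA. Proof. by case: fA. Qed.
Let At : transitive RA. Proof. by case: fA. Qed.
Let Br : reflexive RB. Proof. by case: fB. Qed.
Let Bt : transitive RB. Proof. by case: fB. Qed.

Lemma dec_eqv I J g g' : cobj I J g -> eqv RA RB I J g g' ->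
  dec RA RB I J g' -> dec RA RB I J g.
Proof.
move=> og gg' [I1 [J1 [g1 [g2 [sI sJ o1 o2 e]]]]].
by exists I1, J1, g1, g2; split=> //; apply: eqv_trans e.
Qed.

Lemma endo_conj I J g a b u u' v v' : cobj I J g -> endo RA RB I J g a b ->
  incid_unit RA I u u' -> incid_unit RB J v v' ->
  endo RA RB I J (u *m g *m v) (u *m a *m u') (v' *m b *m v).
Proof.
move=> og [[aI aA] [bJ bB] ab] [[uI u'I uu' u'u] uA u'A] [[vJ v'J vv' v'v] vB v'B].
have gc := cobj_corner og.
split; [split|split|].
- by apply: cornerM u'I; apply: cornerM aI.
- by do 2?apply: (@incidM _ _ _ _ _ At).
- by apply: cornerM vJ; apply: cornerM bJ.
- by do 2?apply: (@incidM _ _ _ _ _ Bt).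
- rewrite !mulmxA -[_ *m u' *m u]mulmxA u'u -(mulmxA _ (idm K I)) gc.1.
  by rewrite -[_ *m v *m v']mulmxA vv' -(mulmxA _ (idm K J)) bJ.1 -(mulmxA u) ab !mulmxA.
Qed.

Definition all_tits_pos I J := forall I' J', I' \subset I -> J' \subset J ->
  I' != set0 -> #|I'| = #|J'| -> tits_pos RA RB I' J'.

(** The base change takes place inside the summand [(I2, J2)], so both of its pieces split off from
    the entire object. This is what makes a minimal summand indecomposable. *)
Lemma dec_extend I J I2 J2 g : I2 \subset I -> J2 \subset J ->
  cobj I J g ->
  idm K I2 *m g *m idm K (J :\: J2) = 0 ->
  idm K (I :\: I2) *m g *m idm K J2 = 0 ->
  dec RA RB I2 J2 (idm K I2 *m g *m idm K J2) ->
  exists I4 J4 s s' t t', [/\ [/\ I4 \subset I2, I4 != set0 & I4 != I2],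
    J4 \subset J2, incid_unit RA I2 s s' /\ incid_unit RB J2 t t' &
    let g' := (s + idm K (I :\: I2)) *m g *m (t + idm K (J :\: J2)) in
    [/\ idm K I4 *m g' *m idm K (J :\: J4) = 0,
        idm K (I :\: I4) *m g' *m idm K J4 = 0,
        idm K (I2 :\: I4) *m g' *m idm K (J :\: (J2 :\: J4)) = 0 &
        idm K (I :\: (I2 :\: I4)) *m g' *m idm K (J2 :\: J4) = 0]].
Proof.
move=> sI sJ og z1 z2 [I4 [J4 [g4 [g5 [sI4 sJ4 o4 o5 [s [s' [t [t' [sA tB E]]]]]]]]]].
have gc := cobj_corner og.
exists I4, J4, s, s', t, t'; split=> //.
have [c4 c5] := (cobj_corner o4, cobj_corner o5).
have [[[sc _ _ _] _ _] [[tc _ _ _] _ _]] := (sA, tB).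
pose g3 := idm K (I :\: I2) *m g *m idm K (J :\: J2).
have c3 : corner (I :\: I2) (J :\: J2) g3 by apply: corner_mx.
have -> : (s + idm K (I :\: I2)) *m g *m (t + idm K (J :\: J2)) = g4 + g5 + g3.
  have gE : g = idm K I2 *m g *m idm K J2 + g3.
    rewrite -{1}gc.1 -{1}gc.2 (idmDI K sI) (idmDI K sJ) mulmxDl !mulmxDr !mulmxA.
    by rewrite z1 z2 addr0 add0r.
  rewrite {1}gE mulmxDl !mulmxDr !mulmxDl -E.
  have k0 : idm K (I :\: I2) *m (idm K I2 *m g *m idm K J2) = 0.
    by rewrite !mulmxA idmM0 ?mul0mx // setD_disjoint.
  have s3 : s *m g3 = 0 by rewrite -c3.1 mulmxA (corner_mulr sc) ?mul0mx // disjoint_setD.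
  have t3 : g3 *m t = 0 by rewrite -c3.2 -mulmxA (corner_mull tc) ?mulmx0 // setD_disjoint.
  have k0' : idm K I2 *m g *m idm K J2 *m idm K (J :\: J2) = 0.
    by rewrite -mulmxA idmM0 ?mulmx0 // disjoint_setD.
  rewrite k0 s3 c3.1 t3 c3.2 -(mulmxA s _ (idm K (J :\: J2))) k0' mulmx0.
  by rewrite !mul0mx !addr0 !add0r.  
move: g3 c3 => g3 c3.
have mI i : (i \in I4) ==> (i \in I2) by apply/implyP; case: sI4 => /subsetP sI4 _ _; apply: sI4.
have mJ j : (j \in J4) ==> (j \in J2) by apply/implyP; apply: (subsetP sJ4).
move/corner0P: c4 => c4; move/corner0P: c5 => c5; move/corner0P: c3 => c3.
split; apply/matrixP => i j; rewrite mul_idmE idm_mulE !mxE;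
  case: ifP => // jJ; case: ifP => // iI;
  rewrite c4 ?c5 ?c3 ?addr0 //; move: (mI i) (mJ j) jJ iI; rewrite !inE;
  by case: (i \in I4); case: (i \in I2); case: (j \in J4); case: (j \in J2);
     rewrite //= ?andbF.
Qed.

Lemma setUD_id (A B : {set 'I_n}) : A \subset B -> A :|: (B :\: A) = B.
Proof. by move=> sAB; rewrite -[in X in X :|: _](setIidPr sAB) setID. Qed.

Lemma incid_unit_extend R I I1 u u' : reflexive R -> I1 \subset I ->
  incid_unit R I1 u u' ->
  incid_unit R I (u + idm K (I :\: I1)) (u' + idm K (I :\: I1)).
Proof.
move=> Rr sI uR; rewrite -{1}(setUD_id sI).
by apply: incid_unitD; [exact: disjoint_setD|done|exact: incid_unit1].
Qed.

Lemma extend_mull I I1 u : corner I1 I1 u ->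
  idm K I1 *m (u + idm K (I :\: I1)) = u.
Proof. by move=> uc; rewrite mulmxDr uc.1 idmM0 ?addr0 // disjoint_setD. Qed.

Lemma extend_mulr I I1 u : corner I1 I1 u ->
  (u + idm K (I :\: I1)) *m idm K I1 = u.
Proof. by move=> uc; rewrite mulmxDl uc.2 idmM0 ?addr0 // setD_disjoint. Qed.

(** A base change within the kernel coordinates [I1] preserves the kernel, and the units on both
    sides keep the square zero. *)
Lemma sq0_extend R I I1 f u u' : reflexive R -> I1 \subset I -> corner I I f ->
  f *m idm K I1 = 0 -> inj_on (I :\: I1) f -> f *m f = 0 -> incid_unit R I1 u u' ->
  let f' := (u + idm K (I :\: I1)) *m f *m (u' + idm K (I :\: I1)) in
  [/\ f' *m idm K I1 = 0, inj_on (I :\: I1) f' & f' *m f' = 0].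
Proof.
move=> Rr sI fI f0 fi ff uR f'.
have [[_ _ UU' U'U] _ _] := incid_unit_extend Rr sI uR.
have [[uc u'c _ _] _ _] := uR.
split.
- by rewrite -mulmxA extend_mulr // -mulmxA -u'c.1 (mulmxA f) f0 mul0mx mulmx0.
- move=> x xI f'x; apply: fi => //.
  have : (u' + idm K (I :\: I1)) *m (f' *m x) = 0 by rewrite f'x mulmx0.
  rewrite /f' !mulmxA U'U fI.1 -mulmxA mulmxDl xI -{1}xI mulmxA.
  by rewrite (corner_mulr u'c) ?mul0mx ?add0r // disjoint_setD.
- rewrite /f' !mulmxA -[_ *m (u' + _) *m (u + _)]mulmxA U'U.
  by rewrite -[_ *m f *m idm K I]mulmxA fI.2 -[_ *m f *m f]mulmxA ff mulmx0 mul0mx.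
Qed.

Lemma inj_on_neq0 I f (x : 'cV[K]_n) : inj_on I f -> idm K I *m x = x ->
  f *m x = 0 -> x != 0 -> False.
Proof. by move=> fi xI fx /eqP[]; apply: fi. Qed.

(* A non-scalar endomorphism would yield one of minimal rank and square zero;
   its image then meets some indecomposable summand [I2] of its kernel. *)
Lemma indec_rigid I J g : cobj I J g -> I != set0 -> all_tits_pos I J ->
  ~ dec RA RB I J g -> rigid RA RB I J g.
Proof.
have [m] := ubnP #|I|; elim: m I J g => // m IH I J g; rewrite ltnS => Im.
move=> og I0 W nd; apply: contrapT => nrg.
have gc := cobj_corner og; have IJ : #|I| = #|J| by case: og => h /cinv_card.
have [brick|] := pselect (forall a b, endo RA RB I J g a b -> exists c, a = c *: idm K I).
  by apply: nrg; apply: brick_rigid => //; apply: W.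
move=> /existsNP[a /existsNP[b /not_implyP[eab anc]]].
(* The competitors live on all objects isomorphic to [g], so that later base changes keep the
   minimal rank. *)
pose P (t : 'M[K]_n * 'M[K]_n * 'M[K]_n) := let: (g', f, b) := t in
  [/\ eqv RA RB I J g g', endo RA RB I J g' f b, f != 0 &
    exists x : 'cV[K]_n, [/\ idm K I *m x = x, f *m x = 0 & x != 0]].
(* Subtracting an eigenvalue makes a non-scalar endomorphism singular without making it zero. *)
have : exists t, P t.
  have [[aI aA] [bJ bB] agb] := eab.
  have [c [y [yI ay y0]]] := corner_eigenvector aI I0.
  exists (g, a - c *: idm K I, b - c *: idm K J); split.
  - exact: eqv_refl.
  - split; [split|split|].
    + by apply: cornerB => //; apply: cornerZ; apply: corner_idm.
    + by apply: incidB => //; apply: incidZ; apply: incid_idm.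
    + by apply: cornerB => //; apply: cornerZ; apply: corner_idm.
    + by apply: incidB => //; apply: incidZ; apply: incid_idm.
    + by rewrite mulmxBl mulmxBr agb -scalemxAl -scalemxAr gc.1 gc.2.
  - by apply/eqP => /subr0_eq ac; apply: anc; exists c.
  - by exists y; split; rewrite // mulmxBl ay -scalemxAl yI subrr.
case/(@ex_min_nat _ _ (fun t => \rank t.1.2)) => -[[g0 f0] b0] /= [gg0 e0 f0n0 x0] fmin.
have og0 := cobj_eqv gg0 og.
have nd0 g' : eqv RA RB I J g g' -> ~ dec RA RB I J g'.
  by move=> gg' /(dec_eqv og gg').
have [[f0I f0A] [b0J b0B] fgb0] := e0.
(* By Fitting's lemma [f0] is nilpotent. A nonzero square would be a competitor, hence of the same
   rank, so [f0] would be injective on its image and no power could vanish. *)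
have f00 : f0 *m f0 = 0.
  have [[k fk]|/(nd0 _ gg0)//] := fitting_dec fA fB og0 f0I f0A b0J b0B fgb0 x0.
  apply: contrapT => /eqP ff.
  have : P (g0, f0 *m f0, b0 *m b0).
    split=> //; last by case: x0 => x [xI fx xn]; exists x; rewrite -mulmxA fx mulmx0.
    split; [split|split|]; rewrite -?mulmxA.
    - exact: (cornerM f0I f0I).
    - exact: incidM.
    - exact: (cornerM b0J b0J).
    - exact: incidM.
    - by rewrite fgb0 !mulmxA fgb0.
  move/fmin => /= le; have E : \rank (f0 *m f0) = \rank f0.
    by apply/eqP; rewrite eqn_leq mxrankM_maxl le.
  have kerf (x : 'M[K]_n) : f0 *m (f0 *m x) = 0 -> f0 *m x = 0.
    exact: mxrank_mul_kernel.
  case/eqP: f0n0; clear -fk ff kerf; elim: k fk => // -[|k] IHk; first by rewrite /mpow /= => E; rewrite E eqxx in ff.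
  by move/kerf/IHk.
have [I1 [w [w' [sI1 wA f10 f1i]]]] := kernel_adapt fA f0I f0A.
have [J1 [y [y' [sJ1 yB b10 b1i]]]] := kernel_adapt fB b0J b0B.
have I1n : I1 != set0.
  apply/eqP => I1E; case: x0 => x [xI fx xn].
  have [[wI w'I ww' w'w] _ _] := wA.
  apply: (@inj_on_neq0 _ _ (w' *m x) f1i).
  - by rewrite I1E setD0 mulmxA w'I.1.
  - by rewrite -!mulmxA (mulmxA w) ww' xI fx mulmx0.
  - by apply: contra_neq xn => /(congr1 (mulmx w)); rewrite mulmxA ww' xI mulmx0.
have w'A := incid_unit_sym wA.
have e1 := endo_conj og0 e0 w'A yB.
set g1 := w' *m g0 *m y in e1; set f1 := w' *m f0 *m w in f10 f1i e1.
set b1 := y' *m b0 *m y in b10 b1i e1.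
have g01 : eqv RA RB I J g0 g1 by exists w', w, y, y'.
have gg1 := eqv_trans fA fB gg0 g01.
have og1 := cobj_eqv gg1 og.
have [[f1I f1A] [b1J b1B] fgb1] := e1.
have [h1 [g1c h1c gh1 hg1]] := og1.
have f11 : f1 *m f1 = 0.
  rewrite /f1 !mulmxA; case: wA => [[_ _ ww' _] _ _].
  by rewrite -[_ *m w *m w']mulmxA ww' -(mulmxA w') f0I.2 -(mulmxA w') f00 mulmx0 mul0mx.
have rf1 : (\rank f1 <= \rank f0)%N.
  by apply: leq_trans (mxrankM_maxl _ _) (mxrankM_maxr _ _).
have f1n0 : f1 != 0.
  apply: contra_neq f0n0 => f1E; case: wA => [[_ _ ww' _] _ _].
  have <- : w *m f1 *m w' = f0 by rewrite /f1 !mulmxA ww' f0I.1 -mulmxA ww' f0I.2.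
  by rewrite f1E mulmx0 mul0mx.
have f1c := sq0_corner sI1 f1I f10 f1i f11.
have I1I : I1 != I.
  by apply: contra_neq f1n0 => E; rewrite -f1c.2 E setDv idm0 mulmx0.

clearbody g1 f1 b1.
(* The kernel of an endomorphism is a subobject: [g1] is block triangular for [I1] and [J1]. *)
have g1z : idm K (I :\: I1) *m g1 *m idm K J1 = 0.
  apply: (inj_onM f1i); first by rewrite !mulmxA idm_id.
  by rewrite !mulmxA f1c.2 fgb1 -mulmxA b10 mulmx0.
have h1z : idm K (J :\: J1) *m h1 *m idm K I1 = 0.
  have b1c : b1 *m idm K (J :\: J1) = b1.
    by rewrite -[RHS]b1J.2 (idmDI K sJ1) mulmxDr b10 add0r.
  apply: (inj_onM b1i); first by rewrite !mulmxA idm_id.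
  rewrite !mulmxA b1c -[b1]b1J.1 -hg1 -(mulmxA h1) -fgb1.
  by rewrite -[_ *m h1]mulmxA -(mulmxA f1) gh1 f1I.2 -mulmxA f10 mulmx0.
pose k := idm K I1 *m g1 *m idm K J1.
have gk : g1 *m idm K J1 = k.
  by rewrite -{1}g1c.1 (idmDI K sI1) !mulmxDl g1z addr0.
pose k' := idm K J1 *m h1 *m idm K I1.
have hk : h1 *m idm K I1 = k'.
  by rewrite -{1}h1c.1 (idmDI K sJ1) !mulmxDl h1z addr0.
have ok : cobj I1 J1 k.
  have kc : corner I1 J1 k by apply: corner_mx.
  have k'c : corner J1 I1 k' by apply: corner_mx.
  exists k'; split=> //.
    by rewrite -gk -mulmxA k'c.1 -hk mulmxA gh1 idmMSr.
  by rewrite -hk -mulmxA kc.1 -gk mulmxA hg1 idmMSr.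
(* The candidates are the summands [I2] of the kernel object, in any basis, onto which the image of
   [f1] projects nontrivially; the whole kernel is one. A smallest candidate is indecomposable,
   since one of two pieces would again receive the image, and the induction hypothesis makes it
   rigid. *)
pose P2 (t : ({set 'I_n} * {set 'I_n}) * ('M[K]_n * 'M[K]_n) * ('M[K]_n * 'M[K]_n)) :=
  let: ((I2, J2), (U, U'), (V, V')) := t in
  [/\ I2 \subset I1 /\ J2 \subset J1,
      incid_unit RA I1 U U' /\ incid_unit RB J1 V V',
      idm K I2 *m (U *m k *m V) *m idm K (J1 :\: J2) = 0,
      idm K (I1 :\: I2) *m (U *m k *m V) *m idm K J2 = 0 &
      idm K I2 *m U *m f1 != 0].
have : exists t, P2 t.
  exists ((I1, J1), (idm K I1, idm K I1), (idm K J1, idm K J1)); split=> //.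
  - by split; apply: incid_unit1.
  - by rewrite setDv idm0 mulmx0.
  - by rewrite setDv idm0 !mul0mx.
  - by rewrite idm_id f1c.1.
move/(@ex_min_nat _ P2 (fun t => #|t.1.1.1|)) => [[[[I2 J2] [U U']] [V V']] PP].
move: PP => /= [[sI2 sJ2] [UA VB] z1 z2 hn0] I2min.
pose kk := U *m k *m V; rewrite -/kk in z1 z2.
have [kc k'c] : corner I1 J1 kk /\ cobj I1 J1 kk.
  have okk : cobj I1 J1 kk.
    have ekk : eqv RA RB I1 J1 k kk by exists U, U', V, V'.
    exact: cobj_eqv ekk ok.
  by split=> //; apply: cobj_corner.
have [kk' okk] := k'c.
have [ok2 _ _] := cinv_block okk sI2 sJ2 z1 z2.
have I2n : I2 != set0 by apply: contra_neq hn0 => ->; rewrite idm0 !mul0mx.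
have rg2 : rigid RA RB I2 J2 (idm K I2 *m kk *m idm K J2).
  apply: IH => //.
  - apply: leq_ltn_trans (subset_leq_card sI2) _.
    by apply: leq_trans Im; apply: proper_card; rewrite properEneq I1I.
  - by exists (idm K J2 *m kk' *m idm K I2).
  - move=> I' J' sI' sJ'; apply: W.
      exact: subset_trans sI' (subset_trans sI2 sI1).
    exact: subset_trans sJ' (subset_trans sJ2 sJ1).
  case/(dec_extend sI2 sJ2 k'c z1 z2).
  move=> I4 [J4 [s [s' [t [t' [[sI4 I4n I4I2] sJ4 [sA tB] /= [y1 y2 y3 y4]]]]]]].
  have sA' := incid_unit_extend Ar sI2 sA; have tB' := incid_unit_extend Br sJ2 tB.
  set S := s + _ in y1 y2 y3 y4 sA'; set T := t + _ in y1 y2 y3 y4 tB'.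
  have E : S *m kk *m T = (S *m U) *m k *m (V *m T) by rewrite /kk !mulmxA.
  rewrite E in y1 y2 y3 y4.
  have SUA : incid_unit RA I1 (S *m U) (U' *m (s' + idm K (I1 :\: I2))) by apply: incid_unitM.
  have VTB : incid_unit RB J1 (V *m T) ((t' + idm K (J1 :\: J2)) *m V') by apply: incid_unitM.
  have sI41 := subset_trans sI4 sI2; have sJ41 := subset_trans sJ4 sJ2.
  have sI51 : I2 :\: I4 \subset I1 by apply: subset_trans (subsetDl _ _) sI2.
  have sJ51 : J2 :\: J4 \subset J1 by apply: subset_trans (subsetDl _ _) sJ2.
  have [e4|n4] := eqVneq (idm K I4 *m (S *m U) *m f1) 0; last first.
    have := I2min ((I4, J4), (S *m U, U' *m (s' + idm K (I1 :\: I2))),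
      (V *m T, (t' + idm K (J1 :\: J2)) *m V')).
    rewrite /= leqNgt proper_card ?properEneq ?I4I2 // => H.
    by have // : ~~ true by apply: H; split.
  have [e5|n5] := eqVneq (idm K (I2 :\: I4) *m (S *m U) *m f1) 0; last first.
    have := I2min ((I2 :\: I4, J2 :\: J4), (S *m U, U' *m (s' + idm K (I1 :\: I2))),
      (V *m T, (t' + idm K (J1 :\: J2)) *m V')).
    rewrite /= leqNgt proper_card /=; last first.
      apply/properP; split; first exact: subsetDl.
      by case/set0Pn: I4n => i i4; exists i; rewrite ?(subsetP sI4) // inE i4.
    move=> H; by have // : ~~ true by apply: H; split.
  case/eqP: hn0; have [[sc s'c ss' s's] _ _] := sA.
  have : idm K I2 *m (S *m U) *m f1 = 0.
    rewrite (idmDI K sI4) (mulmxDl (idm K I4)) (mulmxDl (idm K I4 *m _)).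
    by rewrite e4 e5 addr0.
  rewrite !mulmxA extend_mull // => /(congr1 (mulmx s')).
  by rewrite mulmx0 !mulmxA s's.
have V'B := incid_unit_sym VB.
have [f21 f2i f22] := sq0_extend Ar sI1 f1I f10 f1i f11 UA.
have b11 : b1 *m b1 = 0.
  have bE : b1 = h1 *m f1 *m g1 by rewrite -mulmxA fgb1 mulmxA hg1 b1J.1.
  rewrite {1}bE -!mulmxA -fgb1 (mulmxA f1) f11 mul0mx mulmx0 //.
have [b21 b2i b22] := sq0_extend Br sJ1 b1J b10 b1i b11 V'B.
have UA' := incid_unit_extend Ar sI1 UA.
have VB' := incid_unit_extend Br sJ1 VB.
have e2 := endo_conj og1 e1 UA' VB'.
set UU := U + _ in f21 f2i f22 UA' e2; set UU' := U' + _ in f21 f2i f22 UA' e2.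
set VV := V + _ in b21 b2i b22 VB' e2; set VV' := V' + _ in b21 b2i b22 VB' e2.
set g2 := UU *m g1 *m VV in e2; set f2 := UU *m f1 *m UU' in f21 f2i f22 e2.
set b2 := VV' *m b1 *m VV in b21 b2i b22 e2.
have gg2 : eqv RA RB I J g g2.
  by apply: eqv_trans gg1 _ => //; exists UU, UU', VV, VV'.
have [[Uc _ _ _] _ _] := UA; have [[Vc _ _ _] _ _] := VB.
have kkE : kk = U *m g1 *m V.
  by rewrite /kk /k !mulmxA Uc.2 -mulmxA Vc.1.
clearbody kk.
have g2k (A B : {set 'I_n}) : A \subset I1 -> B \subset J1 ->
  idm K A *m g2 *m idm K B = idm K A *m kk *m idm K B.
  move=> sA sB; rewrite -(idmMS K sA) -(idmMSr K sB) kkE /g2 -!mulmxA.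
  rewrite (mulmxA (idm K I1) UU) extend_mull // (mulmxA VV) extend_mulr //.
  by rewrite (mulmxA (idm K I1) U) Uc.1 (mulmxA V (idm K J1)) Vc.2.
have g2z : idm K (I :\: I1) *m g2 *m idm K J1 = 0.
  rewrite /g2 -!mulmxA extend_mulr // -Vc.1 (mulmxA _ UU) mulmxDr idm_id.
  rewrite (corner_mull Uc) ?add0r; last exact: setD_disjoint.
  by rewrite (mulmxA g1) (mulmxA (idm K _)) mulmxA g1z mul0mx.
have [[f2I f2A] [b2J b2B] fgb2] := e2.
have f2c := sq0_corner sI1 f2I f21 f2i f22.
have b2c := sq0_corner sJ1 b2J b21 b2i b22.
have h2n0 : idm K I2 *m f2 != 0.
  apply: contra_neq hn0 => f2E; have [[_ _ _ U'U] _ _] := UA'.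
  have : idm K I2 *m f2 *m UU = 0 by rewrite f2E mul0mx.
  rewrite /f2 -!mulmxA U'U f1I.2 (mulmxA (idm K I2)) -(idmMS K sI2) -(mulmxA (idm K I2)).
  by rewrite extend_mull // !mulmxA idmMS.
have g2z1 : idm K I2 *m g2 *m idm K (J1 :\: J2) = 0 by rewrite g2k ?subsetDl.
have g2z2 : idm K (I1 :\: I2) *m g2 *m idm K J2 = 0 by rewrite g2k ?subsetDl.
have rf2 : (\rank f2 <= \rank f0)%N.
  by apply: leq_trans rf1; apply: leq_trans (mxrankM_maxl _ _) (mxrankM_maxr _ _).
apply: (nd0 _ gg2).
clearbody g2 f2 b2.
apply: (rigid_sub_dec fA fB (cobj_eqv gg2 og) e2 sI1 sJ1 sI2 sJ2) => //; last first.
  by rewrite g2k.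
(* The projection of [f2] to the summand is again a nonzero singular endomorphism. Minimality
   forbids a drop in rank, so the projection is injective on the image of [f2]. *)
apply: mxrank_mul_kernel; apply/eqP; rewrite eqn_leq mxrankM_maxr /=.
apply: leq_trans rf2 _.
apply: (fmin (g2, idm K I2 *m f2, idm K J2 *m b2)).
have sI2I := subset_trans sI2 sI1; have sJ2J := subset_trans sJ2 sJ1.
split=> //.
- split; [split|split|].
  + by apply: cornerM f2I; apply: cornerW (corner_idm _ _).
  + by apply: incidM => //; apply: incid_idm.
  + by apply: cornerM b2J; apply: cornerW (corner_idm _ _).
  + by apply: incidM => //; apply: incid_idm.
  + have g2c := cobj_corner (cobj_eqv gg2 og).
    have r : g2 *m idm K J2 = idm K I2 *m g2 *m idm K J2.
      rewrite -{1}g2c.1 (idmDI K sI1) (idmDI K sI2) !mulmxDl g2z2 addr0.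
      by rewrite -(idmMSr K sJ2) [idm K (I :\: I1) *m _ *m _]mulmxA g2z mul0mx addr0.
    by rewrite -mulmxA fgb2 !mulmxA r -{1}b2c.1 mulmxA (idmDI K sJ2) mulmxDr g2z1 addr0.
- have /set0Pn[i iI1] := I1n.
  exists (delta_mx i 0); split.
  + apply/colP => j; rewrite idm_mulE mxE eqxx andbT; case: ifP => // jI.
    by case: eqP => // ji; rewrite ji (subsetP sI1) in jI.
  + have -> : delta_mx i 0 = idm K I1 *m delta_mx i 0 :> 'cV[K]_n.
      apply/colP => j; rewrite idm_mulE mxE eqxx andbT; case: ifP => // jI.
      by case: eqP => // ji; rewrite ji iI1 in jI.
    by rewrite -mulmxA (mulmxA f2) f21 mul0mx mulmx0.
  + by apply/eqP => /matrixP/(_ i 0); rewrite !mxE !eqxx => /eqP; rewrite oner_eq0.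
Qed.

End Ringel.

(** * Rigid objects *)

(* Cramer's rule extends a kernel vector at [t = 0] to a polynomial one. *)
Lemma pencil_kernel (K : fieldType) m r (M0 M1 : 'M[K]_(m, r)) (v0 : 'rV[K]_m) :
  row_full M0 -> v0 *m M0 = 0 ->
  exists v : 'rV[{poly K}]_m,
    (forall t, map_mx (horner_eval t) v *m (M0 + t *: M1) = 0) /\
    map_mx (horner_eval 0) v = v0.
Proof.
move=> /row_fullP[C CM0] v0M0.
pose M : 'M[{poly K}]_(m, r) := map_mx polyC M0 + 'X *: map_mx polyC M1.
pose w : 'rV[{poly K}]_m := map_mx polyC v0.
pose CM := map_mx polyC C *m M.
(* The product of [v] with [M] vanishes because [\adj CM] times [CM] is the scalar [\det CM]. At 0
   the matrix [CM] is the identity and [w] times [M] is zero, so [v] becomes [v0]. *)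
pose v := \det CM *: w - w *m M *m \adj CM *m map_mx polyC C.
have evC t p q (A : 'M[K]_(p, q)) : map_mx (horner_eval t) (map_mx polyC A) = A.
  by apply/matrixP => i j; rewrite !mxE /horner_eval hornerC.
have evM t : map_mx (horner_eval t) M = M0 + t *: M1.
  rewrite map_mxD !evC; congr (_ + _); rewrite map_mxZ evC /=.
  by rewrite /horner_eval hornerX.
exists v; split=> [t|].
  rewrite -evM -map_mxM; have -> : v *m M = 0; last by rewrite map_mx0.
  rewrite mulmxBl -[_ *m _ *m M]mulmxA -/CM -[_ *m \adj _ *m _]mulmxA mul_adj_mx.
  by rewrite mul_mx_scalar -scalemxAl subrr.
have evM0 : map_mx (horner_eval 0) M = M0 by rewrite evM scale0r addr0.
rewrite map_mxB map_mxZ !map_mxM evM0 !evC v0M0 !mul0mx subr0.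
by rewrite -det_map_mx map_mxM evC evM0 CM0 det1 scale1r.
Qed.

Section Rigid.
Variables (K : closedFieldType) (n : nat) (RA RB : rel 'I_n).
Hypotheses (fA : chain_union RA) (fB : chain_union RB).
Implicit Types (I J : {set 'I_n}) (a b f g h u v x : 'M[K]_n).

Let Ar : reflexive RA. Proof. by case: fA. Qed.
Let At : transitive RA. Proof. by case: fA. Qed.
Let Br : reflexive RB. Proof. by case: fB. Qed.
Let Bt : transitive RB. Proof. by case: fB. Qed.

Lemma det_corner_unit R I a : reflexive R -> transitive R ->
  corner I I a -> incid R a -> \det (a + idm K (~: I)) != 0 ->
  exists a', incid_unit R I a a'.
Proof.
move=> Rr Rt aI aR; rewrite -unitfE -unitmxE => au.
have [|w aw wR] := cinj_cinv aI.
  move=> x xI ax; rewrite -[x](mulKmx au).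
  by rewrite mulmxDl ax add0r -xI [idm K (~: I) *m _]mulmxA idmM setIC setICr idm0 mul0mx mulmx0.
by exists w; split=> //; apply: wR.
Qed.

(** Rigidity makes the extension matrix surjective at [t = 0], so the identity endomorphism extends
    to a polynomial family of morphisms between [g] and [g + t *: d]. These are invertible wherever
    the product [p] of two determinants is nonzero, and [p] is 1 at 0. *)
Lemma rigid_pencil I J g d : cobj I J g -> rigid RA RB I J g -> corner I J d ->
  exists2 p : {poly K}, p != 0 & forall t, p.[t] != 0 -> eqv RA RB I J g (g + t *: d).
Proof.
move=> og rg dc; have gc := cobj_corner og.
have full : row_full (ext_mx RA RB I J g g) by apply/rigidP.
pose v0 := row_mx (pos_vec (rel_pos RA I) (idm K I)) (pos_vec (rel_pos RB J) (idm K J)).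
have v0E : v0 *m ext_mx RA RB I J g g = 0.
  rewrite ext_mxP; do ?[exact: corner_idm|exact: incid_idm].
  by rewrite gc.1 gc.2 subrr; apply/rowP => k; rewrite !mxE.
have [v [vt v00]] := pencil_kernel (ext_mx RA RB I J 0 d) full v0E.
pose a t := pos_mx (map_mx (horner_eval t) (lsubmx v)).
pose b t := pos_mx (map_mx (horner_eval t) (rsubmx v)).
pose p := \det (pos_mx (lsubmx v) + map_mx polyC (idm K (~: I))) *
          \det (pos_mx (rsubmx v) + map_mx polyC (idm K (~: J))).
have evC t (A : 'M[K]_n) : map_mx (horner_eval t) (map_mx polyC A) = A.
  by apply/matrixP => i j; rewrite !mxE /horner_eval hornerC.
have pE t : p.[t] = \det (a t + idm K (~: I)) * \det (b t + idm K (~: J)).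
  rewrite /p hornerM -!/(horner_eval t _) -!det_map_mx !map_mxD !evC.
  by rewrite !map_mx_pos_mx.
have a0 : a 0 = idm K I.
  rewrite /a map_lsubmx v00 row_mxKl pos_vecK_incid //; first exact: corner_idm.
  exact: incid_idm.
have b0 : b 0 = idm K J.
  rewrite /b map_rsubmx v00 row_mxKr pos_vecK_incid //; first exact: corner_idm.
  exact: incid_idm.
have IC (A : {set 'I_n}) : idm K A + idm K (~: A) = 1%:M.
  by rewrite -idmT (idmDI K (subsetT A)) setTD.
exists p.
  apply/eqP => p0; have := pE 0; rewrite a0 b0 !IC !det1 p0 horner0 mulr1 => /eqP.
  by rewrite eq_sym oner_eq0.
move=> t; rewrite pE mulf_eq0 negb_or => /andP[da db].
have [aI aA] := pos_mx_incid (map_mx (horner_eval t) (lsubmx v)).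
have [bJ bB] := pos_mx_incid (map_mx (horner_eval t) (rsubmx v)).
rewrite -/(a t) in aI aA da; rewrite -/(b t) in bJ bB db.
have [a' aU] := det_corner_unit Ar At aI aA da.
have [b' bU] := det_corner_unit Br Bt bJ bB db.
exists (a t), a', b', (b t); split=> //; first exact: incid_unit_sym.
have : a t *m g - (g + t *: d) *m b t = 0.
  have := vt t; rewrite -ext_mx_pencil.
  rewrite -[map_mx _ v]hsubmxK -map_lsubmx -map_rsubmx.
  rewrite -[map_mx _ (lsubmx v)]pos_mxK -[map_mx _ (rsubmx v)]pos_mxK.
  rewrite ext_mxP // => /(congr1 (@pos_mx _ _ _)).
  rewrite pos_vecK_corner; last first.
    apply: cornerB; first exact: cornerM gc.
    by apply: cornerM bJ; apply: cornerD => //; apply: cornerZ.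
  by move->; rewrite /pos_mx big1 // => k _; rewrite mxE scale0r.
move/subr0_eq => ->; case: bU => [[_ _ bb' _] _ _].
rewrite -mulmxA bb'; have [_ ->] // : corner I J (g + t *: d).
by apply: cornerD => //; apply: cornerZ.
Qed.

(** On the line joining the two objects, all but finitely many points are isomorphic to [g1], and
    likewise to [g2]; an algebraically closed field has a point avoiding both sets of exceptions. *)
Lemma rigid_unique I J g1 g2 : cobj I J g1 -> cobj I J g2 ->
  rigid RA RB I J g1 -> rigid RA RB I J g2 -> eqv RA RB I J g1 g2.
Proof.
move=> o1 o2 r1 r2; have [c1 c2] := (cobj_corner o1, cobj_corner o2).
have [p1 p1n e1] := rigid_pencil o1 r1 (cornerB c2 c1).
have [p2 p2n e2] := rigid_pencil o2 r2 (cornerB c1 c2).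
have : p1 * (p2 \Po (1 - 'X)) != 0.
  rewrite mulf_neq0 //; apply: contra_neq p2n => p2E.
  have : (p2 \Po (1 - 'X)) \Po (1 - 'X) = 0 by rewrite p2E comp_poly0.
  by rewrite -comp_polyA comp_polyB comp_polyX comp_polyC opprB addrC subrK comp_polyXr.
move/closed_nonrootP => [t]; rewrite rootM negb_or => /andP[t1 t2].
have {}t1 := e1 t t1.
have {}t2 : eqv RA RB I J g2 (g2 + (1 - t) *: (g1 - g2)).
  by apply: e2; move: t2; rewrite /root horner_comp !hornerE.
apply: eqv_trans t1 _ => //; apply: eqv_sym => //.
have -> // : g1 + t *: (g2 - g1) = g2 + (1 - t) *: (g1 - g2).
by rewrite scalerBl scale1r [RHS]addrA (addrC g2) subrK -scalerN opprB.
Qed.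

Definition finite_type I J := exists s : seq 'M[K]_n,
  forall g, cobj I J g -> exists2 g', g' \in s & eqv RA RB I J g g'.

Lemma eqvD I J I1 J1 g1 g2 x y : I1 \subset I -> J1 \subset J ->
  corner I1 J1 g1 -> corner (I :\: I1) (J :\: J1) g2 ->
  eqv RA RB I1 J1 g1 x -> eqv RA RB (I :\: I1) (J :\: J1) g2 y ->
  eqv RA RB I J (g1 + g2) (x + y).
Proof.
move=> sI sJ g1c g2c [u1 [u1' [v1 [v1' [u1A v1B <-]]]]] [u2 [u2' [v2 [v2' [u2A v2B <-]]]]].
exists (u1 + u2), (u1' + u2'), (v1 + v2), (v1' + v2'); split.
- by rewrite -(setUD_id sI); apply: incid_unitD => //; apply: disjoint_setD.
- by rewrite -(setUD_id sJ); apply: incid_unitD => //; apply: disjoint_setD.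
have [[[u1c _ _ _] _ _] [[u2c _ _ _] _ _]] := (u1A, u2A).
have [[[v1c _ _ _] _ _] [[v2c _ _ _] _ _]] := (v1B, v2B).
have u12 : u1 *m g2 = 0 by rewrite -g2c.1 mulmxA (corner_mulr u1c) ?mul0mx // disjoint_setD.
have u21 : u2 *m g1 = 0 by rewrite -g1c.1 mulmxA (corner_mulr u2c) ?mul0mx // setD_disjoint.
have v12 : g1 *m v2 = 0 by rewrite -g1c.2 -mulmxA (corner_mull v2c) ?mulmx0 // disjoint_setD.
have v21 : g2 *m v1 = 0 by rewrite -g2c.2 -mulmxA (corner_mull v1c) ?mulmx0 // setD_disjoint.
have -> : (u1 + u2) *m (g1 + g2) = u1 *m g1 + u2 *m g2.
  by rewrite mulmxDl !mulmxDr u12 u21 addr0 add0r.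
rewrite mulmxDl !mulmxDr -(mulmxA u1 g1 v2) -(mulmxA u2 g2 v1) v12 v21.
by rewrite !mulmx0 addr0 add0r.
Qed.

(** A decomposable object is a sum over one of finitely many partitions of the index sets, with
    summands known by induction; the indecomposable objects on [(I, J)] form at most one isomorphism
    class. *)
Lemma finite_type_tits I J : all_tits_pos RA RB I J -> finite_type I J.
Proof.
have [m] := ubnP #|I|; elim: m I J => // m IH I J; rewrite ltnS => Im W.
have [I0|I0] := eqVneq I set0.
  exists [:: 0] => g og; exists 0; rewrite ?inE //.
  have gc := cobj_corner og; have -> : g = 0 by rewrite -gc.1 I0 idm0 mul0mx.
  by apply: eqv_refl => //; split; rewrite ?mulmx0 ?mul0mx.
pose good (q : {set 'I_n} * {set 'I_n}) := [&& q.1 \subset I, q.1 != set0, q.1 != I & q.2 \subset J].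
(* Index pairs that define no splitting receive empty lists, so that choice applies to all pairs. *)
have H q : exists s : seq 'M[K]_n * seq 'M[K]_n, good q ->
    (forall g, cobj q.1 q.2 g -> exists2 g', g' \in s.1 & eqv RA RB q.1 q.2 g g') /\
    (forall g, cobj (I :\: q.1) (J :\: q.2) g ->
       exists2 g', g' \in s.2 & eqv RA RB (I :\: q.1) (J :\: q.2) g g').
  case gq : (good q); last by exists ([::], [::]).
  case/and4P: gq => sI n0 nI sJ.
  have [||s1 s1P] := IH q.1 q.2.
  - by apply: leq_trans Im; apply: proper_card; rewrite properEneq nI.
  - by move=> I' J' sI' sJ'; apply: W; [apply: subset_trans sI' sI|apply: subset_trans sJ' sJ].
  have [||s2 s2P] := IH (I :\: q.1) (J :\: q.2).
  - apply: leq_trans Im; apply: proper_card; apply/properP; split; first exact: subsetDl.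
    by case/set0Pn: n0 => i iq; exists i; rewrite ?(subsetP sI) // inE iq.
  - by move=> I' J' sI' sJ'; apply: W; [apply: subset_trans sI' (subsetDl _ _)|apply: subset_trans sJ' (subsetDl _ _)].
  by exists (s1, s2).
have [S SP] := choice H.
pose s := flatten [seq [seq x + y | x <- (S q).1, y <- (S q).2] | q <- enum {: {set 'I_n} * {set 'I_n}}].
have decP g : dec RA RB I J g -> exists2 g', g' \in s & eqv RA RB I J g g'.
  move=> [I1 [J1 [g1 [g2 [[sI n0 nI] sJ o1 o2 e]]]]].
  have [|H1 H2] := SP (I1, J1); first by rewrite /good sI n0 nI sJ.
  have [x xs ex] := H1 _ o1; have [y ys ey] := H2 _ o2.
  exists (x + y).
    apply/flattenP; exists [seq x + y | x <- (S (I1, J1)).1, y <- (S (I1, J1)).2].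
      by apply/mapP; exists (I1, J1); rewrite // mem_enum.
    by apply/allpairsP; exists (x, y).
  apply: eqv_trans e _ => //.
  exact: eqvD sI sJ (cobj_corner o1) (cobj_corner o2) ex ey.
have [[g0 [o0 nd0]]|nex] := pselect (exists g, cobj I J g /\ ~ dec RA RB I J g).
  exists (g0 :: s) => g og; have [/decP[g' g's e]|nd] := pselect (dec RA RB I J g).
    by exists g'; rewrite // inE g's orbT.
  exists g0; first by rewrite inE eqxx.
  by apply: rigid_unique => //; apply: indec_rigid.
exists s => g og; apply: decP; apply: contrapT => nd.
by apply: nex; exists g.
Qed.

End Rigid.

(** * Cancellation *)

Section Cancellation.
Variables (K : closedFieldType) (n : nat) (RA RB : rel 'I_n).
Hypotheses (fA : chain_union RA) (fB : chain_union RB).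
Implicit Types (I J : {set 'I_n}) (a b f g h u v x : 'M[K]_n).

Let Ar : reflexive RA. Proof. by case: fA. Qed.
Let At : transitive RA. Proof. by case: fA. Qed.
Let Br : reflexive RB. Proof. by case: fB. Qed.
Let Bt : transitive RB. Proof. by case: fB. Qed.

(** The Schur complement of the pivot [a i i]. *)
Definition schur I i a :=
  idm K I *m a *m idm K I - (a i i)^-1 *: (idm K I *m a *m idm K [set i] *m (idm K [set i] *m a *m idm K I)).

Lemma idm1_sandwich i a : idm K [set i] *m a *m idm K [set i] = a i i *: idm K [set i].
Proof.
apply/matrixP => k l; rewrite mul_idmE idm_mulE !mxE !inE.
case: (k =P i) => [->|ki]; case: (l =P i) => [->|li]; rewrite ?eqxx ?andbT ?andbF ?mulr1 ?mulr0 //.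
by case: (i =P l) => [il|]; [case: li|rewrite mulr0].
Qed.

Lemma disjoint_set1 (I : {set 'I_n}) i : i \notin I -> [disjoint [set i] & I].
Proof. by rewrite disjoints1. Qed.

Lemma idmU1 I i : i \notin I -> idm K (i |: I) = idm K [set i] + idm K I.
Proof. by move=> iI; rewrite (idmDI K (subsetUl [set i] I)) setU1K. Qed.

(** A kernel vector [x] of the Schur complement extends by a multiple of the coordinate [i] to a
    kernel vector [x - z] of the unit [a]. *)
Lemma schur_unit R I i a a' : reflexive R -> transitive R -> i \notin I ->
  incid_unit R (i |: I) a a' -> a i i != 0 ->
  exists s', incid_unit R I (schur I i a) s'.
Proof.
move=> Rr Rt iI [[ac a'c aa' a'a] aR a'R] d0.
have d1 := disjoint_set1 iI; have d2 : [disjoint I & [set i]] by rewrite disjoint_sym.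
have sc : corner I I (schur I i a).
  apply: cornerB; first exact: corner_mx.
  by apply: cornerZ; apply: (@cornerM _ _ _ [set i]); apply: corner_mx.
have sR : incid R (schur I i a).
  apply: incidB; first by do 2?apply: incidM => //; apply: incid_idm.
  by apply: incidZ; do 4?apply: incidM => //; apply: incid_idm.
have [|w sw wR] := cinj_cinv sc; last by exists w; split=> //; apply: wR.
move=> x xI sx; set z := (a i i)^-1 *: (idm K [set i] *m a *m x).
have ax : idm K I *m a *m x = idm K I *m a *m z.
  apply: subr0_eq; rewrite -sx /schur /z mulmxBl -!mulmxA xI; congr (_ - _).
  by rewrite -scalemxAl -!scalemxAr -!mulmxA (mulmxA (idm K [set i]) (idm K [set i])) idm_id xI.
have az : idm K [set i] *m a *m x = idm K [set i] *m a *m z.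
  rewrite /z -scalemxAr -(mulmxA (idm K [set i]) a x) [X in _ = _ *: X]mulmxA idm1_sandwich.
  by rewrite -scalemxAl scalerA mulVf // scale1r.
have ay : a *m (x - z) = 0.
  rewrite mulmxBr -[a]ac.1 idmU1 // !mulmxDl ax az subrr //.
have xz : x = z.
  apply: subr0_eq; have E : idm K (i |: I) *m (x - z) = x - z.
    rewrite mulmxBr -xI mulmxA idmMSr ?subsetUr // xI; congr (_ - _).
    by rewrite /z -scalemxAr !mulmxA idmMSr // subsetUl.
  by rewrite -E -a'a -mulmxA ay mulmx0.
by rewrite -xI xz /z -scalemxAr !mulmxA idmM0 // !mul0mx scaler0.
Qed.

Variables (I J : {set 'I_n}) (i j : 'I_n).
Hypotheses (iI : i \notin I) (jJ : j \notin J).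
Let E : 'M[K]_n := delta_mx i j.

Let di1 : [disjoint [set i] & I]. Proof. exact: disjoint_set1. Qed.
Let di2 : [disjoint I & [set i]]. Proof. by rewrite disjoint_sym. Qed.
Let dj1 : [disjoint [set j] & J]. Proof. exact: disjoint_set1. Qed.
Let dj2 : [disjoint J & [set j]]. Proof. by rewrite disjoint_sym. Qed.

Lemma cinv_delta : cinv [set i] [set j] E (delta_mx j i : 'M[K]_n).
Proof.
have c k l : corner [set k] [set l] (delta_mx k l : 'M[K]_n).
  by apply/corner0P => k' l'; rewrite !inE mxE => /negPf->.
have m k l : (delta_mx k l : 'M[K]_n) *m delta_mx l k = idm K [set k].
  rewrite mul_delta_mx; apply/matrixP => k' l'; rewrite !mxE inE.
  by case: (k' =P k) => [->|_]; rewrite ?andbF // andbT eq_sym.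
split; [exact: c|exact: c|exact: m|exact: m].
Qed.

Lemma cobjU1 g : cobj I J g -> cobj (i |: I) (j |: J) (g + E).
Proof.
move=> [h [gc hc gh hg]]; have [Ec Ec' EE E'E] := cinv_delta.
exists (h + delta_mx j i); split.
- apply: cornerD; first by apply: cornerW gc; apply: subsetUr.
  by apply: cornerW Ec; apply: subsetUl.
- apply: cornerD; first by apply: cornerW hc; apply: subsetUr.
  by apply: cornerW Ec'; apply: subsetUl.
- rewrite mulmxDl !mulmxDr gh EE idmU1 // addrC; congr (_ + _).
    by rewrite -hc.1 mulmxA (corner_mulr Ec) ?mul0mx // add0r.
  by rewrite -Ec'.1 mulmxA (corner_mulr gc) ?mul0mx // addr0.
- rewrite mulmxDl !mulmxDr hg E'E idmU1 // addrC; congr (_ + _).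
    by rewrite -gc.1 mulmxA (corner_mulr Ec') ?mul0mx // add0r.
  by rewrite -Ec.1 mulmxA (corner_mulr hc) ?mul0mx // addr0.
Qed.

Lemma delta_blocks g g' a b : corner I J g -> corner I J g' ->
  corner (i |: I) (i |: I) a -> corner (j |: J) (j |: J) b ->
  a *m (g + E) = (g' + E) *m b ->
  [/\ idm K I *m a *m idm K I *m g = g' *m (idm K J *m b *m idm K J),
      idm K [set i] *m a *m idm K I *m g = E *m (idm K [set j] *m b *m idm K J),
      idm K I *m a *m idm K [set i] *m E = g' *m (idm K J *m b *m idm K [set j]) &
      a i i = b j j].
Proof.
move=> gc g'c ac bc ab; have [Ec _ _ _] := cinv_delta.
have El : idm K I *m E = 0 by apply: corner_mull Ec di2.
have Er : E *m idm K J = 0 by apply: corner_mulr Ec dj1.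
have gl h : corner I J h -> idm K [set i] *m h = 0 by move=> hc; apply: corner_mull hc di1.
have gr h : corner I J h -> h *m idm K [set j] = 0 by move=> hc; apply: corner_mulr hc dj2.
have L X Y : idm K X *m (a *m (g + E)) *m idm K Y = idm K X *m ((g' + E) *m b) *m idm K Y.
  by rewrite ab.
split.
- have := L I J; rewrite mulmxDr mulmxDl !mulmxDr !mulmxDl !mulmxA El mul0mx mul0mx addr0.
  rewrite -[_ *m E *m _]mulmxA Er mulmx0 addr0 g'c.1 -[_ *m g *m _]mulmxA gc.2 => H.
  by rewrite -!mulmxA gc.1 (mulmxA g') g'c.2 !mulmxA.
- have := L [set i] J; rewrite mulmxDr mulmxDl !mulmxDr !mulmxDl !mulmxA (gl _ g'c) mul0mx mul0mx add0r.
  rewrite -[_ *m E *m _]mulmxA Er mulmx0 addr0 Ec.1 -[_ *m g *m _]mulmxA gc.2 => H.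
  by rewrite -!mulmxA gc.1 (mulmxA E) Ec.2 !mulmxA.
- have := L I [set j]; rewrite mulmxDr mulmxDl !mulmxDr !mulmxDl !mulmxA El mul0mx mul0mx addr0.
  rewrite -[_ *m g *m _]mulmxA (gr _ gc) mulmx0 add0r g'c.1 -[_ *m E *m _]mulmxA Ec.2 => H.
  by rewrite -!mulmxA Ec.1 (mulmxA g') g'c.2 !mulmxA.
- move/matrixP/(_ i j): ab; rewrite mulmxDr mulmxDl ![(_ + _ : 'M[K]_n) i j]mxE.
  have -> : (a *m g) i j = 0 by rewrite -gc.2 mulmxA mul_idmE (negPf jJ).
  have -> : (g' *m b) i j = 0 by rewrite -g'c.1 -mulmxA idm_mulE (negPf iI).
  rewrite !add0r [(a *m _) i j]mxE (bigD1 i) //= mxE !eqxx mulr1 big1 ?addr0; last first.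
    by move=> k ki; rewrite mxE (negPf ki) mulr0.
  rewrite mxE (bigD1 j) //= mxE !eqxx mul1r big1 ?addr0 // => k kj.
  by rewrite mxE (negPf kj) andbF mul0r.
Qed.

(** [E] identifies the coordinates [i] and [j], so the pivots [a i i] and [b j j] agree and the two
    Schur complements intertwine [g] and [g']. *)
Lemma cancel_unit g g' a a' b b' : cobj I J g -> cobj I J g' ->
  incid_unit RA (i |: I) a a' -> incid_unit RB (j |: J) b b' ->
  a *m (g + E) = (g' + E) *m b -> a i i != 0 -> eqv RA RB I J g g'.
Proof.
move=> og og' aA bB ab d0; have [gc g'c] := (cobj_corner og, cobj_corner og').
have [[ac _ _ _] _ _] := aA; have [[bc _ _ _] _ _] := bB.
have [e11 e21 e12 e22] := delta_blocks gc g'c ac bc ab.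
have [s sA] := schur_unit Ar At iI aA d0.
rewrite e22 in d0; have [t tB] := schur_unit Br Bt jJ bB d0.
exists (schur I i a), s, t, (schur J j b); split=> //; first exact: incid_unit_sym.
have -> : schur I i a *m g = g' *m schur J j b.
  rewrite /schur mulmxBl mulmxBr e11 -scalemxAl -scalemxAr e22; congr (_ - _ *: _).
  by rewrite -(mulmxA _ _ g) e21 mulmxA e12 -(mulmxA g').
by case: tB => [[_ _ st _] _ _]; rewrite -mulmxA st g'c.2.
Qed.

(* If the entry [a i i] vanishes, a transvection along the inverse makes it [1]. *)
Lemma eqv_cancel g g' : cobj I J g -> cobj I J g' ->
  eqv RA RB (i |: I) (j |: J) (g + E) (g' + E) -> eqv RA RB I J g g'.
Proof.
move=> og og' [a [a' [b' [b [aA b'B ab]]]]].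
have bB := incid_unit_sym b'B; have a'A := incid_unit_sym aA.
have [[ac a'c aa' a'a] aR a'R] := aA; have [[bc b'c bb' b'b] bR b'R] := bB.
have [gc g'c] := (cobj_corner og, cobj_corner og').
have gEc := cobj_corner (cobjU1 og); have gEc' := cobj_corner (cobjU1 og').
have {}ab : a *m (g + E) = (g' + E) *m b.
  by rewrite -ab -[RHS]mulmxA b'b -mulmxA gEc.2.
have [d0|d0] := eqVneq (a i i) 0; last exact: (cancel_unit og og' aA bB ab).
have ab' : a' *m (g' + E) = (g + E) *m b'.
  have -> : g' + E = (g' + E) *m b *m b' by rewrite -mulmxA bb' gEc'.2.
  by rewrite -ab !mulmxA a'a gEc.1.
have [_ _ e12 _] := delta_blocks g'c gc a'c b'c ab'.
pose p := idm K I *m a' *m idm K [set i]; pose q := idm K J *m b' *m idm K [set j].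
have nil R (L : {set 'I_n}) k x x' : reflexive R -> transitive R -> k \notin L ->
    incid_unit R (k |: L) x x' -> let y := idm K L *m x *m idm K [set k] in
    incid_unit R (k |: L) (idm K (k |: L) + y) (idm K (k |: L) - y).
  move=> Rr Rt kL [_ xR _] y; have yc : corner L [set k] y by apply: corner_mx.
  apply: incid_unit_nil => //.
  - by apply: cornerW yc; [apply: subsetUr|apply: subsetUl].
  - by do 2?apply: incidM => //; apply: incid_idm.
  - by rewrite -{2}yc.1 mulmxA (corner_mulr yc) ?mul0mx // disjoint_set1.
have pA := nil _ _ _ _ _ Ar At iI a'A; have qB := nil _ _ _ _ _ Br Bt jJ b'B.
rewrite -/p in pA; rewrite -/q in qB.
apply: (cancel_unit og og' (incid_unitM At aA pA) (incid_unitM Bt bB qB)).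
  have [Ec _ _ _] := cinv_delta.
  have pE : p *m (g + E) = p *m E.
    by rewrite mulmxDr -{1}gc.1 /p (mulmxA _ (idm K I)) -(mulmxA _ _ (idm K I)) idmM0 ?mulmx0 ?mul0mx ?add0r.
  have Eq : (g + E) *m q = g *m q.
    by rewrite mulmxDl -{1}Ec.2 /q !mulmxA -(mulmxA E) idmM0 ?mulmx0 ?mul0mx ?addr0.
  (* The transvections form an automorphism of [g + E]: the inverse isomorphism gives equal products
     of [p] with [E] and of [g] with [q], while [p] times [g] and [E] times [q] vanish. *)
  have key : (idm K (i |: I) + p) *m (g + E) = (g + E) *m (idm K (j |: J) + q).
    by rewrite mulmxDl [RHS]mulmxDr gEc.1 gEc.2 pE Eq /p e12.
  by rewrite -mulmxA key mulmxA ab -mulmxA.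
rewrite mulmxDr ac.2 mxE d0 add0r.
have -> : (a *m p) i i = (a *m a') i i.
  rewrite [RHS]mxE [LHS]mxE; apply: eq_bigr => k _.
  rewrite mul_idmE idm_mulE inE eqxx; case: ifP => // /negbT kI.
  have [->|ki] := eqVneq k i; first by rewrite d0 !mul0r.
  suff -> : a i k = 0 by rewrite !mul0r.
  by rewrite -ac.2 mul_idmE !inE (negPf ki) (negPf kI).
by rewrite aa' mxE eqxx !inE eqxx oner_neq0.
Qed.

(** By cancellation, adding [E] is injective on isomorphism classes. Each listed object is replaced
    by some preimage, or by 0 if it has none. *)
Lemma finite_typeU1 : finite_type K RA RB (i |: I) (j |: J) -> finite_type K RA RB I J.
Proof.
move=> [s sP].
have H G : exists g, (exists g1, cobj I J g1 /\ eqv RA RB (i |: I) (j |: J) (g1 + E) G) ->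
    cobj I J g /\ eqv RA RB (i |: I) (j |: J) (g + E) G.
  have [[g1 g1P]|nex] := pselect (exists g1, cobj I J g1 /\ eqv RA RB (i |: I) (j |: J) (g1 + E) G).
    by exists g1.
  by exists 0.
have [c cP] := choice H.
exists [seq c G | G <- s] => g og.
have oE := cobjU1 og; have [G Gs e] := sP _ oE.
exists (c G); first by apply/mapP; exists G.
have [|oc ec] := cP G; first by exists g.
apply: eqv_cancel => //; apply: eqv_trans e _ => //.
by apply: eqv_sym => //; apply: cobj_corner; apply: cobjU1.
Qed.

End Cancellation.

Lemma finite_type_sub (K : closedFieldType) n (RA RB : rel 'I_n) (I J : {set 'I_n}) :
  chain_union RA -> chain_union RB -> #|I| = #|J| ->
  finite_type K RA RB [set: 'I_n] [set: 'I_n] -> finite_type K RA RB I J.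
Proof.
move=> fA fB IJ ft.
have [m] := ubnP (n - #|I|); elim: m I J IJ => // m IH I J IJ; rewrite ltnS => nI.
have cn (A : {set 'I_n}) : (#|A| <= n)%N := leq_trans (max_card _) (eq_leq (card_ord n)).
have full (A : {set 'I_n}) : (A == [set: 'I_n]) = (#|A| == n).
  by rewrite eqEcard subsetT cardsT card_ord eqn_leq cn.
have [IT|IT] := eqVneq I [set: 'I_n].
  suff /eqP JT : J == [set: 'I_n] by rewrite IT JT.
  by rewrite full -IJ -full IT.
have nfull (A : {set 'I_n}) : A != [set: 'I_n] -> exists i, i \notin A.
  by rewrite -subTset => /subsetPn[i _ iA]; exists i.
have [i iI] := nfull _ IT.
have [|j jJ] := nfull J; first by rewrite full -IJ -full.
apply: (finite_typeU1 fA fB iI jJ); apply: IH; first by rewrite !cardsU1 iI jJ IJ.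
have := cn (i |: I).
by rewrite cardsU1 iI /= add1n => Hn; apply: leq_trans nI; rewrite ltn_sub2l.
Qed.

(** * Dimension count *)

Section PolyFun.
Variables (K : fieldType) (V : finType).
Implicit Types (f : (V -> K) -> K) (d : nat).

Definition monom (e : V -> nat) (x : V -> K) := \prod_v x v ^+ e v.

(** The degree is bounded in each variable separately, so that [d.+1 ^ #|V|] monomials span these
    functions. *)
Definition polyfun d f := exists c : {ffun V -> 'I_d.+1} -> K,
  forall x, f x = \sum_e c e * monom (fun v => e v) x.

Lemma polyfun_ext d f f' : f =1 f' -> polyfun d f -> polyfun d f'.
Proof. by move=> ff [c cP]; exists c => x; rewrite -ff. Qed.

Lemma polyfun_monom d e : (forall v, e v <= d)%N -> polyfun d (monom e).
Proof.
move=> ed; pose e0 : {ffun V -> 'I_d.+1} := [ffun v => inord (e v)].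
exists (fun e' => (e' == e0)%:R) => x.
rewrite (bigD1 e0) //= eqxx mul1r big1 ?addr0; last by move=> e' /negPf->; rewrite mul0r.
by apply: eq_bigr => v _; rewrite ffunE inordK // ltnS.
Qed.

Lemma polyfunD d f f' : polyfun d f -> polyfun d f' -> polyfun d (fun x => f x + f' x).
Proof.
move=> [c cP] [c' c'P]; exists (fun e => c e + c' e) => x.
by rewrite cP c'P -big_split; apply: eq_bigr => e _; rewrite mulrDl.
Qed.

Lemma polyfunZ d k f : polyfun d f -> polyfun d (fun x => k * f x).
Proof.
move=> [c cP]; exists (fun e => k * c e) => x.
by rewrite cP big_distrr; apply: eq_bigr => e _; rewrite /= mulrA.
Qed.

Lemma polyfun_const d k : polyfun d (fun=> k).
Proof.
have := polyfunZ k (@polyfun_monom d (fun=> 0%N) (fun=> leq0n d)).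
by apply: polyfun_ext => x; rewrite /monom big1 ?mulr1.
Qed.

Lemma polyfun_var d v : (0 < d)%N -> polyfun d (fun x => x v).
Proof.
move=> d0; have [|c cP] := @polyfun_monom d (fun w => (w == v) : nat).
  by move=> w; apply: leq_trans (leq_b1 _) d0.
exists c => x; rewrite -cP /monom (bigD1 v) //= eqxx expr1 big1 ?mulr1 //.
by move=> w /negPf->.
Qed.

Lemma polyfun_sum d (T : Type) (r : seq T) (F : T -> (V -> K) -> K) :
  (forall t, polyfun d (F t)) -> polyfun d (fun x => \sum_(t <- r) F t x).
Proof.
move=> FP; elim: r => [|t r IH].
  by apply: polyfun_ext (polyfun_const d 0) => x; rewrite big_nil.
by apply: polyfun_ext (polyfunD (FP t) IH) => x; rewrite big_cons.
Qed.

Lemma polyfunM d d' f f' : polyfun d f -> polyfun d' f' ->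
  polyfun (d + d') (fun x => f x * f' x).
Proof.
move=> [c cP] [c' c'P].
suff : polyfun (d + d') (fun x => \sum_e \sum_e' c e * (c' e' *
    monom (fun v => e v + e' v)%N x)).
  apply: polyfun_ext => x; rewrite cP c'P big_distrl; apply: eq_bigr => e _.
  rewrite big_distrr; apply: eq_bigr => e' _ /=.
  rewrite -!mulrA; congr (_ * _); rewrite mulrCA; congr (_ * _).
  by rewrite /monom -big_split; apply: eq_bigr => v _; rewrite exprD.
apply: polyfun_sum => e; apply: polyfun_sum => e'.
do 2!apply: polyfunZ; apply: polyfun_monom => v.
by apply: leq_add; rewrite -ltnS.
Qed.

Lemma polyfun_le d d' f : (d <= d')%N -> polyfun d f -> polyfun d' f.
Proof.
move=> dd' fP; rewrite -(subnKC dd').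
by apply: polyfun_ext (polyfunM fP (polyfun_const _ 1)) => x; rewrite mulr1.
Qed.

Lemma polyfun_prod d (T : Type) (r : seq T) (F : T -> (V -> K) -> K) :
  (forall t, polyfun d (F t)) -> polyfun (size r * d) (fun x => \prod_(t <- r) F t x).
Proof.
move=> FP; elim: r => [|t r IH].
  by apply: polyfun_ext (polyfun_const _ 1) => x; rewrite big_nil.
by rewrite mulSn; apply: polyfun_ext (polyfunM (FP t) IH) => x; rewrite big_cons.
Qed.

(** The rows of [C] are the coefficient vectors of the functions; there are as many columns as
    monomials, which bounds the rank. *)
Lemma polyfun_matrix d (T : finType) (F : T -> (V -> K) -> K) :
  (forall t, polyfun d (F t)) ->
  exists2 C : 'M[K]_(#|T|, #|{ffun V -> 'I_d.+1}|), (\rank C <= d.+1 ^ #|V|)%N &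
    forall c : 'rV[K]_#|T|, c *m C = 0 -> forall x, \sum_t c 0 (enum_rank t) * F t x = 0.
Proof.
move=> /choice[c cP].
exists (\matrix_(i, k) c (enum_val i) (enum_val k)).
  by apply: leq_trans (rank_leq_col _) _; rewrite card_ffun card_ord.
move=> b bC x.
under eq_bigr => t _ do rewrite cP big_distrr.
rewrite exchange_big big1 // => e _ /=.
transitivity ((\sum_t b 0 (enum_rank t) * c t e) * monom (fun v => e v) x).
  by rewrite big_distrl; apply: eq_bigr => t _; rewrite /= mulrA.
have -> : \sum_t b 0 (enum_rank t) * c t e = 0; last by rewrite mul0r.
move/matrixP/(_ 0 (enum_rank e)): bC; rewrite !mxE; apply: etrans.
rewrite [RHS](reindex _ (onW_bij _ (@enum_rank_bij T))).
by apply: eq_bigr => t _; rewrite !mxE !enum_rankK.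
Qed.

End PolyFun.

(** Each condition lowers the dimension of the solution space by at most [rho]. *)
Lemma common_kernel (K : fieldType) N rho (Q : eqType) (r : Q -> nat)
    (C : forall q, 'M[K]_(N, r q)) (qs : seq Q) :
  {in qs, forall q, \rank (C q) <= rho}%N -> (size qs * rho < N)%N ->
  exists2 c : 'rV[K]_N, c != 0 & all (fun q => c *m C q == 0) qs.
Proof.
move=> Cr lt.
have [U rU UC] : exists2 U : 'M[K]_N, (N <= \rank U + size qs * rho)%N &
    all (fun q => U *m C q == 0) qs.
  elim: qs Cr {lt} => [|q qs IH] Cr.
    by exists 1%:M; rewrite // mxrank1 addn0.
  have [|U rU UC] := IH; first by move=> q' q's; apply: Cr; rewrite inE q's orbT.
  exists (U :&: kermx (C q))%MS.
    apply: leq_trans rU _; rewrite -(mxrank_mul_ker U (C q)) /= mulSn addnA leq_add2r.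
    by rewrite addnC leq_add2l; apply: leq_trans (Cr q (mem_head _ _)); apply: mxrankM_maxr.
  rewrite /= -sub_kermx capmxSr /=; apply: sub_all UC => q' /eqP UC'.
  by rewrite -sub_kermx; apply: submx_trans (capmxSl _ _) _; rewrite sub_kermx UC'.
have U0 : U != 0.
  by apply: contraTneq lt => U0; rewrite -leqNgt; move: rU; rewrite U0 mxrank0.
have [i Ui] : exists i, row i U != 0.
  apply/existsP; apply: contraNT U0 => /existsPn Ui.
  by apply/eqP/row_matrixP => i; rewrite row0; apply/eqP; move: (Ui i); rewrite negbK.
exists (row i U) => //; apply: sub_all UC => q /eqP UC.
by rewrite -row_mul UC row0.
Qed.

Section Infinite.
Variables (K : closedFieldType) (n : nat) (RA RB : rel 'I_n).
Hypotheses (fA : chain_union RA) (fB : chain_union RB).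
Implicit Types (I J : {set 'I_n}) (a b f g h u v x : 'M[K]_n).

Let Ar : reflexive RA. Proof. by case: fA. Qed.
Let At : transitive RA. Proof. by case: fA. Qed.
Let Br : reflexive RB. Proof. by case: fB. Qed.
Let Bt : transitive RB. Proof. by case: fB. Qed.

Lemma exists_cobj I J : #|I| = #|J| -> exists g : 'M[K]_n, cobj I J g.
Proof.
have [m] := ubnP #|I|; elim: m I J => // m IH I J; rewrite ltnS => Im IJ.
have [I0|[i iI]] := set_0Vmem I.
  have J0 : J = set0 by apply: cards0_eq; rewrite -IJ I0 cards0.
  by exists 0, 0; rewrite I0 J0; split; rewrite ?idm0 ?mulmx0 //; split; rewrite ?mulmx0 ?mul0mx.
have [j jJ] : exists j, j \in J.
  by apply/set0Pn; rewrite -card_gt0 -IJ card_gt0; apply/set0Pn; exists i.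
have [||g og] := IH (I :\ i) (J :\ j).
- by apply: leq_trans Im; rewrite [X in (_ < X)%N](cardsD1 i) iI.
- by move: IJ; rewrite (cardsD1 i) (cardsD1 j J) iI jJ => -[].
exists (g + delta_mx i j); rewrite -(setD1K iI) -(setD1K jJ).
by apply: cobjU1 => //; rewrite !inE eqxx.
Qed.

Lemma infinite_field D : exists z : 'I_D -> K, injective z.
Proof.
elim: D => [|D [z zi]]; first by exists (fun=> 0) => -[].
have /closed_nonrootP[t] : \prod_i ('X - (z i)%:P) != 0.
  by apply/prodf_neq0 => i _; rewrite polyXsubC_eq0.
rewrite /root horner_prod => /prodf_neq0 tz.
exists (fun i => if unlift ord0 i is Some j then z j else t) => i j.
case: (unliftP ord0 i) => [i' ->|->]; case: (unliftP ord0 j) => [j' ->|->] //.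
- by move/zi->.
- by move=> E; move: (tz i' isT); rewrite !hornerE E subrr eqxx.
- by move=> E; move: (tz j' isT); rewrite !hornerE E subrr eqxx.
Qed.

(* Replacing [(a, b)] by [(c a, c^-1 b)] normalizes a nonzero entry [p0] of [a]
   to [1], which saves one variable. *)
Definition chart_var I J p0 : finType :=
  ((({: {p : 'I_n * 'I_n | (p \in rel_pos RA I) && (p != p0)}} : finType) +
   ({: {p : 'I_n * 'I_n | p \in rel_pos RB J}} : finType))%type : finType).

Lemma card_chart_var I J p0 : p0 \in rel_pos RA I ->
  #|chart_var I J p0| = (#|rel_pos RA I|.-1 + #|rel_pos RB J|)%N.
Proof.
move=> p0A; rewrite card_sum !card_sig; congr (_ + _)%N.
rewrite (cardsD1 p0 (rel_pos RA I)) p0A /=.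
by apply: eq_card => p; rewrite !inE andbC.
Qed.

Definition chart_a I J p0 (y : chart_var I J p0 -> K) : 'M[K]_n :=
  \matrix_(i, j) if (i, j) == p0 then 1 else
    if insub (i, j) is Some v then y (inl v) else 0.

Definition chart_b I J p0 (y : chart_var I J p0 -> K) : 'M[K]_n :=
  \matrix_(i, j) if insub (i, j) is Some v then y (inr v) else 0.

Lemma chart_surj I J p0 a b : corner I I a -> incid RA a -> corner J J b ->
  incid RB b -> a p0.1 p0.2 = 1 ->
  exists y, chart_a (I := I) (J := J) (p0 := p0) y = a /\ chart_b y = b.
Proof.
move=> /corner0P aI aA /corner0P bJ bB a1.
exists (fun s => match s with inl p => a (val p).1 (val p).2
                 | inr p => b (val p).1 (val p).2 end).
split; apply/matrixP => i j; rewrite mxE.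
  case: eqP => [E|/eqP np0]; first by rewrite -a1 -E.
  case: insubP => [v _ ->//|].
  rewrite np0 andbT inE /= andbA negb_and => /orP[/aI//|/aA//].
case: insubP => [v _ ->//|].
by rewrite inE /= andbA negb_and => /orP[/bJ//|/bB//].
Qed.

Lemma chart_polyfun I J p0 G i j :
  polyfun 2 (fun y : chart_var I J p0 -> K => (chart_a y *m G *m chart_b y) i j).
Proof.
have pa k l : polyfun 1 (fun y : chart_var I J p0 -> K => chart_a y k l).
  have [E|E] := eqVneq (k, l) p0.
    by apply: polyfun_ext (polyfun_const _ _ 1) => y; rewrite mxE E eqxx.
  case v: (insub (k, l) : option {p | (p \in rel_pos RA I) && (p != p0)}) => [w|].
    apply: (@polyfun_ext _ _ _ (fun y => y (inl w))); last exact: polyfun_var.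
    by move=> y; rewrite mxE (negPf E) v.
  by apply: polyfun_ext (polyfun_const _ _ 0) => y; rewrite mxE (negPf E) v.
have pb k l : polyfun 1 (fun y : chart_var I J p0 -> K => chart_b y k l).
  case v: (insub (k, l) : option {p | p \in rel_pos RB J}) => [w|].
    apply: (@polyfun_ext _ _ _ (fun y => y (inr w))); last exact: polyfun_var.
    by move=> y; rewrite mxE v.
  by apply: polyfun_ext (polyfun_const _ _ 0) => y; rewrite mxE v.
apply: (@polyfun_ext _ _ _ (fun y => \sum_l \sum_k G k l * (chart_a y i k * chart_b y l j))).
  move=> y; rewrite mxE; apply: eq_bigr => l _; rewrite [(_ *m G) i l]mxE big_distrl.
  by apply: eq_bigr => k _; rewrite /= mulrA [G k l * _]mulrC.
apply: polyfun_sum => l; apply: polyfun_sum => k; apply: polyfunZ.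
exact: (polyfunM (pa i k) (pb l j)).
Qed.

(* The [D ^ M] Lagrange functions of a grid of invertible matrices are linearly
   independent, but their restrictions to finitely many charts span a space of
   dimension [O(D ^ (M - 1))]. *)
Lemma not_finite_type I J : I != set0 -> #|I| = #|J| -> ~~ tits_pos RA RB I J ->
  ~ finite_type K RA RB I J.
Proof.
move=> I0 IJ ntp [s sP].
have [g0 [h0 g0h0]] := exists_cobj IJ.
have [g0c h0c gh hg] := g0h0.
pose M := #|setX I J|; pose dA := #|rel_pos RA I|; pose dB := #|rel_pos RB J|.
have ME : M = (#|I| * #|J|)%N by rewrite /M cardsX.
have Mgt0 : (0 < M)%N by rewrite ME muln_gt0 -IJ andbb card_gt0.
have dle : (dA + dB <= M)%N by rewrite leqNgt ME.
(* A chart is a representative together with a normalized position, so [k] is their number. [D] is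
   large enough for [k * (3 * M * D) ^ M.-1 < D ^ M]. *)
pose k := (size s * dA)%N; pose D := (k * (3 * M) ^ M).+1.
have [z zi] := infinite_field D.
pose Pos : finType := {p : 'I_n * 'I_n | p \in setX I J}.
have PosE : #|Pos| = M by rewrite card_sig.
pose T : finType := {ffun Pos -> 'I_D}.
have TE : #|T| = (D ^ M)%N by rewrite card_ffun card_ord PosE.
pose mt (t : T) : 'M[K]_n := \matrix_(i, j) if insub (i, j) is Some p then z (t p) else 0.
have mtc t : corner I J (mt t).
  apply/corner0P => i j nij; rewrite mxE; case: insubP => // p.
  by rewrite inE (negPf nij).
(* Shifting the grid by a multiple of the invertible [g0] makes all its points invertible: only the
   eigenvalues of finitely many matrices must be avoided. *)
have [c cP] : exists c, forall t, ~~ root (char_poly (- (mt t *m h0))) c.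
  have /closed_nonrootP[c] : \prod_t char_poly (- (mt t *m h0)) != 0.
    by apply/prodf_neq0 => t _; apply: monic_neq0; apply: char_poly_monic.
  rewrite /root horner_prod => /prodf_neq0 H; exists c => t; exact: H.
pose Pt t := c *: g0 + mt t.
have Ptc t : corner I J (Pt t) by apply: cornerD => //; apply: cornerZ.
have oPt t : cobj I J (Pt t).
  pose q := Pt t *m h0.
  have qc : corner I I q by apply: cornerM (Ptc t) h0c.
  have [|w qw _] := cinj_cinv qc.
    move=> x xI qx; have := cP t; rewrite -eigenvalue_root_char /eigenvalue negbK.
    rewrite /eigenspace kermx_eq0 row_free_unit => u.
    rewrite -[x](mulKmx u) mulmxBl mul_scalar_mx.
    have -> : - (mt t *m h0) *m x - c *: x = - (q *m x).
      by rewrite /q mulmxDl -scalemxAl gh mulmxDl -scalemxAl xI opprD addrC mulNmx.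
    by rewrite qx oppr0 mulmx0.
  have <- : q *m g0 = Pt t by rewrite -mulmxA hg (Ptc t).2.
  by exists (h0 *m w); apply: cinvM qw g0h0.
pose Q := ('M[K]_n * ('I_n * 'I_n))%type.
(* The Lagrange functions: at each position, the factors vanish at the grid values different from
   that of [t]. *)
pose wt (t : T) (x : 'M[K]_n) := \prod_(p : Pos) \prod_(l <- rem (t p) (enum 'I_D))
  (x (val p).1 (val p).2 + - (c * g0 (val p).1 (val p).2 + z l)).
have wtP t t' : (wt t (Pt t') != 0) = (t == t').
  have E (p : Pos) : Pt t' (val p).1 (val p).2 = c * g0 (val p).1 (val p).2 + z (t' p).
    rewrite !mxE -surjective_pairing; congr (_ + _).
    by case: insubP => [p' _ /val_inj ->//|]; rewrite (valP p).
  apply/prodf_neq0/eqP => [H|-> p _].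
    apply/ffunP => p; have := H p isT; rewrite prodf_seq_neq0 => /allP/(_ (t' p)).
    rewrite E subrr eqxx => {}H; apply/eqP; rewrite eq_sym; apply: contraT => tp.
    suff : false by [].
    by apply: H; rewrite (mem_rem_uniq _ (enum_uniq _)) !inE tp mem_enum.
  rewrite prodf_seq_neq0; apply/allP => l; rewrite (mem_rem_uniq _ (enum_uniq _)) !inE.
  case/andP=> ll _; apply/implyP => _; rewrite E opprD addrACA subrr add0r subr_eq0.
  by rewrite (inj_eq zi) eq_sym.
pose d := (M * (D * 2))%N.
pose F (q : Q) (t : T) (y : chart_var I J q.2 -> K) := wt t (chart_a y *m q.1 *m chart_b y).
have FP q t : polyfun d (F q t).
  have H (p : Pos) : polyfun (D * 2) (fun y : chart_var I J q.2 -> K =>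
     \prod_(l <- rem (t p) (enum 'I_D)) ((chart_a y *m q.1 *m chart_b y) (val p).1 (val p).2
        + - (c * g0 (val p).1 (val p).2 + z l))).
    have := polyfun_prod (rem (t p) (enum 'I_D)) (fun l : 'I_D =>
      polyfunD (@chart_polyfun I J q.2 q.1 (val p).1 (val p).2)
        (polyfun_const (chart_var I J q.2) 2 (- (c * g0 (val p).1 (val p).2 + z l)))).
    apply: polyfun_le; rewrite leq_mul2r /=.
    by rewrite size_rem ?mem_enum // -cardE card_ord leq_pred.
  have := polyfun_prod (index_enum Pos) H.
  apply: polyfun_le; rewrite leq_mul2r -PosE /index_enum -enumT -cardE leqnn orbT.
  by [].
pose HC q := cid2 (polyfun_matrix (FP q)).
pose C q := s2val (HC q).
pose rho := (d.+1 ^ (dA.-1 + dB))%N.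
pose qs : seq Q := [seq (G, p) | G <- s, p <- enum (rel_pos RA I)].
have qsA (q : Q) : q \in qs -> q.2 \in rel_pos RA I.
  by move=> /allpairsP[x [_ pA ->]]; rewrite mem_enum in pA.
have Cr : {in qs, forall q, \rank (C q) <= rho}%N.
  by move=> q /qsA qA; rewrite /rho -(card_chart_var J qA); apply: (s2valP (HC q)).
have qsz : size qs = k by rewrite size_allpairs -cardE.
have lt : (size qs * rho < #|T|)%N.
  rewrite qsz TE /rho.
  have dD : (d.+1 <= 3 * M * D)%N by rewrite /d /D; nia.
  have [k0|k0] := posnP k; first by rewrite k0 mul0n expn_gt0.
  have dA0 : (0 < dA)%N by move: k0; rewrite /k muln_gt0 => /andP[].
  (* Here the failure of positivity enters: with one entry normalized, at most [M - 1] variables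
     remain. *)
  have Ngt : (dA.-1 + dB <= M.-1)%N by lia.
  apply: (@leq_ltn_trans (k * (3 * M * D) ^ M.-1)%N).
    rewrite leq_mul2l; apply/orP; right.
    apply: leq_trans (_ : (3 * M * D) ^ (dA.-1 + dB) <= _)%N.
      by have [->|e0] := posnP (dA.-1 + dB); rewrite ?expn0 // leq_exp2r.
    by rewrite leq_pexp2l // !muln_gt0 /= Mgt0.
  rewrite expnMn mulnA -[in X in (_ < X)%N](prednK Mgt0) expnS ltn_pmul2r ?expn_gt0 //.
  rewrite /D ltnS leq_mul2l; apply/orP; right.
  by apply: leq_pexp2l; [rewrite muln_gt0 Mgt0|exact: leq_pred].
have [b b0 /allP bC] := common_kernel Cr lt.
case/eqP: b0; apply/rowP => i; rewrite -[i]enum_valK; set t := enum_val i.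
have [G Gs [u [u' [v [v' [uA vB E]]]]]] := sP _ (oPt t).
have [[uI u'I uu' u'u] uR u'R] := uA; have [[vI v'I vv' v'v] vR v'R] := vB.
have [p0 u'p0] : exists p0 : 'I_n * 'I_n, u' p0.1 p0.2 != 0.
  apply: contrapT => /forallNP u'0; case/eqP: I0; apply/eqP; rewrite -(idm_neq0 K) -uu'.
  suff -> : u' = 0 by rewrite mulmx0.
  by apply/matrixP => k1 l1; rewrite mxE; apply/eqP; have /negP := u'0 (k1, l1); rewrite negbK.
have p0A : p0 \in rel_pos RA I.
  rewrite inE; apply: contraT => np0; case/negP: u'p0; apply/eqP.
  move: np0; rewrite andbA negb_and => /orP[np0|/u'R//].
  by move/corner0P: u'I; apply.
have [y [ya yb]] : exists y, chart_a (I := I) (J := J) (p0 := p0) y = (u' p0.1 p0.2)^-1 *: u' /\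
    chart_b y = u' p0.1 p0.2 *: v'.
  apply: chart_surj.
  - exact: cornerZ.
  - exact: incidZ.
  - exact: cornerZ.
  - exact: incidZ.
  - by rewrite mxE mulVf.
have PG : Pt t = chart_a y *m G *m chart_b y.
  rewrite ya yb -scalemxAl -scalemxAl -scalemxAr scalerA mulVf // scale1r -E.
  by rewrite !mulmxA u'u (Ptc t).1 -mulmxA vv' (Ptc t).2.
have qin : (G, p0) \in qs by apply/allpairsP; exists (G, p0); rewrite mem_enum.
(* The grid point of [t] lies in the chart [(G, p0)]; evaluated there, the linear relation retains
   only its term for [t]. *)
have := s2valP' (HC (G, p0)) b (eqP (bC _ qin)) y.
rewrite (bigD1 t) //= big1 => [|t' tt']; last first.
  rewrite /F /= -PG; apply/eqP; rewrite mulf_eq0 orbC; apply/orP; left.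
  by rewrite -[_ == 0]negbK wtP.
rewrite addr0 /F /= -PG => /eqP; rewrite mulf_eq0 -[wt _ _ == 0]negbK wtP eqxx orbF.
by move/eqP => ->; rewrite mxE.
Qed.
End Infinite.

(** * Counting labels *)

Theorem finite_type_tits_form (K : closedFieldType) n (RA RB : rel 'I_n) :
  chain_union RA -> chain_union RB ->
  finite_type K RA RB [set: 'I_n] [set: 'I_n] <->
  forall I J : {set 'I_n}, I != set0 -> #|I| = #|J| -> tits_pos RA RB I J.
Proof.
move=> fA fB; split=> [ft I J I0 IJ|tp].
  apply: contraT => ntp; case: (not_finite_type (K := K) I0 IJ ntp).
  exact: finite_type_sub.
by apply: finite_type_tits => // I J _ _; apply: tp.
Qed.

Lemma exists_subset_card (T : finType) (A : {set T}) k : (k <= #|A|)%N ->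
  exists2 B : {set T}, B \subset A & #|B| = k.
Proof.
elim: k => [|k IH] kA; first by exists set0; rewrite ?sub0set ?cards0.
have [B sB cB] := IH (ltnW kA).
have /subsetPn[x xA xB] : ~~ (A \subset B).
  by apply: contraTN kA => /subset_leq_card; rewrite cB -leqNgt.
by exists (x |: B); rewrite ?cardsU1 ?xB ?cB // subUset sub1set xA.
Qed.

Definition sumsq (x : seq nat) := sumn [seq (k * k)%N | k <- x].

Section Labels.
Local Open Scope nat_scope.
Variables (n m : nat) (comp : 'I_n -> 'I_m) (lev : 'I_n -> nat) (r : 'I_m -> nat).
Hypothesis lev_lt : forall x, lev x < r (comp x).

(** [comp] names the factor of the Levi subgroup and [lev] the step of its flag. For the group [P]
    there is a single component. *)
Definition label_rel : rel 'I_n := fun x y => (comp x == comp y) && (lev x <= lev y).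

Lemma label_rel_chain : chain_union label_rel.
Proof.
split=> [x|y x z|y x z].
- by rewrite /label_rel eqxx leqnn.
- by move=> /andP[/eqP xy lxy] /andP[/eqP yz lyz]; rewrite /label_rel xy yz eqxx (leq_trans lxy).
have E u v : comparable_rel label_rel u v = (comp u == comp v).
  by rewrite /comparable_rel /label_rel [comp v == _]eq_sym -andb_orr leq_total andbT.
by rewrite !E => /eqP-> /eqP->.
Qed.

Definition label_class c j : {set 'I_n} := [set x | (comp x == c) && (lev x == j)].
Definition label_counts (I : {set 'I_n}) c : seq nat :=
  [seq #|I :&: label_class c j| | j <- iota 0 (r c)].

Lemma sum_labels (I : {set 'I_n}) (F : 'I_m -> nat -> nat) :
  \sum_(x in I) F (comp x) (lev x) =
  \sum_c \sum_(j < r c) #|I :&: label_class c j| * F c j.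
Proof.
transitivity (\sum_(x in I) \sum_c \sum_(j < r c) (x \in label_class c j) * F c j).
  apply: eq_bigr => x _; rewrite (bigD1 (comp x)) //= [X in _ + X]big1 ?addn0; last first.
    move=> c cx; rewrite big1 // => j _.
    by rewrite inE eq_sym (negPf cx).
  rewrite (bigD1 (Ordinal (lev_lt x))) //= big1 ?addn0; last first.
    by move=> j; rewrite -val_eqE inE eq_sym /= => /negPf->; rewrite andbF.
  by rewrite inE !eqxx mul1n.
rewrite exchange_big; apply: eq_bigr => c _; rewrite exchange_big; apply: eq_bigr => j _.
rewrite -big_distrl /=; congr (_ * _); rewrite -sum1_card big_mkcond [RHS]big_mkcond.
by apply: eq_bigr => x _; rewrite !inE; case: (x \in I).
Qed.

Lemma sumn_label_counts (I : {set 'I_n}) c :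
  sumn (label_counts I c) = \sum_(j < r c) #|I :&: label_class c j|.
Proof. by rewrite sumnE big_map -[r c]subn0 big_mkord subn0. Qed.

Lemma sumsq_label_counts (I : {set 'I_n}) c :
  sumsq (label_counts I c) =
  \sum_(j < r c) #|I :&: label_class c j| * #|I :&: label_class c j|.
Proof. by rewrite /sumsq sumnE !big_map -[r c]subn0 big_mkord subn0. Qed.

Lemma card_labels (I : {set 'I_n}) : #|I| = \sum_c sumn (label_counts I c).
Proof.
rewrite -sum1_card (sum_labels I (fun _ _ => 1)); apply: eq_bigr => c _.
by rewrite sumn_label_counts; apply: eq_bigr => j _; rewrite muln1.
Qed.

(** Two different levels of a component are ordered in exactly one direction, equal levels in both.
    So counting pairs in both directions gives the square of the total plus the squares of the
    parts. *)
Lemma card_rel_pos (I : {set 'I_n}) : 2 * #|rel_pos label_rel I| =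
  \sum_c (sumn (label_counts I c) * sumn (label_counts I c) + sumsq (label_counts I c)).
Proof.
have -> : #|rel_pos label_rel I| = \sum_(x in I) \sum_(y in I) label_rel x y.
  rewrite -sum1_card pair_big_dep /= big_mkcond [RHS]big_mkcond.
  by apply: eq_bigr => -[x y] _; rewrite inE /=; case: (x \in I) (y \in I) => [] [].
pose k c j := #|I :&: label_class c j|.
transitivity (2 * \sum_c \sum_(j < r c) k c j * \sum_(j' < r c) k c j' * (j <= j')).
  congr (2 * _).
  rewrite -(sum_labels I (fun c j => \sum_(j' < r c) k c j' * (j <= j'))).
  apply: eq_bigr => x _.
  rewrite (sum_labels I (fun c j => (comp x == c) && (lev x <= j))).
  rewrite (bigD1 (comp x)) //= [X in _ + X]big1 ?addn0; last first.
    move=> c cx; rewrite big1 // => j _.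
    by rewrite eq_sym (negPf cx) muln0.
  by apply: eq_bigr => j _; rewrite eqxx.
rewrite big_distrr; apply: eq_bigr => c _ /=.
rewrite sumn_label_counts sumsq_label_counts -!/(k c _).
have -> : \sum_(j < r c) k c j * \sum_(j' < r c) k c j' * (j <= j') =
    \sum_(j < r c) \sum_(j' < r c) k c j * k c j' * (j <= j').
  by apply: eq_bigr => j _; rewrite big_distrr; apply: eq_bigr => j' _; rewrite /= mulnA.
rewrite mul2n -addnn {2}exchange_big -big_split /=.
rewrite big_distrl -big_split /=; apply: eq_bigr => j _.
rewrite -big_split big_distrr /= (bigD1 j) //= [X in _ = X + _](bigD1 j) //=.
rewrite leqnn !muln1 -addnA -addnA; congr (_ + _); rewrite addnC; congr (_ + _).
apply: eq_bigr => j' jj'; rewrite [k c j' * _]mulnC -mulnDr.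
have -> : (j <= j') + (j' <= j) = 1; last by rewrite muln1.
by move: jj'; rewrite -val_eqE /=; case: ltngtP.
Qed.

Lemma exists_counts (t : 'I_m -> seq nat) :
  (forall c, size (t c) = r c) ->
  (forall c j, j < r c -> nth 0 (t c) j <= #|label_class c j|) ->
  exists I : {set 'I_n}, forall c, label_counts I c = t c.
Proof.
move=> st tle.
have H (q : 'I_m * nat) : exists B : {set 'I_n}, q.2 < r q.1 ->
    B \subset label_class q.1 q.2 /\ #|B| = nth 0 (t q.1) q.2.
  case: (ltnP q.2 (r q.1)) => [/tle/exists_subset_card[B sB cB]|_]; first by exists B.
  by exists set0.
have [B BP] := choice H.
exists [set x | x \in B (comp x, lev x)] => c.
apply: (@eq_from_nth _ 0); rewrite size_map size_iota ?st // => j jr.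
rewrite (nth_map 0) ?size_iota // nth_iota // add0n.
have [sB <-] := BP (c, j) jr; apply: eq_card => x; rewrite !inE.
apply/idP/idP => [/and3P[xB /eqP<- /eqP<-]//|xB].
by have := subsetP sB x xB; rewrite inE => /andP[/eqP xc /eqP xj]; rewrite xc xj xB !eqxx.
Qed.

End Labels.

(** * The Tits form *)

Section SumSquares.
Local Open Scope nat_scope.
Implicit Types (x q d : seq nat).

Lemma double_mul_le u v : 2 * (u * v) <= u * u + v * v.
Proof. by have [l _] := nat_Cauchy u v; rewrite -!mulnn in l. Qed.

Lemma sumn_le_sumsq x : sumn x <= sumsq x.
Proof. by rewrite /sumsq; elim: x => //= k x IH; nia. Qed.

(** Cauchy-Schwarz against the vector of ones. *)
Lemma sqr_sumn_le x : sumn x * sumn x <= size x * sumsq x.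
Proof.
rewrite /sumsq; elim: x => //= k x; move: (sumn [seq l * l | l <- x]) (sumn x) (size x) => t s r.
case: r => [|r] IH; first by nia.
have h := double_mul_le s (r.+1 * k).
have : r.+1 * (2 * (k * s)) <= r.+1 * (r.+1 * (k * k) + t) by nia.
by rewrite leq_pmul2l //; nia.
Qed.

Lemma sqr_sumn_leW r x : size x <= r -> sumn x * sumn x <= r * sumsq x.
Proof. by move=> xr; apply: leq_trans (sqr_sumn_le x) _; rewrite leq_mul2r xr orbT. Qed.

(** Cauchy-Schwarz is applied to the other entries only. This sharpens the bound when the isolated
    entry belongs to a small block. *)
Lemma sumsq_split j x : j < size x -> exists s t,
  [/\ sumn x = nth 0 x j + s, sumsq x = nth 0 x j * nth 0 x j + t &
      s * s <= (size x).-1 * t].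
Proof.
move=> jx; exists (sumn (take j x ++ drop j.+1 x)), (sumsq (take j x ++ drop j.+1 x)).
split.
- by rewrite -{1}(cat_take_drop j x) (drop_nth 0 jx) !sumn_cat /= addnCA.
- rewrite /sumsq -{1}(cat_take_drop j x) (drop_nth 0 jx) !map_cat !sumn_cat /=.
  by rewrite addnCA.
- apply: leq_trans (sqr_sumn_le _) _; rewrite leq_mul2r; apply/orP; right.
  by rewrite size_cat size_take size_drop jx; lia.
Qed.

Definition sub_dims x q := size x = size q /\ forall j, nth 0 x j <= nth 0 q j.

Lemma sub_dims_split v x q : sub_dims x q -> v \in q -> exists e s t,
  [/\ e <= v, sumn x = e + s, sumsq x = e * e + t & s * s <= (size q).-1 * t].
Proof.
move=> [sx xq] vq; have vs : index v q < size q by rewrite index_mem.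
have [|s [t [e1 e2 e3]]] := @sumsq_split (index v q) x; first by rewrite sx.
exists (nth 0 x (index v q)), s, t; split=> //; last by rewrite -sx.
by rewrite -[leqRHS](nth_index 0 vq).
Qed.

Lemma sub_dims_sumn x q : sub_dims x q -> sumn x <= sumn q.
Proof.
move=> [sx xq]; elim: x q sx xq => [|k x IH] [|l q] //= [sx] xq.
by apply: leq_add; [apply: (xq 0)|apply: IH => // j; apply: (xq j.+1)].
Qed.

(** List (B) in terms of block sizes: [size q == 1] stands for the whole group, and two blocks
    containing a 1 for a mirabolic one. *)
Definition caseB_blocks d q1 q2 : bool :=
  [|| size d == 2,
      [&& size d == 3, size q1 == 2 & size q2 <= 4],
      (size d == 3) && ((size q1 == 1) || ((size q1 == 2) && (1 \in q1))),
      [&& size d == 3, 2 \in d & (size q1 == 1) || (size q1 == 2)],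
      (size d == 3) && (1 \in d),
      [&& size d == 4, sumn q1 == 2 & size q1 == 1],
      [&& size d == 4, size q1 == 1 & size q2 <= 4],
      [&& size d == 4, 1 \in d & size q1 == 1],
      [&& (size d == 5) || (size d == 6), size q1 == 1 & size q2 == 2],
      (sumn q1 == 1) && (size q1 == 1),
      [&& sumn q1 == 2, size q1 == 1 & size q2 == 2] |
      (size q1 == 1) && ((size q2 == 1) || ((size q2 == 2) && (1 \in q2)))].

Lemma mirabolic_bound x q : sub_dims x q -> (size q == 1) || ((size q == 2) && (1 \in q)) ->
  exists e, [/\ e <= 1, e <= sumn x & e * e + (sumn x - e) * (sumn x - e) <= sumsq x].
Proof.
move=> xq /orP[/eqP q1|/andP[/eqP q2 q1]].
  by exists 0; rewrite subn0; split=> //; have := @sqr_sumn_leW 1 x; rewrite xq.1 q1 mul1n; apply.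
have [e [s [t [e1 -> -> st]]]] := sub_dims_split xq q1.
exists e; split=> //; first exact: leq_addr.
by rewrite addKn leq_add2l; apply: leq_trans st _; rewrite q2 mul1n.
Qed.

(** With [a] and [b] the totals of [x1] and [x2], the claim is that [2 a b] is less than the three
    sums of squares. These are bounded by Cauchy-Schwarz through the number of blocks, by the plain
    totals, or with the entry of a small block isolated. *)
Lemma caseB_tits d d0 x1 q1 x2 q2 : caseB_blocks d0 q1 q2 ->
  sub_dims d d0 -> sub_dims x1 q1 -> sub_dims x2 q2 ->
  sumn d = sumn x1 + sumn x2 -> 0 < sumn d ->
  sumn d * sumn d < (sumn x1 * sumn x1 + sumsq x1) + (sumn x2 * sumn x2 + sumsq x2) + sumsq d.
Proof.
move=> cB sd s1 s2 E N0.
have T1 := sumn_le_sumsq x1; have T2 := sumn_le_sumsq x2; have Td := sumn_le_sumsq d.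
have C1 r : size q1 <= r -> sumn x1 * sumn x1 <= r * sumsq x1.
  by move=> h; apply: sqr_sumn_leW; rewrite s1.1.
have C2 r : size q2 <= r -> sumn x2 * sumn x2 <= r * sumsq x2.
  by move=> h; apply: sqr_sumn_leW; rewrite s2.1.
have Cd r : size d0 <= r -> sumn d * sumn d <= r * sumsq d.
  by move=> h; apply: sqr_sumn_leW; rewrite sd.1.
have P1 := sub_dims_sumn s1; have P2 := sub_dims_sumn s2.
have Spd v := sub_dims_split (v := v) sd.
have M1 := mirabolic_bound s1; have M2 := mirabolic_bound s2.
move: (sumn x1) (sumsq x1) (sumn x2) (sumsq x2) (sumn d) (sumsq d) E N0 T1 T2 Td C1 C2 Cd P1 P2 Spd M1 M2.
move=> a t1 b t2 N td E N0 T1 T2 Td C1 C2 Cd P1 P2 Spd M1 M2; subst N.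
have sq := double_mul_le.
case/or4P: cB => [/eqP k|/and3P[/eqP k /eqP r1 r2]|/andP[/eqP k r1]|].
- have := Cd 2; rewrite k => /(_ isT); have := sq a b; nia.
(* The bounds add up to [5/6 a^2 + 2/3 a b + 7/12 b^2], and the pair [5 a], [4 b] completes the
   square in [a]. The pairs for (B7) and (B9) arise in the same way. *)
- have := Cd 3; rewrite k => /(_ isT); have := C1 2; rewrite r1 => /(_ isT).
  have := C2 4 r2; have := sq (5 * a) (4 * b); nia.
(* The quadratic part is only a multiple of [(2 a - b)^2], so the linear bound [b] on the sum of
   squares [t2] has to supply strictness. The same square occurs in (B8). *)
- have := Cd 3; rewrite k => /(_ isT); have [e [e1 ea eT]] := M1 r1.
  have := sq (2 * a) b.
  case: e e1 ea eT => [|[|//]] _ ea eT; nia.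
case/or4P => [/and3P[/eqP k dt r1]|/andP[/eqP k dt]|/and3P[/eqP k /eqP p1 /eqP r1]|].
- have {}r1 : size q1 <= 2 by case/orP: r1 => /eqP->.
  have [f [s [t [f2 EN ET]]]] := Spd 2 dt; rewrite k /= => st.
  (* If the small block contributes 2, the gap is at least [((b - a - 1)^2 + (a - 3)^2) / 2 + 1]; if
     it contributes 1, at least [((b - a)^2 + (a - 1)^2) / 2 + 1]. *)
  have := C1 2 r1; have := sq a b; have := sq b a.+1; have := sq a 1; have := sq a 3.
  case: f f2 EN ET => [|[|[|//]]] _ EN ET.
  + rewrite add0n in EN; rewrite -EN in st; nia.
  + have : s * s + 2 * (a + b) = (a + b) * (a + b) + 1 by nia.
    nia.
  + have : s * s + 4 * (a + b) = (a + b) * (a + b) + 4 by nia.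
    nia.
- have [f [s [t [f2 EN ET]]]] := Spd 1 dt; rewrite k /= => st.
  have := sq a b; case: f f2 EN ET => [|[|//]] _ EN ET; first by rewrite add0n in EN; rewrite -EN in st; nia.
  have : s * s + 2 * (a + b) = (a + b) * (a + b) + 1 by nia.
  nia.
- have := Cd 4; rewrite k => /(_ isT); have := C1 1; rewrite r1 => /(_ isT).
  have {}P1 : a <= 2 by rewrite -p1.
  (* For [a] equal to 2 or 1 the gap is at least [(b - 4)^2 / 4 + 1] or [(b - 1)^2 / 4 + 1]. *)
  have := sq b 4; have := sq b 1.
  move: P1 N0; rewrite leq_eqVlt => /orP[/eqP->|]; first by nia.
  rewrite ltnS leq_eqVlt => /orP[/eqP->|]; first by nia.
  by rewrite ltnS leqn0 => /eqP->; nia.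
case/or4P => [/and3P[/eqP k /eqP r1 r2]|/and3P[/eqP k dt /eqP r1]|/and3P[k /eqP r1 /eqP r2]|].
- have := Cd 4; rewrite k => /(_ isT); have := C1 1; rewrite r1 => /(_ isT).
  have := C2 4 r2; have := sq (5 * a) (3 * b); nia.
- have [f [s [t [f2 EN ET]]]] := Spd 1 dt; rewrite k /= => st.
  have := C1 1; rewrite r1 => /(_ isT) ha.
  have := sq (2 * a) b.
  case: f f2 EN ET => [|[|//]] _ EN ET; first by rewrite add0n in EN; rewrite -EN in st; nia.
  have : s * s + 2 * (a + b) = (a + b) * (a + b) + 1 by nia.
  have : 4 * (a * b) + 2 * a <= 4 * (a * a) + b * b + b.
    have [ab|ab] := leqP (2 * a) b; nia.
  nia.
- have := Cd 6; have -> : size d0 <= 6 by case/orP: k => /eqP->.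
  move=> /(_ isT); have := C1 1; rewrite r1 => /(_ isT).
  have := C2 2; rewrite r2 => /(_ isT).
  have := sq (7 * a) (5 * b); nia.
case/or3P => [/andP[/eqP p1 /eqP r1]|/and3P[/eqP p1 /eqP r1 /eqP r2]|/andP[/eqP r1 r2]].
- have {}P1 : a <= 1 by rewrite -p1.
  case: a P1 {C1 M1 Spd Cd} N0 T1 Td => [|[|//]] _; nia.
- have := C1 1; rewrite r1 => /(_ isT); have := C2 2; rewrite r2 => /(_ isT).
  have {}P1 : a <= 2 by rewrite -p1.
  have := sq b 3; have := sq b 1.
  move: P1 N0 Td; rewrite leq_eqVlt => /orP[/eqP->|]; first by nia.
  rewrite ltnS leq_eqVlt => /orP[/eqP->|]; first by nia.
  by rewrite ltnS leqn0 => /eqP->; nia.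
- have := C1 1; rewrite r1 => /(_ isT); have [e [e1 eb eT]] := M2 r2.
  have := sq a b.
  case: e e1 eb eT => [|[|//]] _ eb eT; first by rewrite subn0 in eT; nia.
  have [ab|ab] := leqP a b; nia.
Qed.
Definition caseC_blocks (d1 d2 : nat) q1 q2 q3 : bool :=
  [|| minn d1 d2 <= 2,
      (minn d1 d2 == 3) && (size q1 == 1),
      [&& (minn d1 d2 == 4) || (minn d1 d2 == 5), size q1 == 1 & size q2 == 2],
      (sumn q1 == 1) && (size q1 == 1),
      [&& sumn q1 == 2, size q1 == 1 & size q2 == 2],
      (size q1 == 1) && ((size q2 == 1) || ((size q2 == 2) && (1 \in q2))) |
      [&& size q1 == 1, size q2 == 2 & size q3 <= 4]].

Lemma sub_dims2 d (d1 d2 : nat) : sub_dims d [:: d1; d2] -> exists e f,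
  [/\ e <= minn d1 d2, sumn d = e + f & sumsq d = e * e + f * f].
Proof.
case: d => [|e [|f [|? ?]]] [//= _ le].
have := le 0; have := le 1; rewrite /sumsq /= !addn0 => fd ed.
have [d12|d21] := leqP d1 d2; first by exists e, f.
by exists f, e; rewrite ![f + _]addnC ![f * f + _]addnC.
Qed.

(** [P] has two blocks with entries [e] and [f], of which [e] is bounded by the smaller block; the
    square of the total exceeds [e^2 + f^2] by [2 e f], and the three factors must outweigh this. *)
Lemma caseC_tits d (d1 d2 : nat) x1 q1 x2 q2 x3 q3 : caseC_blocks d1 d2 q1 q2 q3 ->
  sub_dims d [:: d1; d2] -> sub_dims x1 q1 -> sub_dims x2 q2 -> sub_dims x3 q3 ->
  sumn d = sumn x1 + sumn x2 + sumn x3 -> 0 < sumn d ->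
  sumn d * sumn d < (sumn x1 * sumn x1 + sumsq x1) + (sumn x2 * sumn x2 + sumsq x2) +
    (sumn x3 * sumn x3 + sumsq x3) + sumsq d.
Proof.
move=> cC /sub_dims2[e [f [emin -> ->]]] s1 s2 s3 E N0.
have T1 := sumn_le_sumsq x1; have T2 := sumn_le_sumsq x2; have T3 := sumn_le_sumsq x3.
have C1 r : size q1 <= r -> sumn x1 * sumn x1 <= r * sumsq x1.
  by move=> h; apply: sqr_sumn_leW; rewrite s1.1.
have C2 r : size q2 <= r -> sumn x2 * sumn x2 <= r * sumsq x2.
  by move=> h; apply: sqr_sumn_leW; rewrite s2.1.
have C3 r : size q3 <= r -> sumn x3 * sumn x3 <= r * sumsq x3.
  by move=> h; apply: sqr_sumn_leW; rewrite s3.1.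
have P1 := sub_dims_sumn s1.
have M2 := mirabolic_bound s2.
move: (sumn x1) (sumsq x1) (sumn x2) (sumsq x2) (sumn x3) (sumsq x3) E N0 T1 T2 T3 C1 C2 C3 P1 M2.
move=> a t1 b t2 c t3 E N0 T1 T2 T3 C1 C2 C3 P1 M2.
suff : 2 * (e * f) < (a * a + t1) + (b * b + t2) + (c * c + t3) by nia.
have F : e * f + e * e = e * (a + b + c) by nia.
(* Integrality: [(s - k) (s - k - 1)] is never negative. This is sharper than a square, and for
   bounded [e] finitely many values of [k] suffice. *)
have U s k : (2 * k + 1) * s <= s * s + k * k + k.
  by have [|] := leqP s k; nia.
have sq := double_mul_le.
case/or4P: cC => [d12|/andP[/eqP d123 /eqP r1]|/and3P[d45 /eqP r1 /eqP r2]|].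
- have {emin d12} : e <= 2 by apply: leq_trans d12.
  have := U a 1; have := U b 1; have := U c 1.
  case: e E F N0 => [|[|[|//]]] E F N0; lia.
- have {emin d123} : e <= 3 by rewrite -d123.
  have := C1 1; rewrite r1 => /(_ isT).
  have := U a 1; have := U b 1; have := U c 1; have := U b 2; have := U c 2.
  case: e E F N0 => [|[|[|[|//]]]] E F N0; lia.
- have {emin d45} : e <= 5 by apply: leq_trans emin _; case/orP: d45 => /eqP->.
  have := C1 1; rewrite r1 => /(_ isT); have := C2 2; rewrite r2 => /(_ isT).
  have := sq (3 * b) (2 * e); have := sq a 1; have := sq a 2.
  have := U a 0; have := U a 1; have := U a 2.
  have := U c 0; have := U c 1; have := U c 2; have := U c 3; have := U c 4.
  case: e E F N0 => [|[|[|[|[|[|//]]]]]] E F N0; lia.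
(* An arbitrary flag in the third factor still contributes [c^2 + c]; the estimate is [U] at
   [k = e - 1], with [e = 0] treated apart. *)
have Uc : 2 * (e * c) + e <= c * c + c + e * e.
  case: e {E emin} F N0 => [|e] *; first by nia.
  have := U c e; nia.
case/or4P => [/andP[/eqP p1 /eqP r1]|/and3P[/eqP p1 /eqP r1 /eqP r2]|/andP[/eqP r1 r2]|/and3P[/eqP r1 /eqP r2 r3]].
- have {}P1 : a <= 1 by rewrite -p1.
  have Ub : 2 * (e * b) + e <= b * b + b + e * e.
    case: e {E emin Uc} F N0 => [|e] *; first by nia.
    have := U b e; nia.
  case: a P1 {C1} E N0 T1 F => [|[|//]] _ E N0 T1 F; nia.
- have := C1 1; rewrite r1 => /(_ isT); have := C2 2; rewrite r2 => /(_ isT).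
  have {}P1 : a <= 2 by rewrite -p1.
  have := sq (3 * b) (2 * e); have := sq (2 * e) 9.
  case: a P1 {C1} E N0 T1 F => [|[|[|//]]] _ E N0 T1 F; nia.
- have := C1 1; rewrite r1 => /(_ isT); have [g [g1 eb eT]] := M2 r2.
  have := sq (2 * a) e; have := sq (2 * b) e; have := sq (2 * b) e.+1.
  case: g g1 eb eT => [|[|//]] _ eb eT.
    by rewrite subn0 in eT; nia.
  have {}eT : b * b + 2 <= t2 + 2 * b by clear -eb eT; nia.
  by clear -Uc F eT T3; lia.
- have := C1 1; rewrite r1 => /(_ isT); have := C2 2; rewrite r2 => /(_ isT).
  have := C3 4 r3.
  have [e0|e0] := posnP e; first by clear -e0 E N0 T1 T2 T3 F; nia.
  have ee : 0 < e * e by rewrite muln_gt0 e0.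
  (* Completing the three squares costs [1/2 + 2/3 + 4/5 = 59/30] times [e^2], just below the
     available [2 e^2]. *)
  have := sq (2 * a) e; have := sq (3 * b) (2 * e); have := sq (5 * c) (4 * e).
  by clear -F ee; lia.
Qed.

(** Each factor contributes at least twice its total, because a natural number is at most its
    square; with [e] at most 1, [2 e f] stays below twice the total. *)
Lemma mirabolic_tits m d (e0 n0 : nat) (x : 'I_m -> seq nat) : minn e0 n0 <= 1 ->
  sub_dims d [:: e0; n0] -> sumn d = \sum_c sumn (x c) -> 0 < sumn d ->
  sumn d * sumn d < \sum_c (sumn (x c) * sumn (x c) + sumsq (x c)) + sumsq d.
Proof.
move=> e0n0 /sub_dims2[e [f [emin -> ->]]] E N0.
have {e0n0 emin} e1 : e <= 1 by apply: leq_trans emin _.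
have : 2 * \sum_c sumn (x c) <= \sum_c (sumn (x c) * sumn (x c) + sumsq (x c)).
  rewrite big_distrr; apply: leq_sum => c _ /=.
  by have := sumn_le_sumsq (x c); nia.
by rewrite -E; case: e e1 E N0 => [|[|//]] _ E N0; nia.
Qed.

End SumSquares.

(** * Null vectors outside the list *)

Section Patterns.
Local Open Scope nat_scope.
Implicit Types (x q d : seq nat).

(** Room for the vector with [v] on the first [k] blocks and zero on the others. *)
Definition fits q k v := (k <= size q) && all (leq v) (take k q).

Lemma fits_sub q k v : fits q k v -> exists x,
  [/\ sub_dims x q, sumn x = k * v & sumsq x = k * (v * v)].
Proof.
move=> /andP[kq vq]; exists (nseq k v ++ nseq (size q - k) 0); split.
- split=> [|j]; first by rewrite size_cat !size_nseq subnKC.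
  rewrite nth_cat size_nseq; case: ltnP => jk; last by rewrite nth_nseq if_same.
  rewrite nth_nseq jk; have jt : j < size (take k q) by rewrite size_takel.
  by have /(all_nthP 0)/(_ j jt) := vq; rewrite nth_take.
- by rewrite sumn_cat !sumn_nseq mul0n addn0 mulnC.
- by rewrite /sumsq map_cat !map_nseq sumn_cat !sumn_nseq mul0n addn0 mulnC.
Qed.

Lemma fits_all q k v : k <= size q -> (forall u, u < v -> u \notin q) -> fits q k v.
Proof.
move=> kq vq; rewrite /fits kq; apply/allP => u /mem_take uq.
by rewrite leqNgt; apply: contraL uq => /vq.
Qed.

Lemma fits_whole q v : size q = 1 -> v <= sumn q -> fits q 1 v.
Proof. by case: q => [|u [|? ?]] //= _; rewrite addn0 /fits /= => ->. Qed.

Definition obstructionB d q1 q2 := exists y x1 x2,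
  [/\ sub_dims y d, sub_dims x1 q1 /\ sub_dims x2 q2,
      sumn y = sumn x1 + sumn x2, 0 < sumn y &
      (sumn x1 * sumn x1 + sumsq x1) + (sumn x2 * sumn x2 + sumsq x2) + sumsq y
        <= sumn y * sumn y].

Lemma obstructionB_sym d q1 q2 : obstructionB d q1 q2 -> obstructionB d q2 q1.
Proof.
move=> [y [x1 [x2 [sy [s1 s2] E N0 le]]]]; exists y, x2, x1; split=> //.
  by rewrite E addnC.
by rewrite [in leqLHS](addnC (_ + sumsq x2)).
Qed.

(* The numbers to which this is applied below are the null vectors of
   [E6~] (4, 1), [E7~] (5, 1), (3, 2) and [E8~] (7, 1), (4, 2), (3, 3). *)
Lemma obstructionB_fits d q1 q2 k v k1 v1 k2 v2 :
  fits d k v -> fits q1 k1 v1 -> fits q2 k2 v2 ->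
  [&& k * v == k1 * v1 + k2 * v2, 0 < k * v &
      (k1 * v1 * (k1 * v1) + k1 * (v1 * v1)) + (k2 * v2 * (k2 * v2) + k2 * (v2 * v2)) +
      k * (v * v) <= k * v * (k * v)] ->
  obstructionB d q1 q2.
Proof.
move=> /fits_sub[y [sy e1 e2]] /fits_sub[x1 [s1 e3 e4]] /fits_sub[x2 [s2 e5 e6]].
rewrite -e1 -e2 -e3 -e4 -e5 -e6 => /and3P[/eqP E N0 le].
by exists y, x1, x2.
Qed.

Lemma notin_lt2 q : 0 \notin q -> 1 \notin q -> forall u, u < 2 -> u \notin q.
Proof. by move=> q0 q1 [|[|]]. Qed.

Lemma not_caseB d q1 q2 : ~~ caseB_blocks d q1 q2 ->
  [/\ [/\ size d != 2, ~~ [&& size d == 3, size q1 == 2 & size q2 <= 4],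
      ~~ ((size d == 3) && ((size q1 == 1) || ((size q1 == 2) && (1 \in q1)))) &
      ~~ [&& size d == 3, 2 \in d & (size q1 == 1) || (size q1 == 2)]],
    [/\ ~~ ((size d == 3) && (1 \in d)), ~~ [&& size d == 4, sumn q1 == 2 & size q1 == 1],
      ~~ [&& size d == 4, size q1 == 1 & size q2 <= 4] &
      ~~ [&& size d == 4, 1 \in d & size q1 == 1]] &
    [/\ ~~ [&& (size d == 5) || (size d == 6), size q1 == 1 & size q2 == 2],
      ~~ ((sumn q1 == 1) && (size q1 == 1)),
      ~~ [&& sumn q1 == 2, size q1 == 1 & size q2 == 2] &
      ~~ ((size q1 == 1) && ((size q2 == 1) || ((size q2 == 2) && (1 \in q2))))]].
Proof.
rewrite /caseB_blocks.
by do 11![case/norP => ? ]; split; split.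
Qed.

Lemma not_caseC (d1 d2 : nat) q1 q2 q3 : ~~ caseC_blocks d1 d2 q1 q2 q3 ->
  [/\ 2 < minn d1 d2, ~~ ((minn d1 d2 == 3) && (size q1 == 1)),
    ~~ [&& (minn d1 d2 == 4) || (minn d1 d2 == 5), size q1 == 1 & size q2 == 2],
    ~~ ((sumn q1 == 1) && (size q1 == 1)) &
    [/\ ~~ [&& sumn q1 == 2, size q1 == 1 & size q2 == 2],
      ~~ ((size q1 == 1) && ((size q2 == 1) || ((size q2 == 2) && (1 \in q2)))) &
      ~~ [&& size q1 == 1, size q2 == 2 & size q3 <= 4]]].
Proof.
rewrite /caseC_blocks; case/norP; rewrite -ltnNge => ?.
by do 5![case/norP => ? ]; split=> //; split.
Qed.

Lemma obstructionB_whole d q1 q2 : 0 \notin d -> 0 \notin q1 -> 0 \notin q2 ->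
  3 < size d -> size q1 = 1 -> 0 < size q2 -> ~~ caseB_blocks d q1 q2 ->
  obstructionB d q1 q2.
Proof.
move=> d0 q10 q20 sd s1 s2 /not_caseB[_ [_ n6 n7 n8] [n9 n10 n11 n12]].
have p1 : 0 < sumn q1.
  by case: q1 s1 q10 {n6 n7 n8 n9 n10 n11 n12} => [|[|u] [|? ?]] //=.
have o1 q k : 0 \notin q -> k <= size q -> fits q k 1.
  by move=> q0 kq; apply: fits_all => // -[].
have p2 : 1 < sumn q1 by clear -p1 n10 s1; lia.
have [s2_3|s2_2] := leqP 3 (size q2).
  have [sd5|sd4] := leqP 5 (size d).
    by apply: (@obstructionB_fits _ _ _ 5 1 1 2 3 1); rewrite ?o1 //; apply: fits_whole.
  have sd4' : size d = 4 by clear -sd sd4; lia.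
  rewrite sd4' s1 /= in n6 n7 n8.
  apply: (@obstructionB_fits _ _ _ 4 2 1 3 5 1) => //.
  - apply: fits_all; first by rewrite sd4'.
    by apply: notin_lt2 => //; move: n8; rewrite andbT.
  - by apply: fits_whole => //; clear -p2 n6; lia.
  - by apply: o1 => //; clear -n7; lia.
rewrite s1 /= in n9 n10 n11 n12.
have s22 : size q2 = 2 by clear -s2 s2_2 n12; lia.
rewrite s22 /= in n9 n11 n12.
(* Failure of (B7) and (B9) leaves at least seven blocks in [d], failure of (B10) and (B11) makes
   the whole factor at least 3, and failure of (B12) excludes blocks of size 1 in [q2]. *)
apply: (@obstructionB_fits _ _ _ 7 1 1 3 2 2) => //.
- by apply: o1 => //; clear -n9 n7 sd s1 s22; lia.
- by apply: fits_whole => //; clear -n11 p2; lia.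
- apply: fits_all; first by rewrite s22.
  exact: notin_lt2.
Qed.

Lemma obstructionB_exists d q1 q2 : 0 \notin d -> 0 \notin q1 -> 0 \notin q2 ->
  1 < size d -> 0 < size q1 -> 0 < size q2 ->
  ~~ caseB_blocks d q1 q2 -> ~~ caseB_blocks d q2 q1 -> obstructionB d q1 q2.
Proof.
move=> d0 q10 q20 sd s1 s2 n12 n21.
have o1 q k : 0 \notin q -> k <= size q -> fits q k 1.
  by move=> q0 kq; apply: fits_all => // -[].
have [sd4|sd3] := leqP 4 (size d).
  have [s12|s11] := leqP 2 (size q1); last first.
    by apply: obstructionB_whole => //; apply/eqP; rewrite eqn_leq s1 -ltnS s11.
  have [s22|s21] := leqP 2 (size q2); last first.
    apply: obstructionB_sym; apply: obstructionB_whole => //.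
    by apply/eqP; rewrite eqn_leq s2 -ltnS s21.
  by apply: (@obstructionB_fits _ _ _ 4 1 2 1 2 1) => //; apply: o1.
have [[m1 _ _ _] [m5 _ _ _] _] := not_caseB n12.
have sd3' : size d = 3 by clear -sd sd3 m1; lia.
have d1 : 1 \notin d by move: m5; rewrite sd3'.
(* Failure of (B3) leaves exactly two blocks in [q], both of size at least 2; failure of (B2) gives
   five blocks in [q'], and failure of (B4) and (B5) makes the blocks of [d] at least 3. *)
have small q q' : 0 \notin q -> 0 \notin q' -> 0 < size q -> size q <= 2 ->
    ~~ caseB_blocks d q q' -> obstructionB d q q'.
  move=> q0 q'0 sq0 sq /not_caseB[[_ n2 n3 n4] _ _].
  rewrite sd3' /= in n2 n3 n4.
  have sq2 : size q = 2 by clear -sq0 sq n3; lia.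
  rewrite sq2 /= ?andbT in n2 n3 n4.
  apply: (@obstructionB_fits _ _ _ 3 3 2 2 5 1) => //.
  - apply: fits_all; first by rewrite sd3'.
    by move=> [|[|[|]]].
  - apply: fits_all; first by rewrite sq2.
    exact: notin_lt2.
  - by apply: o1 => //; rewrite ltnNge.
have [s13|s12] := leqP 3 (size q1); last exact: small.
have [s23|s22] := leqP 3 (size q2); last first.
  by apply: obstructionB_sym; apply: small.
apply: (@obstructionB_fits _ _ _ 3 2 3 1 3 1) => //; try exact: o1.
apply: fits_all; first by rewrite sd3'.
exact: notin_lt2.
Qed.

Definition obstructionC (d1 d2 : nat) q1 q2 q3 := exists y x1 x2 x3,
  [/\ sub_dims y [:: d1; d2], [/\ sub_dims x1 q1, sub_dims x2 q2 & sub_dims x3 q3],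
      sumn y = sumn x1 + sumn x2 + sumn x3, 0 < sumn y &
      (sumn x1 * sumn x1 + sumsq x1) + (sumn x2 * sumn x2 + sumsq x2) +
      (sumn x3 * sumn x3 + sumsq x3) + sumsq y <= sumn y * sumn y].

Lemma obstructionC_swap12 (d1 d2 : nat) q1 q2 q3 :
  obstructionC d1 d2 q1 q2 q3 -> obstructionC d1 d2 q2 q1 q3.
Proof.
move=> [y [x1 [x2 [x3 [sy [s1 s2 s3] E N0 le]]]]]; exists y, x2, x1, x3; split=> //.
  by rewrite E [sumn x1 + _]addnC.
by rewrite [in leqLHS](addnC (_ + sumsq x2)).
Qed.

Lemma obstructionC_swap23 (d1 d2 : nat) q1 q2 q3 :
  obstructionC d1 d2 q1 q2 q3 -> obstructionC d1 d2 q1 q3 q2.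
Proof.
move=> [y [x1 [x2 [x3 [sy [s1 s2 s3] E N0 le]]]]]; exists y, x1, x3, x2; split=> //.
  by rewrite E addnAC.
by rewrite [in leqLHS](addnAC _ (_ + sumsq x3)).
Qed.

(* Applied to the null vectors of [E6~], [E7~], [E8~], with [v = 3, 4, 6]. *)
Lemma obstructionC_fits (d1 d2 : nat) q1 q2 q3 v k1 v1 k2 v2 k3 v3 :
  v <= minn d1 d2 -> fits q1 k1 v1 -> fits q2 k2 v2 -> fits q3 k3 v3 ->
  [&& 2 * v == k1 * v1 + k2 * v2 + k3 * v3, 0 < 2 * v &
      (k1 * v1 * (k1 * v1) + k1 * (v1 * v1)) + (k2 * v2 * (k2 * v2) + k2 * (v2 * v2)) +
      (k3 * v3 * (k3 * v3) + k3 * (v3 * v3)) + 2 * (v * v) <= 2 * v * (2 * v)] ->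
  obstructionC d1 d2 q1 q2 q3.
Proof.
rewrite leq_min => /andP[vd1 vd2].
have /fits_sub[y [sy e1 e2]] : fits [:: d1; d2] 2 v by rewrite /fits /= vd1 vd2.
move=> /fits_sub[x1 [s1 e3 e4]] /fits_sub[x2 [s2 e5 e6]] /fits_sub[x3 [s3 e7 e8]].
rewrite -e1 -e2 -e3 -e4 -e5 -e6 -e7 -e8 => /and3P[/eqP E N0 le].
by exists y, x1, x2, x3.
Qed.

Lemma obstructionC_whole (d1 d2 : nat) q1 q2 q3 :
  0 \notin q1 -> 0 \notin q2 -> 0 \notin q3 ->
  size q1 = 1 -> 0 < size q2 -> 0 < size q3 ->
  ~~ caseC_blocks d1 d2 q1 q2 q3 -> ~~ caseC_blocks d1 d2 q1 q3 q2 ->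
  obstructionC d1 d2 q1 q2 q3.
Proof.
move=> q10 q20 q30 s1 s2 s3 n123 n132.
have o1 q k : 0 \notin q -> k <= size q -> fits q k 1.
  by move=> q0 kq; apply: fits_all => // -[].
have p1 : 0 < sumn q1.
  by case: q1 s1 q10 {n123 n132} => [|[|u] [|? ?]] //=.
have [m1 m2 _ m4 _] := not_caseC n123; rewrite s1 /= ?andbT in m2 m4.
have p2 : 1 < sumn q1 by rewrite ltn_neqAle eq_sym m4.
have d4 : 4 <= minn d1 d2 by rewrite ltn_neqAle eq_sym m2.
(* Failure of (C6) leaves two blocks of size at least 2 in [q]; failure of (C3) raises the smaller
   block of [P] to 6, failure of (C5) the whole factor to 3, and failure of (C7) the number of
   blocks of [q'] to five. *)
have small q q' : 0 \notin q -> 0 \notin q' -> 0 < size q -> size q <= 2 ->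
    ~~ caseC_blocks d1 d2 q1 q q' -> obstructionC d1 d2 q1 q q'.
  move=> q0 q'0 sq0 sq /not_caseC[_ _ n3 _ [n5 n6 n7]].
  rewrite s1 /= in n3 n5 n6 n7.
  have sq2 : size q = 2 by clear -sq0 sq n6; lia.
  rewrite sq2 /= ?andbT in n3 n5 n6 n7.
  apply: (@obstructionC_fits _ _ _ _ _ 6 1 3 2 2 5 1) => //.
  - move: (minn d1 d2) d4 n3 => k k4 n3; clear -k4 n3; lia.
  - by apply: fits_whole => //; clear -n5 p2; lia.
  - apply: fits_all; first by rewrite sq2.
    exact: notin_lt2.
  - by apply: o1 => //; rewrite ltnNge.
have [s23|s22] := leqP 3 (size q2); last exact: small.
have [s33|s32] := leqP 3 (size q3); last first.
  by apply: obstructionC_swap23; apply: small.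
apply: (@obstructionC_fits _ _ _ _ _ 4 1 2 3 1 3 1) => //; try exact: o1.
exact: fits_whole.
Qed.

Lemma obstructionC_exists (d1 d2 : nat) q1 q2 q3 :
  0 \notin q1 -> 0 \notin q2 -> 0 \notin q3 ->
  0 < size q1 -> 0 < size q2 -> 0 < size q3 ->
  ~~ caseC_blocks d1 d2 q1 q2 q3 -> ~~ caseC_blocks d1 d2 q1 q3 q2 ->
  ~~ caseC_blocks d1 d2 q2 q1 q3 -> ~~ caseC_blocks d1 d2 q2 q3 q1 ->
  ~~ caseC_blocks d1 d2 q3 q1 q2 -> ~~ caseC_blocks d1 d2 q3 q2 q1 ->
  obstructionC d1 d2 q1 q2 q3.
Proof.
move=> q10 q20 q30 s1 s2 s3 n123 n132 n213 n231 n312 n321.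
have o1 q k : 0 \notin q -> k <= size q -> fits q k 1.
  by move=> q0 kq; apply: fits_all => // -[].
have one k : 0 < k -> k < 2 -> k = 1 by case: k => [|[|]].
have [s12|s11] := leqP 2 (size q1).
  have [s22|s21] := leqP 2 (size q2).
    have [s32|s31] := leqP 2 (size q3).
      apply: (@obstructionC_fits _ _ _ _ _ 3 2 1 2 1 2 1) => //; try exact: o1.
      by have [] := not_caseC n123.
    apply: obstructionC_swap23; apply: obstructionC_swap12.
    by apply: obstructionC_whole => //; apply: one.
  by apply: obstructionC_swap12; apply: obstructionC_whole => //; apply: one.
by apply: obstructionC_whole => //; apply: one.
Qed.

(* The null vector of [D4~]: four lines in a plane. For [s = 3] one of the
   lines belongs to the flag of [P]. *)
Lemma obstruction_lines m d (q : 'I_m -> seq nat) k v s :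
  s <= m ->
  (forall c, 0 \notin q c) -> (forall c, 0 < size (q c)) -> fits d k v ->
  [&& k * v == s, 0 < k * v & 2 * s + k * (v * v) <= s * s] ->
  exists y (x : 'I_m -> seq nat), [/\ sub_dims y d, forall c, sub_dims (x c) (q c),
    sumn y = \sum_c sumn (x c), 0 < sumn y &
    \sum_c (sumn (x c) * sumn (x c) + sumsq (x c)) + sumsq y <= sumn y * sumn y].
Proof.
move=> sm q0 sq /fits_sub[y [sy e1 e2]] /and3P[/eqP E N0 le].
have [|S _ cS] := @exists_subset_card _ [set: 'I_m] s; first by rewrite cardsT card_ord.
rewrite -{s sm}cS in E le.
have H c : exists x, [/\ sub_dims x (q c), sumn x = (c \in S) & sumsq x = (c \in S)].
  have /fits_sub[x [sx e3 e4]] : fits (q c) (c \in S) 1.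
    by apply: fits_all => [|[]//]; apply: leq_trans (leq_b1 _) (sq c).
  by exists x; rewrite e3 e4 !muln1.
have [x xP] := choice H; exists y, x.
have sS : \sum_c (c \in S : nat) = #|S| by rewrite -sum1_card [RHS]big_mkcond; apply: eq_bigr => c _; case: (c \in S).
split=> //.
- by move=> c; case: (xP c).
- rewrite e1 E -sS; apply: eq_bigr => c _; by case: (xP c).
- by rewrite e1.
rewrite e1 e2 E; apply: leq_trans le; rewrite leq_add2r -sS big_distrr leq_sum // => c _.
by case: (xP c) => _ -> ->; case: (c \in S).
Qed.

End Patterns.

(** * Double cosets *)

Definition finitely_many_double_cosets (K : fieldType) n (RA RB : rel 'I_n) :=
  exists s : seq 'M[K]_n, forall g, g \in unitmx ->
    exists2 g', g' \in s & exists u v, [/\ u \in unitmx /\ incid RA u,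
      v \in unitmx /\ incid RB v & u *m g *m v = g'].

Section DoubleCosets.
Variables (K : closedFieldType) (n : nat) (RA RB : rel 'I_n).
Hypotheses (fA : chain_union RA) (fB : chain_union RB).

Lemma cornerT (a : 'M[K]_n) : corner [set: 'I_n] [set: 'I_n] a.
Proof. by split; rewrite idmT ?mul1mx ?mulmx1. Qed.

Lemma incid_unitT R (u : 'M[K]_n) : chain_union R ->
  (exists u', incid_unit R [set: 'I_n] u u') <-> u \in unitmx /\ incid R u.
Proof.
move=> [Rr Rt _]; split=> [[u' [[_ _ uu' _] uR _]]|[uu uR]].
  by split=> //; move: uu'; rewrite idmT => /mulmx1_unit[].
exists (invmx u); split=> //; last exact: incid_inv.
by split; rewrite ?idmT ?mulmxV ?mulVmx //; apply: cornerT.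
Qed.

Lemma finite_double_cosetsE :
  finitely_many_double_cosets K RA RB <-> finite_type K RA RB [set: 'I_n] [set: 'I_n].
Proof.
split=> [[s sP]|[s sP]]; exists s => g.
  move=> [h [_ _ gh _]]; have gu : g \in unitmx.
    by move: gh; rewrite idmT => /mulmx1_unit[].
  have [g' g's [u [v [/(incid_unitT _ fA)[u' uu'] /(incid_unitT _ fB)[v' vv'] E]]]] := sP g gu.
  by exists g' => //; exists u, u', v, v'.
move=> gu; have [|g' g's [u [u' [v [v' [uA vB E]]]]]] := sP g.
  by exists (invmx g); split; rewrite ?idmT ?mulmxV ?mulVmx //; apply: cornerT.
exists g' => //; exists u, v; split=> //.
  by apply/(incid_unitT _ fA); exists u'.
by apply/(incid_unitT _ fB); exists v'.
Qed.

End DoubleCosets.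

(** Index sets of equal size realize every admissible dimension vector. The inequality is twice the
    positivity of the Euler form: the single component of [P] contributes the square of the total,
    which cancels one of its two copies. *)
Theorem double_cosets_tits (K : closedFieldType) n m (comp : 'I_n -> 'I_m)
    (lev lev' : 'I_n -> nat) (q : 'I_m -> seq nat) (d : seq nat) :
  (forall x, lev x < size (q (comp x)))%N -> (forall x, lev' x < size d)%N ->
  (forall c, label_counts comp lev (fun c => size (q c)) [set: 'I_n] c = q c) ->
  label_counts (fun=> ord0) lev' (fun _ : 'I_1 => size d) [set: 'I_n] ord0 = d ->
  finitely_many_double_cosets K (label_rel comp lev)
    (label_rel (fun _ : 'I_n => ord0 : 'I_1) lev') <->
  forall (x : 'I_m -> seq nat) y, (forall c, sub_dims (x c) (q c)) -> sub_dims y d ->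
    sumn y = (\sum_c sumn (x c))%N -> (0 < sumn y)%N ->
    (sumn y * sumn y < \sum_c (sumn (x c) * sumn (x c) + sumsq (x c)) + sumsq y)%N.
Proof.
move=> ltA ltB qE dE.
have fA := label_rel_chain comp lev; have fB := label_rel_chain (fun _ : 'I_n => ord0 : 'I_1) lev'.
rewrite finite_double_cosetsE // finite_type_tits_form //.
have cA (I : {set 'I_n}) := card_labels (r := fun c => size (q c)) ltA I.
have cB (J : {set 'I_n}) := card_labels (comp := fun=> ord0 : 'I_1) (r := fun=> size d) ltB J.
have rA (I : {set 'I_n}) := card_rel_pos (r := fun c => size (q c)) ltA I.
have rB (J : {set 'I_n}) := card_rel_pos (comp := fun=> ord0 : 'I_1) (r := fun=> size d) ltB J.
have sub (t : seq nat) k (cmp : 'I_n -> 'I_k) l r (I : {set 'I_n}) c :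
    label_counts cmp l r [set: 'I_n] c = t -> sub_dims (label_counts cmp l r I c) t.
  move=> <-; split=> [|j]; first by rewrite !size_map.
  have [jr|jr] := ltnP j (r c); last by rewrite nth_default ?size_map ?size_iota.
  rewrite !(nth_map 0) ?size_iota // nth_iota // add0n.
  by apply: subset_leq_card; apply: setSI; apply: subsetT.
split=> [tp x y sx sy E y0|H I J I0 IJ].
  have [||I Ix] := @exists_counts n m comp lev (fun c => size (q c)) x.
  - by move=> c; case: (sx c).
  - move=> c j jr; case: (sx c) => _ /(_ j); rewrite -{1}(qE c) /label_counts.
    by rewrite (nth_map 0) ?size_iota // nth_iota // add0n setTI.
  have [||J Jy] := @exists_counts n 1 (fun=> ord0) lev' (fun=> size d) (fun=> y).
  - by case: sy.
  - move=> c j jr; case: sy => _ /(_ j); rewrite -{1}dE /label_counts.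
    by rewrite (nth_map 0) ?size_iota // nth_iota // add0n setTI (ord1 c).
  have cI : #|I| = sumn y by rewrite cA E; apply: eq_bigr => c _; rewrite Ix.
  have cJ : #|J| = sumn y by rewrite cB big_ord1 Jy.
  have := tp I J; rewrite -card_gt0 /tits_pos cI cJ => /(_ y0 erefl).
  have := rA I; under [in X in _ = X -> _]eq_bigr => c _ do rewrite Ix.
  by have := rB J; rewrite big_ord1 Jy; nia.
have := H (label_counts comp lev (fun c => size (q c)) I)
  (label_counts (fun=> ord0) lev' (fun _ : 'I_1 => size d) J ord0).
have cJ : #|J| = sumn (label_counts (fun=> ord0) lev' (fun _ : 'I_1 => size d) J ord0).
  by rewrite cB big_ord1.
rewrite -cA -rA -cJ; move/(_ (fun c => sub _ _ _ _ _ _ _ (qE c)) (sub _ _ _ _ _ _ _ dE)).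
rewrite IJ => /(_ erefl); rewrite -IJ card_gt0 => /(_ I0); rewrite IJ /tits_pos => lt.
by have := rB J; rewrite big_ord1 -cJ IJ; move: lt; nia.
Qed.

(** * Block sizes as label counts *)

Section BlockLabels.
Import tagnat.

Lemma card_reshape_index N (d : seq nat) j : sumn d = N -> (j < size d)%N ->
  #|[set a : 'I_N | reshape_index d a == j]| = nth 0%N d j.
Proof.
move=> <- jd; rewrite -[RHS]card_ord.
pose f (c : 'I_(nth 0%N d j)) : 'I_(sumn d) := Ordinal (flatten_indexP (ltn_ord c)).
have fi : injective f.
  move=> c c' /(congr1 val) /= /(congr1 (reshape_offset d)).
  by rewrite !flatten_indexKr // => /val_inj.
rewrite -(card_imset _ fi); apply: eq_card => a; rewrite inE; apply/eqP/imsetP.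
  move=> aj; have := reshape_offsetP (ltn_ord a); rewrite aj => lt.
  by exists (Ordinal lt) => //; apply: val_inj; rewrite /= -aj reshape_indexK.
by move=> [c _ ->]; rewrite /= flatten_indexKl.
Qed.

Lemma label_counts_blocks m (p : 'I_m -> nat) (q : 'I_m -> seq nat) c :
  (forall c, sumn (q c) = p c) ->
  label_counts (@sig1 _ p) (fun x => reshape_index (q (sig1 x)) (sig2 x))
    (fun c => size (q c)) [set: 'I_(\sum_i p i)] c = q c.
Proof.
move=> qp; apply: (@eq_from_nth _ 0%N); first by rewrite size_map size_iota.
move=> j; rewrite size_map size_iota => jq.
rewrite (nth_map 0%N) ?size_iota // nth_iota // add0n setTI -(card_reshape_index (qp c) jq).
have Ri : injective (@Rank _ p c).
  move=> a b ab; apply/val_inj/eqP; have := eq_Rank a b.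
  by rewrite ab !eqxx => /esym.

rewrite -(card_imset _ Ri); apply: eq_card => x; rewrite inE; apply/andP/imsetP.
  move=> [/eqP <- /eqP xj].
  by exists (sig2 x); rewrite ?sig2K // inE xj.
move=> [a]; rewrite inE => /eqP aj ->; split; first by rewrite Rank1K.
apply/eqP.
suff -> : reshape_index (q (sig1 (Rank c a))) (sig2 (Rank c a)) = reshape_index (q c) a by [].
have := rankK (Tagged (fun i => 'I_(p i)) a).
by rewrite /sig2 /sig1 /Rank => ->.
Qed.

Lemma label_counts_flag N (d : seq nat) : sumn d = N ->
  label_counts (fun=> ord0) (fun a : 'I_N => reshape_index d a)
    (fun _ : 'I_1 => size d) [set: 'I_N] ord0 = d.
Proof.
move=> dN; apply: (@eq_from_nth _ 0%N); first by rewrite size_map size_iota.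
move=> j; rewrite size_map size_iota => jd.
rewrite (nth_map 0%N) ?size_iota // nth_iota // add0n setTI -(card_reshape_index dN jd).
by apply: eq_card => a; rewrite !inE.
Qed.

End BlockLabels.

From mathcomp Require Import classical_sets functions cardinality.
Local Open Scope classical_set_scope.

(** * Orbits *)

Section Orbits.
Variables (K : fieldType) (N : nat).
Implicit Types (A H : set 'M[K]_N) (a b g l : 'M[K]_N).

Record mx_group H : Prop := MxGroup {
  mx_group_unit : forall a, H a -> a \in unitmx;
  mx_group1 : H 1%:M;
  mx_groupM : forall a b, H a -> H b -> H (a *m b);
  mx_groupV : forall a, H a -> H (invmx a) }.

Lemma translate1 A : translate 1%:M A = A.
Proof.
apply/seteqP; split=> [x [y Ay <-]|x Ax]; first by rewrite mul1mx.
by exists x; rewrite // mul1mx.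
Qed.

Lemma translateM a b A : translate a (translate b A) = translate (a *m b) A.
Proof.
apply/seteqP; split=> [x [_ [y Ay <-] <-]|x [y Ay <-]].
  by exists y; rewrite // mulmxA.
by exists (b *m y); [exists y|rewrite mulmxA].
Qed.

Lemma translate_id H a : mx_group H -> H a -> translate a H = H.
Proof.
move=> gH Ha; apply/seteqP; split=> [x [y Hy <-]|x Hx]; first exact: mx_groupM.
exists (invmx a *m x); first by apply: mx_groupM => //; apply: mx_groupV.
by rewrite mulKVmx ?(mx_group_unit gH).
Qed.

Lemma translate_eq H a b : mx_group H -> a \in unitmx -> b \in unitmx ->
  translate a H = translate b H -> H (invmx a *m b).
Proof.
move=> gH au bu E; have : translate b H b by exists 1%:M; rewrite ?mulmx1 //; apply: mx_group1.
by rewrite -E => -[x Hx <-]; rewrite mulKmx.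
Qed.

Lemma diag_orbit_refl L x : mx_group L -> diag_orbit L x x.
Proof.
move=> gL; exists 1%:M; first exact: mx_group1.
by rewrite !translate1 -surjective_pairing.
Qed.

Lemma diag_orbit_translate L x l : mx_group L -> L l ->
  diag_orbit L (translate l x.1, translate l x.2) = diag_orbit L x.
Proof.
move=> gL Ll; apply/seteqP; split=> y [k Lk <-] /=.
  by exists (k *m l); rewrite ?translateM //; apply: mx_groupM.
exists (k *m invmx l); first by apply: mx_groupM => //; apply: mx_groupV.
by rewrite !translateM mulmxKV ?(mx_group_unit gL).
Qed.

Definition finite_mod (H1 H2 : set 'M[K]_N) := exists s : seq 'M[K]_N,
  forall g, g \in unitmx -> exists2 g', g' \in s & exists u v, [/\ H1 u, H2 v & u *m g *m v = g'].

(** Every orbit has a point whose first coordinate is the coset [Q], and the stabilizer of that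
    coset in [L] is [Q]; what remains is the action of [Q] on the cosets of [P]. *)
Lemma finite_orbits_mod (L Q P : set 'M[K]_N) :
  mx_group L -> mx_group Q -> mx_group P -> Q `<=` L ->
  finite_set [set diag_orbit L x | x in coset_space L Q `*` coset_space (@GL K N) P] <->
  finite_mod Q P.
Proof.
move=> gL gQ gP QL.
pose O g := diag_orbit L (Q, translate g P).
have orbE l g : L l -> diag_orbit L (translate l Q, translate g P) = O (invmx l *m g).
  move=> Ll; have Ll' := mx_groupV gL Ll.
  rewrite -(diag_orbit_translate _ gL Ll') /= !translateM mulVmx ?translate1 //.
  exact: mx_group_unit Ll.
split=> [/finite_seqP[s sE]|[s sP]].
  (* One representative is chosen per listed set; sets that are not orbits of the form [O g1] get
     0. *)
  have H o : exists g, (exists2 g1, g1 \in unitmx & O g1 = o) -> g \in unitmx /\ O g = o.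
    by have [[g1 g1u E]|ng] := pselect (exists2 g1, g1 \in unitmx & O g1 = o); [exists g1|exists 0].
  have [c cP] := choice H.
  exists [seq c o | o <- s] => g gu.
  have Os : O g \in s.
    suff : [set` s] (O g) by [].
    rewrite -sE; exists (Q, translate g P) => //; split=> /=.
      by exists 1%:M; [exact: mx_group1|rewrite translate1].
    by exists g.
  have [|cu cE] := cP (O g); first by exists g.
  exists (c (O g)); first by apply/mapP; exists (O g).
  have : O g (Q, translate (c (O g)) P) by rewrite -{1}cE; apply: diag_orbit_refl.
  move=> [l Ll [lQ lP]].
  have Ql : Q l by rewrite -lQ; exists 1%:M; rewrite ?mulmx1 //; apply: mx_group1.
  have lu := mx_group_unit gQ Ql.
  move: lP; rewrite /= translateM => /(translate_eq gP _ cu).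
  rewrite unitmx_mul lu gu => /(_ isT) Pv.
  exists l, (invmx (l *m g) *m c (O g)); split=> //.
  by rewrite mulKVmx // unitmx_mul lu gu.
apply: (@sub_finite_set _ _ (O @` [set` s])); last exact: finite_image.
move=> o [[A B] [/= [l Ll <-] [g gu <-]] <-].
rewrite orbE //; have lu := mx_group_unit gL Ll.
have [|g' g's [u [v [Qu Pv E]]]] := sP (invmx l *m g).
  by rewrite unitmx_mul unitmx_inv lu.
exists g' => //; rewrite -E /O -translateM (translate_id gP Pv) -translateM.
by rewrite -{1}(translate_id gQ Qu) (diag_orbit_translate (Q, _) gL (QL _ Qu)).
Qed.

End Orbits.

(** * Conjugation to standard position *)

Section Conjugation.
Variables (K : fieldType) (N : nat).
Implicit Types (H : set 'M[K]_N) (g x y : 'M[K]_N).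

Definition conjugate x H : set 'M[K]_N := [set x *m h *m invmx x | h in H].

Lemma mx_group_conj x H : x \in unitmx -> mx_group H -> mx_group (conjugate x H).
Proof.
move=> xu gH; split.
- move=> _ [h Hh <-]; rewrite !unitmx_mul xu unitmx_inv xu andbT.
  exact: mx_group_unit Hh.
- by exists 1%:M; [apply: mx_group1|rewrite mulmx1 mulmxV].
- move=> _ _ [h Hh <-] [k Hk <-]; exists (h *m k); first exact: mx_groupM.
  by rewrite !mulmxA mulmxKV.
- move=> _ [h Hh <-]; exists (invmx h); first exact: mx_groupV.
  have hu := mx_group_unit gH Hh.
  apply: (can_inj (mulKmx (_ : x *m h *m invmx x \in unitmx))).
    by rewrite !unitmx_mul xu hu unitmx_inv.
  rewrite mulmxV ?unitmx_mul ?xu ?hu ?unitmx_inv // !mulmxA mulmxKV // mulmxK //.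
  by rewrite mulmxV.
Qed.

Lemma finite_mod_conj x y H1 H2 : x \in unitmx -> y \in unitmx ->
  finite_mod (conjugate x H1) (conjugate y H2) <-> finite_mod H1 H2.
Proof.
move=> xu yu; split=> -[s sP].
  exists [seq invmx x *m g *m y | g <- s] => g gu.
  have [|g' g's [_ [_ [[u Hu <-] [v Hv <-] E]]]] := sP (x *m g *m invmx y).
    by rewrite !unitmx_mul xu gu unitmx_inv.
  exists (invmx x *m g' *m y); first by apply/mapP; exists g'.
  exists u, v; split=> //.
  by rewrite -E !mulmxA mulVmx // mul1mx mulmxKV // mulmxKV // mulmxKV.
exists [seq x *m g *m invmx y | g <- s] => g gu.
have [|g' g's [u [v [Hu Hv E]]]] := sP (invmx x *m g *m y).
  by rewrite !unitmx_mul gu unitmx_inv xu.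
exists (x *m g' *m invmx y); first by apply/mapP; exists g'.
exists (x *m u *m invmx x), (y *m v *m invmx y); split; [by exists u|by exists v|].
by rewrite -E !mulmxA.
Qed.

Definition incid_group (R : rel 'I_N) : set 'M[K]_N := [set M | M \in unitmx /\ incid R M].

Lemma mx_group_incid R : reflexive R -> transitive R -> mx_group (incid_group R).
Proof.
move=> Rr Rt; split.
- by move=> a [].
- by split; [exact: unitmx1|rewrite -idmT; apply: incid_idm].
- by move=> a b [au aR] [bu bR]; split; [rewrite unitmx_mul au|apply: incidM].
- by move=> a [au aR]; split; [rewrite unitmx_inv|apply: incid_inv].
Qed.

Lemma finite_mod_incid RA RB : finite_mod (incid_group RA) (incid_group RB) <->
  finitely_many_double_cosets K RA RB.
Proof. by []. Qed.

End Conjugation.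

(** * Block diagonal groups as incidence groups *)

Section BlockDiagonal.
Variables (K : fieldType) (m : nat) (p : 'I_m -> nat).
Implicit Types (B C : forall i, 'M[K]_(p i)).
Import tagnat.

Lemma mxdiagM B C : \mxdiag_i B i *m \mxdiag_i C i = \mxdiag_i (B i *m C i).
Proof.
rewrite mul_mxdiag_mxblock; apply: eq_mxblock => i j.
case: eqP => [ij|_]; last by rewrite mulmx0.
by case: j / ij; rewrite !conform_mx_id.
Qed.

Lemma mxdiag1 : \mxdiag_i (1%:M : 'M[K]_(p i)) = 1%:M.
Proof. exact: mxdiagZ. Qed.

Lemma unitmx_mxdiag B : (forall i, B i \in unitmx) -> \mxdiag_i B i \in unitmx.
Proof.
move=> Bu; suff : \mxdiag_i B i *m \mxdiag_i invmx (B i) = 1%:M by case/mulmx1_unit.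
by rewrite mxdiagM -mxdiag1; apply: eq_mxdiag => i; rewrite mulmxV.
Qed.

Lemma invmx_mxdiag B : (forall i, B i \in unitmx) ->
  invmx (\mxdiag_i B i) = \mxdiag_i invmx (B i).
Proof.
move=> Bu; have u := unitmx_mxdiag Bu.
apply: (can_inj (mulKmx u)); rewrite mulmxV // mxdiagM -mxdiag1.
by apply: eq_mxdiag => i; rewrite mulmxV.
Qed.

Variable l : forall i, 'I_(p i) -> nat.
Definition block_label (x : 'I_(\sum_i p i)) : nat := l (sig2 x).

Lemma mxdiag_entry B i (a b : 'I_(p i)) : (\mxdiag_i B i) (Rank i a) (Rank i b) = B i a b.
Proof.
have : submxblock (\mxdiag_i B i) i i = B i by exact: submxblock_diag.
by move/matrixP/(_ a b) => <-; rewrite /submxblock [RHS]mxE.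
Qed.

Lemma mxdiag_off B x y : sig1 x != sig1 y -> (\mxdiag_i B i) x y = 0.
Proof. by move=> /negPf xy; rewrite /mxdiag mxE xy mxE. Qed.

Lemma block_label_Rank i (a : 'I_(p i)) : block_label (Rank i a) = l a.
Proof.
rewrite /block_label /sig2 /sig1; have := rankK (Tagged (fun i => 'I_(p i)) a).
by rewrite /Rank => ->.
Qed.

(** A matrix respecting the labels has no entries between different components, so it is made of its
    diagonal blocks; these are invertible because the inverse respects the labels too. *)
Lemma block_diag_prod_incid :
  block_diag_prod (fun i => [set M : 'M[K]_(p i) | M \in unitmx /\
     forall a b, (l b < l a)%N -> M a b = 0]) =
  incid_group (label_rel (@sig1 _ p) block_label).
Proof.
have fR := label_rel_chain (@sig1 _ p) block_label; have [Rr Rt _] := fR.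
have nzP B : (forall i a b, (l b < l a)%N -> B i a b = 0) ->
    incid (label_rel (@sig1 _ p) block_label) (\mxdiag_i B i).
  move=> Bl x y; rewrite -(sig2K x) -(sig2K y) /label_rel !Rank1K.
  move: (sig1 x) (sig2 x) (sig1 y) (sig2 y) => i a j b; rewrite !block_label_Rank.
  have [ij|ij] := eqVneq i j; last first.
    by move=> _; rewrite mxdiag_off // !Rank1K.
  by case: j / ij b => b /=; rewrite -ltnNge mxdiag_entry; apply: Bl.
apply/seteqP; split=> [_ [B BP <-]|M [Mu MR]].
  split; first by apply: unitmx_mxdiag => i; case: (BP i).
  by apply: nzP => i a b; case: (BP i) => _; apply.
pose D (M : 'M[K]_(\sum_i p i)) i := submxblock M i i.
have DE (M' : 'M[K]_(\sum_i p i)) : incid (label_rel (@sig1 _ p) block_label) M' -> M' = \mxdiag_i D M' i.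
  move=> M'R; apply/matrixP => x y; rewrite -(sig2K x) -(sig2K y).
  move: (sig1 x) (sig2 x) (sig1 y) (sig2 y) => i a j b.
  have [ij|ij] := eqVneq i j; last first.
    rewrite M'R ?/label_rel ?Rank1K ?(negPf ij) //.
    by rewrite mxdiag_off // !Rank1K.
  by case: j / ij b => b; rewrite mxdiag_entry mxE.
exists (D M); last by rewrite -DE.
move=> i; split.
  have ME := DE _ MR; have VE := DE _ (incid_inv Rr Rt MR Mu).
  have : \mxdiag_i (D M i *m D (invmx M) i) = \mxdiag_i (1%:M : 'M[K]_(p i)).
    by rewrite -mxdiagM -ME -VE mulmxV // mxdiag1.
  by move/eq_mxdiagP/(_ i) => /mulmx1_unit[].
move=> a b lt; rewrite mxE; apply: MR.
by rewrite /label_rel !block_label_Rank [(_ <= _)%N]leqNgt lt andbF.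
Qed.

End BlockDiagonal.

(** * Block sizes of parabolic subgroups *)

Section Parabolics.
Variables (K : fieldType) (N : nat).
Implicit Types (H : parabolic K N).

Lemma sumn_blocks H : sumn (blocks H) = N.
Proof. by case: H => [A d /= /andP[_ /eqP]]. Qed.

Lemma blocks_gt0 H : 0%N \notin blocks H.
Proof. by case: H => [A d /= /andP[]]. Qed.

Lemma size_blocks_gt0 H : (0 < N)%N -> (0 < size (blocks H))%N.
Proof. by move=> N0; case E : (blocks H) => //; move: N0; rewrite -(sumn_blocks H) E. Qed.

Lemma std_parabolicE (d : seq nat) :
  @std_parabolic K N d =
  incid_group (label_rel (fun _ : 'I_N => ord0 : 'I_1) (fun a => reshape_index d a)).
Proof.
apply/seteqP; split=> M [Mu M0]; split=> // i j.
  by rewrite /label_rel eqxx /= -ltnNge; apply: M0.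
by move=> lt; apply: M0; rewrite /label_rel eqxx /= -ltnNge.
Qed.

Lemma mx_group_std (d : seq nat) : mx_group (@std_parabolic K N d).
Proof.
rewrite std_parabolicE.
by have [? ? _] := label_rel_chain (fun _ : 'I_N => ord0 : 'I_1) (fun a => reshape_index d a); apply: mx_group_incid.
Qed.

Lemma conjugate_GL (g : 'M[K]_N) : g \in unitmx -> conjugate g (@GL K N) = @GL K N.
Proof.
move=> gu; apply/seteqP; split=> [_ [h hu <-]|h hu].
  by rewrite /GL /= !unitmx_mul gu unitmx_inv gu andbT.
exists (invmx g *m h *m g); first by rewrite /GL /= !unitmx_mul unitmx_inv gu [h \in _]hu.
by rewrite !mulmxA mulmxV // mul1mx mulmxK.
Qed.

Lemma std_parabolic_whole (d : seq nat) : sumn d = N -> (size d <= 1)%N ->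
  @std_parabolic K N d = @GL K N.
Proof.
move=> dN sd; apply/seteqP; split=> [M []//|M Mu]; split=> // i j.
have := @reshape_indexP d i; rewrite dN ltn_ord => /(_ isT) lt.
by move/leq_ltn_trans/(_ (leq_trans lt sd)).
Qed.

(** A transvection whose entry lies in the second block row and the first block column is
    missing. *)
Lemma std_parabolic_proper (d : seq nat) : sumn d = N -> 0%N \notin d -> (1 < size d)%N ->
  @std_parabolic K N d <> @GL K N.
Proof.
move=> dN d0 sd E.
have idx r : (r < size d)%N -> exists i : 'I_N, reshape_index d i = r.
  move=> rd; have c0 : (0 < nth 0 d r)%N.
    by rewrite lt0n; apply: contraNneq d0 => <-; apply: mem_nth.
  have lt := flatten_indexP c0; rewrite dN in lt.
  by exists (Ordinal lt); rewrite /= flatten_indexKl.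
have [i i1] := idx 1%N sd; have [j j0] := idx 0%N (ltnW sd).
have ij : i != j by apply/eqP => ij; move: i1; rewrite ij j0.
have : (@GL K N) (1%:M + delta_mx i j).
  have : (1%:M + delta_mx i j) *m (1%:M - delta_mx i j) = 1%:M :> 'M[K]_N.
    rewrite mulmxBr mulmx1 mulmxDl mul1mx mul_delta_mx_0 1?eq_sym // addr0.
    by rewrite addrK.
  by case/mulmx1_unit.
rewrite -E => -[_ /(_ i j)]; rewrite i1 j0 => /(_ isT)/eqP.
by rewrite !mxE (negPf ij) !eqxx add0r oner_eq0.
Qed.

(** Positivity of [N] matters: for [N = 0] the whole group has an empty list of blocks. *)
Lemma is_wholeE H : (0 < N)%N -> is_whole H <-> size (blocks H) = 1%N.
Proof.
move=> N0; have s0 := size_blocks_gt0 H N0; have [g gu E] := par_conj H.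
rewrite /is_whole E -/(conjugate g _); split=> [W|s1].
  apply/eqP; rewrite eqn_leq s0 andbT leqNgt; apply/negP => s1.
  apply: (std_parabolic_proper (sumn_blocks H) (blocks_gt0 H) s1).
  apply/seteqP; split=> [M []//|M Mu].
  have : conjugate g (@std_parabolic K N (blocks H)) (g *m M *m invmx g).
    by rewrite W /GL /= !unitmx_mul gu unitmx_inv gu [M \in _]Mu.
  move=> [h Hh /(can_inj (mulmxK _))]; rewrite unitmx_inv => /(_ gu).
  by move/(can_inj (mulKmx gu)) <-.
by rewrite std_parabolic_whole ?sumn_blocks ?s1 ?conjugate_GL.
Qed.

Lemma proper_nblocks H : par_set H `<` @GL K N -> (1 < size (blocks H))%N.
Proof.
rewrite properEneq => -[/eqP nE _]; rewrite ltnNge; apply/negP => s1; apply: nE.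
have [g gu ->] := par_conj H.
by rewrite std_parabolic_whole ?sumn_blocks // -/(conjugate g _) conjugate_GL.
Qed.

Lemma is_mirabolicE H : is_mirabolic H <-> (size (blocks H) == 2%N) && (1%N \in blocks H).
Proof.
have := sumn_blocks H; rewrite /is_mirabolic => HN; split=> [[->|->]|].
- by rewrite !inE.
- by rewrite !inE orbT.
case/andP => /eqP; case: (blocks H) HN => [|a [|b [|? ?]]] //= ab _.
rewrite addn0 in ab; rewrite !inE => /orP[]/eqP E; [left|right].
  by rewrite -ab -E addKn.
by rewrite -ab -E addnK.
Qed.

End Parabolics.

(** * The classification *)

Lemma caseB_blocksE (K : fieldType) n p1 p2 (P : parabolic K n)
    (Q1 : parabolic K p1) (Q2 : parabolic K p2) : (0 < p1)%N -> (0 < p2)%N ->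
  caseB P Q1 Q2 <-> caseB_blocks (blocks P) (blocks Q1) (blocks Q2).
Proof.
move=> p1_gt0 p2_gt0; have W1 := is_wholeE Q1 p1_gt0; have W2 := is_wholeE Q2 p2_gt0.
have M1 := is_mirabolicE Q1; have M2 := is_mirabolicE Q2.
have m1 H : (size (blocks Q1) == 1%N) || H <-> is_whole Q1 \/ H.
  by rewrite W1; split=> [/orP[/eqP|]|[->|->]]; rewrite ?orbT; [left|right|..].
have m2 H : (size (blocks Q2) == 1%N) || H <-> is_whole Q2 \/ H.
  by rewrite W2; split=> [/orP[/eqP|]|[->|->]]; rewrite ?orbT; [left|right|..].
rewrite /caseB_blocks !sumn_blocks; split.
  case; rewrite /is_maximal /nblocks.
  - by move=> ->.
  - by move=> -> -> ->; rewrite !orbT.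
  - by move=> -> H; rewrite (proj2 (m1 _)) ?orbT //; case: H => [?|/M1]; [left|right].
  - move=> -> -> H; have -> : (size (blocks Q1) == 1%N) || (size (blocks Q1) == 2%N).
      by apply/m1; case: H => [?|->]; [left|right].
    by rewrite !orbT.
  - by move=> -> ->; rewrite !orbT.
  - by move=> -> /eqP e /W1 ->; rewrite e !orbT.
  - by move=> -> /W1 -> ->; rewrite !orbT.
  - by move=> -> -> /W1 ->; rewrite !orbT.
  - by move=> H /W1 -> ->; case: H => ->; rewrite !orbT.
  - by move=> /eqP e /W1 ->; rewrite e !orbT.
  - by move=> /eqP e /W1 -> ->; rewrite e !orbT.
  - move=> /W1 -> H; rewrite (proj2 (m2 _)) ?orbT //.
    by case: H => [?|/M2]; [left|right].
case/or4P => [/eqP|/and3P[/eqP ? /eqP ? ?]|/andP[/eqP ? /m1 H]|].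
- exact: B1.
- exact: B2.
- by apply: B3 => //; case: H => [|/M1]; [left|right].
case/or4P => [/and3P[/eqP ? ? /m1 H]|/andP[/eqP ? ?]|/and3P[/eqP ? /eqP ? /eqP/W1 ?]|].
- by apply: B4 => //; case: H => [|/eqP]; [left|right].
- exact: B5.
- exact: B6.
case/or4P => [/and3P[/eqP ? /eqP/W1 ? ?]|/and3P[/eqP ? ? /eqP/W1 ?]|/and3P[H /eqP/W1 ? /eqP ?]|].
- exact: B7.
- exact: B8.
- by apply: B9 => //; case/orP: H => /eqP; [left|right].
case/or3P => [/andP[/eqP ? /eqP/W1 ?]|/and3P[/eqP ? /eqP/W1 ? /eqP ?]|/andP[/eqP/W1 ? /m2 H]].
- exact: B10.
- exact: B11.
- by apply: B12 => //; case: H => [|/M2]; [left|right].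
Qed.

Lemma caseC_blocksE (K : fieldType) d1 d2 p1 p2 p3 (Q1 : parabolic K p1)
    (Q2 : parabolic K p2) (Q3 : parabolic K p3) : (0 < p1)%N -> (0 < p2)%N ->
  caseC d1 d2 Q1 Q2 Q3 <-> caseC_blocks d1 d2 (blocks Q1) (blocks Q2) (blocks Q3).
Proof.
move=> p1_gt0 p2_gt0; have W1 := is_wholeE Q1 p1_gt0; have W2 := is_wholeE Q2 p2_gt0.
have M2 := is_mirabolicE Q2.
have m2 H : (size (blocks Q2) == 1%N) || H <-> is_whole Q2 \/ H.
  by rewrite W2; split=> [/orP[/eqP|]|[->|->]]; rewrite ?orbT; [left|right|..].
rewrite /caseC_blocks !sumn_blocks; split.
  case; rewrite /is_maximal /nblocks.
  - by move=> ->.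
  - by move=> -> /W1 ->; rewrite !orbT.
  - by move=> H /W1 -> ->; case: H => ->; rewrite !orbT.
  - by move=> /eqP e /W1 ->; rewrite e !orbT.
  - by move=> /eqP e /W1 -> ->; rewrite e !orbT.
  - move=> /W1 -> H; rewrite (proj2 (m2 _)) ?orbT //.
    by case: H => [?|/M2]; [left|right].
  - by move=> /W1 -> -> ->; rewrite !orbT.
case/or4P => [|/andP[/eqP ? /eqP/W1 ?]|/and3P[H /eqP/W1 ? /eqP ?]|].
- exact: C1.
- exact: C2.
- by apply: C3 => //; case/orP: H => /eqP; [left|right].
case/or4P => [/andP[/eqP ? /eqP/W1 ?]|/and3P[/eqP ? /eqP/W1 ? /eqP ?]|/andP[/eqP/W1 ? /m2 H]|/and3P[/eqP/W1 ? /eqP ? ?]].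
- exact: C4.
- exact: C5.
- by apply: C6 => //; case: H => [|/M2]; [left|right].
- exact: C7.
Qed.

Lemma block_diag_prod_conj (K : fieldType) m (p : 'I_m -> nat)
    (y : forall i, 'M[K]_(p i)) (A : forall i, set 'M[K]_(p i)) :
  (forall i, y i \in unitmx) ->
  block_diag_prod (fun i => conjugate (y i) (A i)) =
  conjugate (\mxdiag_i y i) (block_diag_prod A).
Proof.
move=> yu; apply/seteqP; split=> [_ [B BP <-]|_ [_ [B BP <-] <-]].
  have H i : exists b, A i b /\ y i *m b *m invmx (y i) = B i.
    by case: (BP i) => b; exists b.
  exists (\mxdiag_i sval (cid (H i))).
    by exists (fun i => sval (cid (H i))) => // i; case: (cid (H i)) => b [].
  rewrite invmx_mxdiag // !mxdiagM; apply: eq_mxdiag => i.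
  by case: (cid (H i)) => b [].
exists (fun i => y i *m B i *m invmx (y i)); first by move=> i; exists (B i).
by rewrite invmx_mxdiag // !mxdiagM.
Qed.

Section Main.
Import tagnat.
Variables (K : closedFieldType) (m : nat) (p : 'I_m -> nat).
Variables (P : parabolic K (\sum_i p i)) (Q : forall i : 'I_m, parabolic K (p i)).

Definition tits_form_gt0 := forall (x : 'I_m -> seq nat) y,
  (forall c, sub_dims (x c) (blocks (Q c))) -> sub_dims y (blocks P) ->
  sumn y = (\sum_c sumn (x c))%N -> (0 < sumn y)%N ->
  (sumn y * sumn y < \sum_c (sumn (x c) * sumn (x c) + sumsq (x c)) + sumsq y)%N.

(** Conjugation by [g] and by the block diagonal matrix of the [y i] brings [P] and the [Q i] to
    standard position, which preserves finiteness of the set of double cosets. *)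
Lemma finitely_many_orbitsE : finitely_many_orbits P Q <-> tits_form_gt0.
Proof.
have [g gu PE] := par_conj P.
have [y yP] : exists y : forall i, 'M[K]_(p i), forall i, y i \in unitmx /\
    par_set (Q i) = conjugate (y i) (@std_parabolic K (p i) (blocks (Q i))).
  have H i : exists y : 'M[K]_(p i), y \in unitmx /\
      par_set (Q i) = conjugate y (@std_parabolic K (p i) (blocks (Q i))).
    by have [y yu E] := par_conj (Q i); exists y.
  by exists (fun i => sval (cid (H i))) => i; case: (cid (H i)).
have yu i : y i \in unitmx by case: (yP i).
pose l i (a : 'I_(p i)) := reshape_index (blocks (Q i)) a.
have QE : block_diag_prod (fun i => par_set (Q i)) =
    conjugate (\mxdiag_i y i) (incid_group (label_rel (@sig1 _ p) (block_label l))).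
  rewrite -block_diag_prod_incid -block_diag_prod_conj //.
  congr block_diag_prod; apply: functional_extensionality_dep => i.
  by case: (yP i).
(* With a single level per factor the triangularity condition is empty, so the Levi subgroup is an
   incidence group as well. *)
have LE : @levi K m p = incid_group (label_rel (@sig1 _ p) (block_label (fun i _ => 0%N))).
  rewrite -block_diag_prod_incid /levi; congr block_diag_prod.
  apply: functional_extensionality_dep => i.
  by apply/seteqP; split=> M; [move=> Mu; split|case].
have gL : mx_group (@levi K m p).
  have [Rr Rt _] := label_rel_chain (@sig1 _ p) (block_label (fun i _ => 0%N)).
  by rewrite LE; apply: mx_group_incid.
have Yu := unitmx_mxdiag yu.
have gQ : mx_group (block_diag_prod (fun i => par_set (Q i))).
  have [Rr Rt _] := label_rel_chain (@sig1 _ p) (block_label l).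
  by rewrite QE; apply: mx_group_conj => //; apply: mx_group_incid.
have gP : mx_group (par_set P).
  by rewrite PE; apply: (mx_group_conj gu); apply: mx_group_std.
rewrite /finitely_many_orbits /double_flag_variety finite_orbits_mod //; last first.
  move=> _ [B BP <-]; exists B => // i; have [yiu QiE] := yP i.
  by have := BP i; rewrite QiE => /(mx_group_unit (mx_group_conj yiu (mx_group_std _ _ _))).
rewrite QE PE -/(conjugate g _) finite_mod_conj // std_parabolicE finite_mod_incid.
apply: (@double_cosets_tits K _ m _ _ _ (fun c => blocks (Q c)) (blocks P)) => //.
- move=> x; rewrite /block_label /l; apply: reshape_indexP.
  by rewrite sumn_blocks ltn_ord.
- by move=> x; apply: reshape_indexP; rewrite sumn_blocks ltn_ord.
- by move=> c; apply: label_counts_blocks => c'; apply: sumn_blocks.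
- by apply: label_counts_flag; apply: sumn_blocks.
Qed.

End Main.

Lemma sum_uniq m (s : seq 'I_m) (F : 'I_m -> nat) : uniq s -> size s = m ->
  (\sum_c F c = \sum_(c <- s) F c)%N.
Proof.
move=> us sm; apply: perm_big; apply: uniq_perm; rewrite ?index_enum_uniq // => c.
have sub : {subset s <= index_enum 'I_m} by move=> x _; rewrite mem_index_enum.
have le : (size (index_enum 'I_m) <= size s)%N.
  by rewrite /index_enum -enumT size_enum_ord sm.
by have [_ ->] := uniq_min_size us sub le.
Qed.

Lemma sub_dims0 q : sub_dims (nseq (size q) 0%N) q.
Proof. by split=> [|j]; rewrite ?size_nseq // nth_nseq if_same. Qed.

Theorem theorem1p2 (K : closedFieldType) (charK0 : [pchar K] =i pred0)
    (m : nat) (p : 'I_m -> nat) (p_ge1 : forall i, (1 <= p i)%N)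
    (P : parabolic K (\sum_i p i)) (P_proper : par_set P `<` @GL K (\sum_i p i))
    (Q : forall i : 'I_m, parabolic K (p i)) :
  finitely_many_orbits P Q <->
  [\/ m = 1%N,
      m = 2%N /\
        (exists i1 i2 : 'I_m, uniq [:: i1; i2] /\ caseB P (Q i1) (Q i2)),
      m = 3%N /\
        (exists d1 d2 : nat, blocks P = [:: d1; d2] /\
          exists i1 i2 i3 : 'I_m, uniq [:: i1; i2; i3] /\
            caseC d1 d2 (Q i1) (Q i2) (Q i3))
    | (4 <= m)%N /\ is_mirabolic P].
Proof.
rewrite finitely_many_orbitsE.
have P2 := proper_nblocks P_proper; have P0 := blocks_gt0 P.
have Q0 i := blocks_gt0 (Q i); have Q1 i := size_blocks_gt0 (Q i) (p_ge1 i).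
split=> [tits|[m1|[m2 [i1 [i2 [ui /(caseB_blocksE _ _ _ (p_ge1 i1) (p_ge1 i2)) cB]]]]|
    [m3 [d1 [d2 [PE [i1 [i2 [i3 [ui /(caseC_blocksE _ _ _ _ _ (p_ge1 i1) (p_ge1 i2)) cC]]]]]]]]|
    [m4 /is_mirabolicE/andP[sP P1]]] x y sx sy E y0].
(* Without factors the total size is 0, whereas a proper parabolic subgroup has at least two blocks
   of positive size. *)
- have [m0|m_gt0] := posnP m.
    have N0 : (\sum_i p i = 0)%N by apply: big1 => -[i im] _; suff : (i < 0)%N by []; rewrite -m0.
    have s0 := etrans (sumn_blocks P) N0; exfalso.
    by move: s0 P2 P0; case: (blocks P) => [|[|a] s].
  have [m1|m1] := eqVneq m 1%N; first by constructor 1.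
  have [m2|m2] := eqVneq m 2%N.
    constructor 2; split=> //; apply: contrapT => nB.
    have [i1 [i2 ui]] : exists i1 i2 : 'I_m, uniq [:: i1; i2].
      by subst m; exists ord0, ord_max.
    have nB' j1 j2 : uniq [:: j1; j2] -> ~~ caseB_blocks (blocks P) (blocks (Q j1)) (blocks (Q j2)).
      by move=> uj; apply/negP => /caseB_blocksE cB; apply: nB; exists j1, j2; split=> //; apply: cB.
    have [||y [x1 [x2 [sy [s1 s2] E y0 le]]]] :=
      obstructionB_exists P0 (Q0 i1) (Q0 i2) P2 (Q1 i1) (Q1 i2).
    + exact: nB'.
    + by apply: nB'; move: ui; rewrite /= !inE eq_sym.
    have i12 : i2 == i1 = false by move: ui; rewrite /= !inE andbT eq_sym => /negPf.
    have sumE (F : 'I_m -> nat) : (\sum_c F c = F i1 + F i2)%N.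
      by rewrite (sum_uniq _ ui) ?m2 // !big_cons big_nil addn0.
    have [xs [e1 e2 xsS]] : exists xs : 'I_m -> seq nat, [/\ xs i1 = x1, xs i2 = x2 &
        forall c, sub_dims (xs c) (blocks (Q c))].
      exists (fun c => if c == i1 then x1 else if c == i2 then x2 else nseq (size (blocks (Q c))) 0%N).
      rewrite !eqxx i12; split=> // c.
      by case: eqP => [->//|_]; case: eqP => [->//|_]; apply: sub_dims0.
    have := tits xs y xsS sy; rewrite !sumE e1 e2 => /(_ E y0).
    by rewrite ltnNge le.
  have lines k v s : (s <= m)%N -> fits (blocks P) k v ->
      [&& k * v == s, 0 < k * v & 2 * s + k * (v * v) <= s * s]%N -> False.
    move=> sm fP num.
    have [y [x [sy sx E y0]]] := obstruction_lines sm Q0 Q1 fP num.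
    by rewrite leqNgt => /negP; apply; apply: tits.
  have m_gt2 : (2 < m)%N by clear -m_gt0 m1 m2; lia.
  have [sP3|sP2] := leqP 3 (size (blocks P)).
    (* From three factors on, a third block of [P] is already an obstruction, so [P] is maximal in
       what follows. *)
    case: (@lines 3 1 3 m_gt2 _ _)%N => //; apply: fits_all => //.
    by move=> [|].
  have sP : size (blocks P) = 2%N by apply/eqP; rewrite eqn_leq -ltnS sP2 P2.
  have [d1 [d2 PE]] : exists d1 d2, blocks P = [:: d1; d2].
    by case: (blocks P) sP => [|d1 [|d2 [|? ?]]] // _; exists d1, d2.
  have [m3|m3] := eqVneq m 3%N.
    constructor 3; split=> //; exists d1, d2; split=> //; apply: contrapT => nC.
    have [i1 [i2 [i3 ui]]] : exists i1 i2 i3 : 'I_m, uniq [:: i1; i2; i3].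
      by subst m; exists ord0, (inord 1), ord_max; rewrite /= !inE -!val_eqE /= inordK.
    have nC' j1 j2 j3 : uniq [:: j1; j2; j3] ->
        ~~ caseC_blocks d1 d2 (blocks (Q j1)) (blocks (Q j2)) (blocks (Q j3)).
      move=> uj; apply/negP => /caseC_blocksE cC; apply: nC; exists j1, j2, j3; split=> //.
      exact: cC.
    have [i12 i13 i23] : [/\ i1 != i2, i1 != i3 & i2 != i3].
      by move: ui; rewrite /= !inE negb_or !andbT => /andP[/andP[]].
    have nC3 j1 j2 j3 : j1 != j2 -> j1 != j3 -> j2 != j3 ->
        ~~ caseC_blocks d1 d2 (blocks (Q j1)) (blocks (Q j2)) (blocks (Q j3)).
      by move=> j12 j13 j23; apply: nC'; rewrite /= !inE negb_or j12 j13 j23.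
    have i21 : i2 != i1 by rewrite eq_sym.
    have i31 : i3 != i1 by rewrite eq_sym.
    have i32 : i3 != i2 by rewrite eq_sym.
    have [y [x1 [x2 [x3 [sy [s1 s2 s3] E y0 le]]]]] :=
      obstructionC_exists (Q0 i1) (Q0 i2) (Q0 i3) (Q1 i1) (Q1 i2) (Q1 i3)
        (nC3 _ _ _ i12 i13 i23) (nC3 _ _ _ i13 i12 i32) (nC3 _ _ _ i21 i23 i13)
        (nC3 _ _ _ i23 i21 i31) (nC3 _ _ _ i31 i32 i12) (nC3 _ _ _ i32 i31 i21).
    have sumE (F : 'I_m -> nat) : (\sum_c F c = F i1 + F i2 + F i3)%N.
      by rewrite (sum_uniq _ ui) ?m3 // !big_cons big_nil addn0 addnA.
    have [xs [[e1 e2 e3] xsS]] : exists xs : 'I_m -> seq nat,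
        [/\ xs i1 = x1, xs i2 = x2 & xs i3 = x3] /\ forall c, sub_dims (xs c) (blocks (Q c)).
      exists (fun c => if c == i1 then x1 else if c == i2 then x2 else if c == i3 then x3
        else nseq (size (blocks (Q c))) 0%N).
      rewrite !eqxx (negPf i21) (negPf i31) (negPf i32).
      split=> // c; case: eqP => [->//|_]; case: eqP => [->//|_]; case: eqP => [->//|_].
      exact: sub_dims0.
    have := tits xs y xsS; rewrite PE => /(_ sy); rewrite !sumE e1 e2 e3 => /(_ E y0).
    by rewrite ltnNge le.
  constructor 4; split; first by clear -m_gt2 m3; lia.
  apply/is_mirabolicE; rewrite sP eqxx /=; apply: contraT => P1.
  case: (@lines 2 2 4 _ _ _)%N => //; first by clear -m_gt2 m3; lia.
  by apply: fits_all; [rewrite sP|apply: notin_lt2].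
- subst m; rewrite !big_ord1 in E *; rewrite E in y0 *.
  have := sumn_le_sumsq (x ord0); lia.
- have sumE (F : 'I_m -> nat) : (\sum_c F c = F i1 + F i2)%N.
    by rewrite (sum_uniq _ ui) ?m2 // !big_cons big_nil addn0.
  rewrite sumE in E; rewrite sumE; exact: caseB_tits cB sy (sx i1) (sx i2) E y0.
- have sumE (F : 'I_m -> nat) : (\sum_c F c = F i1 + F i2 + F i3)%N.
    by rewrite (sum_uniq _ ui) ?m3 // !big_cons big_nil addn0 addnA.
  rewrite sumE in E; rewrite sumE; rewrite PE in sy.
  exact: caseC_tits cC sy (sx i1) (sx i2) (sx i3) E y0.
- have [d1 [d2 [PE d12]]] : exists d1 d2, blocks P = [:: d1; d2] /\ (minn d1 d2 <= 1)%N.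
    case: (blocks P) sP P1 => [|d1 [|d2 [|? ?]]] // _; rewrite !inE => H; exists d1, d2.
    by split=> //; rewrite geq_min; case/orP: H => /eqP <-; rewrite leqnn ?orbT.
  by rewrite PE in sy; apply: mirabolic_tits d12 sy E y0.
Qed.
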